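(* Let $X$ be a real Hilbert space, $0<\alpha<1$, $T>0$, and let $A:X\supset\mathcal{D}(A)\to X$ be a closed densely defined linear operator such that $\{\lambda\in\mathbb{R};\ \lambda>0\}\subset\rho(A)$ and $\lambda\|(\lambda-A)^{-1}\|_{X\to X}\le 1$ for all $\lambda>0$. Let $a\in\mathcal{D}(A)$. Then there exists a unique strong solution $u$ to $\partial_t^\alpha(u(t)-a)=Au(t)$ in $X$ for $0<t<T$, and it satisfies $$u,\ Au\in C([0,T];X),\qquad \|u(t)\|_X\le\|a\|_X,\qquad \|Au(t)\|_X\le\|Aa\|_X\quad\text{for all } t\in[0,T].$$
   Context: $L^2(0,T;X)$ is the Hilbert space of (classes of) strongly measurable, square-integrable functions $(0,T)\to X$. $\rho(A)$ denotes the resolvent set of $A$. $\mathcal{D}(A)$ carries the graph norm $\|u\|_X+\|Au\|_X$. For $v\in L^2(0,T;X)$ set $J^\alpha v(t)=\frac{1}{\Gamma(\alpha)}\int_0^t (t-s)^{\alpha-1}v(s)\,ds$; $J^\alpha$ is bounded and injective on $L^2(0,T;X)$. Define $\partial_t^\alpha:=(J^\alpha)^{-1}$ with domain $\mathcal{D}(\partial_t^\alpha)=J^\alpha L^2(0,T;X)=:H_\alpha(0,T;X)$. Strong solution: $u$ is a strong solution to $\partial_t^\alpha(u-a)=Au$ if $u\in L^2(0,T;\mathcal{D}(A))$, $u-a\in H_\alpha(0,T;X)$ (where $a$ is regarded as a constant function of $t$), and $\partial_t^\alpha(u-a)=Au$ holds in $L^2(0,T;X)$. Membership in $C([0,T];X)$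 means having a representative continuous on $[0,T]$, with which the function is identified. *)

(* Defs.v *)
From HB Require Import structures.
From mathcomp Require Import all_boot all_order all_algebra.
From mathcomp Require Import all_classical all_reals all_analysis.

Set Implicit Arguments.
Unset Strict Implicit.
Unset Printing Implicit Defensive.
Import Order.TTheory GRing.Theory Num.Theory.
Import numFieldNormedType.Exports.
Local Open Scope classical_set_scope.
Local Open Scope ring_scope.

(* The values of [op_fun] outside [op_dom] are irrelevant. *)
Record linear_operator (R : realType) (X : normedModType R) := LinearOperator {
  op_dom : set X;
  op_fun :> X -> X;
  op_dom0 : op_dom 0;
  op_domP : forall (c : R) (x y : X),
    op_dom x -> op_dom y -> op_dom (c *: x + y);
  op_linear : forall (c : R) (x y : X),
    op_dom x -> op_dom y -> op_fun (c *: x + y) = c *: op_fun x + op_fun y }.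

Section operator.
Context {R : realType} {X : normedModType R}.
Implicit Types (A : linear_operator X) (l : R).

Definition closed_operator A :=
  closed [set p : X * X | op_dom A p.1 /\ p.2 = A p.1].

Definition densely_defined A := dense (op_dom A).

Definition graph_norm A (x : X) : R := `|x| + `|A x|.

Definition resolvent A l (y : X) : X :=
  xget 0 [set x | op_dom A x /\ l *: x - A x = y].

Definition resolvent_set A : set R :=
  [set l | (forall y : X, exists! x : X, op_dom A x /\ l *: x - A x = y) /\
           exists M : R, forall y : X, `|resolvent A l y| <= M * `|y|].

(* Meaningful for bounded linear maps only. *)
Definition operator_norm (B : X -> X) : R :=
  sup [set `|B y| | y in [set y : X | `|y| <= 1]].

End operator.

Section vector_valued.
Context {R : realType} {X : normedModType R}.
Local Notation mu := (@lebesgue_measure R).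

(* A normed space [V] continuously embedded in [X], such as the domain of an
   operator with its graph norm, is given by its carrier [V : set X] and its
   norm [N : X -> R]; [X] itself is [setT] with [Num.norm]. *)

Definition simple_in (V : set X) (s : {fimfun R >-> X}) :=
  (forall x, measurable (s @^-1` [set x] : set R)) /\ (forall t, V (s t)).

Definition strongly_measurable (V : set X) (N : X -> R) (I : set R)
    (f : R -> X) :=
  {ae mu, forall t, I t -> V (f t)} /\
  exists s : nat -> {fimfun R >-> X},
    (forall n, simple_in V (s n)) /\
    {ae mu, forall t, I t -> N (f t - s n t) @[n --> \oo] --> (0 : R)}.

Definition simple_integral (a b : R) (s : {fimfun R >-> X}) : X :=
  \sum_(x \in range s) fine (mu (`]a, b[ `&` s @^-1` [set x])) *: x.

Definition has_bochner_integral (a b : R) (f : R -> X) (w : X) :=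
  strongly_measurable setT Num.norm `]a, b[ f /\
  exists s : nat -> {fimfun R >-> X},
    [/\ forall n, simple_in setT (s n),
        (\int[mu]_(t in `]a, b[) `|f t - s n t|%:E)%E @[n --> \oo]
          --> (0 : \bar R)%E &
        simple_integral a b (s n) @[n --> \oo] --> w].

(* [0] when [f] is not Bochner integrable on [(a,b)]. *)
Definition bochner_integral (a b : R) (f : R -> X) : X :=
  xget 0 [set w | has_bochner_integral a b f w].

(* Elements of [L^2] are represented by functions on [R], of which only the
   a.e. values on [(0,T)] matter. *)
Definition L2 (V : set X) (N : X -> R) (T : R) (f : R -> X) :=
  strongly_measurable V N `]0, T[ f /\
  (\int[mu]_(t in `]0%R, T[) (N (f t) ^+ 2)%:E < +oo)%E.

End vector_valued.

Definition Gamma (R : realType) (a : R) : R :=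
  \int[@lebesgue_measure R]_(t in `]0%R, +oo[) (t `^ (a - 1) * expR (- t)).

Section fractional.
Context {R : realType} {X : normedModType R}.
Local Notation mu := (@lebesgue_measure R).

Definition frac_integral (alpha : R) (v : R -> X) (t : R) : X :=
  (Gamma alpha)^-1 *:
  bochner_integral 0 t (fun s => (t - s) `^ (alpha - 1) *: v s).

Definition frac_integral_preimage (alpha T : R) (w : R -> X) : set (R -> X) :=
  [set v | L2 setT Num.norm T v /\ frac_integral alpha v = w %[ae mu in `]0, T[%classic]].

Definition H_ (alpha T : R) : set (R -> X) :=
  [set w | frac_integral_preimage alpha T w !=set0].

(* A representative of the class [(J^alpha)^-1 w], for [w] in [H_ alpha T]. *)
Definition frac_derivative (alpha T : R) (w : R -> X) : R -> X :=
  xget (cst 0) (frac_integral_preimage alpha T w).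

Definition strong_solution (alpha T : R) (A : linear_operator X) (a : X)
    (u : R -> X) :=
  [/\ L2 (op_dom A) (graph_norm A) T u,
      H_ alpha T (fun t => u t - a) &
      frac_derivative alpha T (fun t => u t - a) = A \o u
        %[ae mu in `]0, T[%classic]].

End fractional.

(* Main.v *)
(* With k(t) = t^(al-1) and c = 1/Gamma(al), the equation reads u = a + c k * A u.
   Replace A by its Yosida approximation l (B - 1), with B = l (l - A)^-1 a
   contraction, and let r be the resolvent kernel of l c k.  Since k is
   log-convex, r is positive, and since k decreases, r has mass less than 1 on
   every interval.  Convolving with r gives u = (1 - \int r) a + r * (B u),
   whose iteration writes u as a subconvex combination of the B^n a; hence
   |u| <= |a|, and inhomogeneous equations satisfy an estimate independent of l.
   The estimate makes the approximations Cauchy as l -> +oo; they commute with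
   the resolvents of A, so that the limit u satisfies A u_a = u_(A a).
   For uniqueness, the difference of two solutions is integrated once and
   smoothed by (1 - A)^-1; it then solves the Yosida-approximate equation
   up to an error O(1/l), and the same estimate applies. *)
Require Import Defs.
From HB Require Import structures.
From mathcomp Require Import all_boot all_order all_algebra.
From mathcomp Require Import all_classical all_reals all_analysis.
From mathcomp Require Import measurable_realfun ring lra.

Set Implicit Arguments.
Unset Strict Implicit.
Unset Printing Implicit Defensive.
Import Order.TTheory GRing.Theory Num.Theory.
Import numFieldNormedType.Exports.
Local Open Scope classical_set_scope.
Local Open Scope ring_scope.

(** All analysis is scalar. Kernels and functions are extended by zero to t <= 0, so that an
    integral over (0, t) is a convolution over the line; vector identities and norm bounds are read
    off from the pairings [dot _ x], and Bochner integrals enter only through bounded functionals.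

    The obstacle in the estimate is that l (B - 1) has norm of order l: a Gronwall argument on the
    equation itself gives a constant growing with l. After convolution with r only the contraction B
    acts, and \int_0^T r < 1 makes the iteration forget the a priori bound on u, however large; what
    is left depends on the forcing alone.

    The obstacle in uniqueness is that a strong solution is merely square integrable and solves the
    equation almost everywhere, while the estimate concerns bounded functions solving it at every t.
    A primitive repairs both. The resolvent then puts the forcing into the domain with a bounded
    image under A, which is what makes the Yosida error O(1/l). *)

Section change_of_variable.
Context {R : realType}.
Local Notation mu := (@lebesgue_measure R).
Local Open Scope ereal_scope.

(** * Affine changes of variable for Lebesgue measure *)

Lemma lebesgue_measure_affine (p q : R) (A : set R) : (0 < p)%R -> measurable A ->
  mu ((fun x : R => p * x + q)%R @^-1` A) = (p^-1)%:E * mu A.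
Proof.
move=> p0 mA.
have mphi : measurable_fun setT (fun x : R => p * x + q)%R.
  by apply: measurable_funD => //; apply: measurable_funM.
pose phi : measurableTypeR R -> measurableTypeR R := (fun x => p * x + q)%R.
have mphi' : measurable_fun setT phi by [].
pose nu0 : {measure set (measurableTypeR R) -> \bar R} :=
  measure_function_pushforward__canonical__measure_function_Measure mu mphi'.
(* The pushforward, rescaled by [p], agrees with [mu] on half-open intervals; uniqueness of Lebesgue
   measure does the rest. *)
pose nu := mscale (NngNum (ltW p0)) nu0.
have H : mu A = nu A.
  apply: lebesgue_measure_unique => //= _ [[a b]] _ <-.
  rewrite /nu /mscale /nu0 /= /pushforward /= /phi.
  have -> : (fun x : R => p * x + q)%R @^-1` `]a, b]%classic = `]((a - q) / p)%R, ((b - q) /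
    p)%R]%classic.
    apply/seteqP; split=> x /=; rewrite !in_itv /= ltr_pdivrMr// ler_pdivlMr// ltrBlDr lerBrDr
      mulrC.
      by [].
    by [].
  rewrite !lebesgue_measure_itv /= !lte_fin ltr_pM2r ?invr_gt0// ltrD2r.
  case: ifP => _; last by rewrite mule0.
  by rewrite -EFinM; congr EFin; field; rewrite gt_eqF.
rewrite H /nu /mscale /= muleA -EFinM mulVf ?gt_eqF// mul1e.
by [].
Qed.

Lemma lebesgue_measure_reflect (t : R) (A : set R) : measurable A ->
  mu ((fun x : R => t - x)%R @^-1` A) = mu A.
Proof.
move=> mA.
have mphi : measurable_fun setT (fun x : R => t - x)%R by apply: measurable_funB.
pose phi : measurableTypeR R -> measurableTypeR R := (fun x => t - x)%R.
have mphi' : measurable_fun setT phi by [].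
pose nu0 : {measure set (measurableTypeR R) -> \bar R} :=
  measure_function_pushforward__canonical__measure_function_Measure mu mphi'.
have H : mu A = nu0 A.
  apply: lebesgue_measure_unique => //= _ [[a b]] _ <-.
  rewrite /nu0 /= /pushforward /phi.
  have -> : (fun x : R => t - x)%R @^-1` `]a, b]%classic = `[(t - b)%R, (t - a)%R[%classic.
    apply/seteqP; split=> x /=; rewrite !in_itv /= => /andP[h1 h2]; apply/andP; split; lra.
  rewrite !lebesgue_measure_itv /= !lte_fin ltrD2l ltrN2; case: ifP => // _.
  by rewrite -!EFinD; congr EFin; lra.
by rewrite H.
Qed.

Lemma ge0_integral_affine (p q : R) (f : R -> \bar R) : (0 < p)%R ->
  measurable_fun setT f -> (forall x, 0 <= f x) ->
  \int[mu]_x f (p * x + q)%R = (p^-1)%:E * \int[mu]_x f x.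
Proof.
move=> p0 mf f0.
have mphi : measurable_fun setT (fun x : measurableTypeR R => p * x + q : measurableTypeR R)%R.
  by apply: measurable_funD => //; apply: measurable_funM.
have pV0 : (0 <= p^-1)%R by rewrite invr_ge0 ltW.
have -> : (p^-1)%:E * \int[mu]_x f x = \int[mscale (NngNum pV0) mu]_x f x.
  by rewrite ge0_integral_mscale.
rewrite -[LHS](@ge0_integral_pushforward _ _ _ _ _ _ mphi mu setT f) //.
by apply: eq_measure_integral => A mA _ /=; rewrite /pushforward lebesgue_measure_affine.
Qed.

(** Positive and negative parts are transported separately, so that the identity can be used before
    integrability is known. *)
Lemma integral_reflect (t : R) (f : R -> \bar R) : measurable_fun setT f ->
  \int[mu]_x f (t - x)%R = \int[mu]_x f x.
Proof.
move=> mf.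
have mphi : measurable_fun setT (fun x : measurableTypeR R => t - x : measurableTypeR R)%R.
  by apply: measurable_funB.
have H g : measurable_fun setT g -> (forall x, 0 <= g x) ->
  \int[mu]_x g (t - x)%R = \int[mu]_x g x.
  move=> mg g0.
  rewrite -[LHS](@ge0_integral_pushforward _ _ _ _ _ _ mphi mu setT g) //.
  by apply: eq_measure_integral => A mA _ /=; rewrite /pushforward lebesgue_measure_reflect.
rewrite integralE [RHS]integralE; congr (_ - _).
  by rewrite -(H f^\+ (measurable_funepos mf) (funepos_ge0 f)); apply: eq_integral => x _;
    rewrite !funeposE.
by rewrite -(H f^\- (measurable_funeneg mf) (funeneg_ge0 f)); apply: eq_integral => x _;
  rewrite !funenegE.
Qed.

(** A translation is the composite of two reflections. *)
Lemma integral_translate (t : R) (f : R -> \bar R) : measurable_fun setT f ->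
  \int[mu]_x f (x - t)%R = \int[mu]_x f x.
Proof.
move=> mf.
have m' : measurable_fun setT (fun x : R => f (x - t)%R).
  by apply: measurableT_comp => //; exact: measurable_funB.
rewrite -(integral_reflect 0 m') -[RHS](integral_reflect (- t) mf).
by apply: eq_integral => x _; congr f; lra.
Qed.

End change_of_variable.

(** * Scalar convolution on the line *)

Section convolution.
Context {R : realType}.
Local Notation mu := (@lebesgue_measure R).
Implicit Types (f g h : R -> R) (t : R).

Definition convol f g t : R := \int[mu]_s (f (t - s) * g s).

Definition convolvable f g t : Prop := mu.-integrable setT (fun s : R => (f (t - s) * g s)%:E).

Lemma measurable_convol_fun f g t : measurable_fun setT f -> measurable_fun setT g ->
  measurable_fun setT (fun s : R => f (t - s) * g s).
Proof.
move=> mf mg; apply: measurable_funM => //.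
by apply: measurableT_comp => //; exact: measurable_funB.
Qed.

Lemma measurable_convol_EFin f g t : measurable_fun setT f -> measurable_fun setT g ->
  measurable_fun setT (fun s : R => (f (t - s) * g s)%:E).
Proof. by move=> mf mg; apply: measurableT_comp => //; exact: measurable_convol_fun. Qed.

Lemma EFin_convol f g t : convolvable f g t ->
  (convol f g t)%:E = (\int[mu]_(s in setT) (f (t - s) * g s)%:E)%E.
Proof. by move=> fg; rewrite /convol /Rintegral fineK // integrable_fin_num. Qed.

Lemma convolC f g t : measurable_fun setT f -> measurable_fun setT g ->
  convol f g t = convol g f t.
Proof.
move=> mf mg; rewrite /convol /Rintegral; congr fine.
have m := measurable_convol_fun t mg mf.
rewrite -(@integral_reflect _ t (EFin \o (fun s : R => g (t - s) * f s)));
  last exact/measurable_EFinP.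
by apply: eq_integral => s _ /=; rewrite mulrC subKr.
Qed.

Lemma convolvableC f g t : measurable_fun setT f -> measurable_fun setT g ->
  convolvable f g t -> convolvable g f t.
Proof.
move=> mf mg /integrableP[_ fi]; apply/integrableP; split.
  exact: measurable_convol_EFin.
have m := measurable_convol_fun t mf mg.
apply: le_lt_trans fi.
rewrite -(@integral_reflect _ t (abse \o (EFin \o (fun s : R => f (t - s) * g s)))); last first.
  by apply: measurableT_comp => //; exact/measurable_EFinP.
have E s : (`|(g (t - s) * f s)%:E| = (abse \o (EFin \o (fun s : R =>
  f (t - s)%R * g s)%R)) (t - s)%R)%E.
  by rewrite /= subKr mulrC.
by rewrite le_eqVlt; apply/orP; left; apply/eqP; apply: eq_integral => s _; exact: E.
Qed.

(** Equality is asked after multiplication by the kernel: for a kernel vanishing on t <= 0 only the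
    s < t matter. *)
Lemma eq_convol f g g' t : (forall s, f (t - s) * g s = f (t - s) * g' s) ->
  convol f g t = convol f g' t.
Proof. by move=> E; rewrite /convol; apply: eq_Rintegral => s _; exact: E. Qed.

Lemma eq_convolvable f g g' t : (forall s, f (t - s) * g s = f (t - s) * g' s) ->
  convolvable f g t -> convolvable f g' t.
Proof. by move=> E; apply: eq_integrable => // s _; rewrite E. Qed.

Lemma convolDr f g h t : convolvable f g t -> convolvable f h t ->
  convol f (fun s => g s + h s) t = convol f g t + convol f h t.
Proof.
move=> fg fh; rewrite /convol; under eq_Rintegral do rewrite mulrDr.
by rewrite RintegralD.
Qed.

Lemma convolvableDr f g h t : convolvable f g t -> convolvable f h t -> convolvable f (fun s =>
  g s + h s) t.
Proof.
move=> fg fh; have := integrableD measurableT fg fh.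
by apply: eq_integrable => // s _; rewrite /= mulrDr.
Qed.

Lemma convolZr f g (a : R) t : convolvable f g t -> convol f (fun s =>
  a * g s) t = a * convol f g t.
Proof.
move=> fg; rewrite /convol; under eq_Rintegral do rewrite mulrCA.
by rewrite RintegralZl.
Qed.

Lemma convolvableZr f g (a : R) t : convolvable f g t -> convolvable f (fun s => a * g s) t.
Proof.
move=> fg; have := integrableZl measurableT a fg.
by apply: eq_integrable => // s _; rewrite /= -EFinM mulrCA.
Qed.

Lemma convolBr f g h t : convolvable f g t -> convolvable f h t ->
  convol f (fun s => g s - h s) t = convol f g t - convol f h t.
Proof.
move=> fg fh; rewrite /convol; under eq_Rintegral do rewrite mulrBr.
by rewrite RintegralB.
Qed.

Lemma convolvableBr f g h t : convolvable f g t -> convolvable f h t -> convolvable f (fun s =>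
  g s - h s) t.
Proof.
move=> fg fh; have := integrableB measurableT fg fh.
by apply: eq_integrable => // s _; rewrite /= mulrBr.
Qed.

Lemma convolBl f g h t : convolvable f h t -> convolvable g h t ->
  convol (fun s => f s - g s) h t = convol f h t - convol g h t.
Proof.
move=> fg fh; rewrite /convol; under eq_Rintegral do rewrite mulrBl.
by rewrite RintegralB.
Qed.

Lemma convolvableBl f g h t : convolvable f h t -> convolvable g h t -> convolvable (fun s =>
  f s - g s) h t.
Proof.
move=> fg fh; have := integrableB measurableT fg fh.
by apply: eq_integrable => // s _; rewrite /= mulrBl.
Qed.

Lemma convolZl f g (a : R) t : convolvable f g t -> convol (fun s =>
  a * f s) g t = a * convol f g t.
Proof.
move=> fg; rewrite /convol; under eq_Rintegral do rewrite -mulrA.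
by rewrite RintegralZl.
Qed.

Lemma convolvableZl f g (a : R) t : convolvable f g t -> convolvable (fun s => a * f s) g t.
Proof.
move=> fg; have := integrableZl measurableT a fg.
by apply: eq_integrable => // s _; rewrite /= -EFinM mulrA.
Qed.

Lemma le_convolvable f g h t : measurable_fun setT f -> measurable_fun setT g ->
  (forall s, `|f (t - s) * g s| <= f (t - s) * h s) -> convolvable f h t -> convolvable f g t.
Proof.
move=> mf mg le; apply: le_integrable => //.
  exact: measurable_convol_EFin.
move=> s _; rewrite /= lee_fin; apply: le_trans (le s) (ler_norm _).
Qed.

Lemma le_convol f g h t : convolvable f g t -> convolvable f h t ->
  (forall s, f (t - s) * g s <= f (t - s) * h s) -> convol f g t <= convol f h t.
Proof. by move=> fg fh le; apply: le_Rintegral. Qed.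

Lemma normr_convol f g h t : convolvable f g t -> convolvable f h t ->
  (forall s, `|f (t - s) * g s| <= f (t - s) * h s) -> `|convol f g t| <= convol f h t.
Proof.
move=> fg fh le; apply: (le_trans (le_normr_Rintegral _ _)) => //.
by apply: le_Rintegral => //; exact: integrable_norm.
Qed.

Lemma convol_ge0 f g t : (forall s, 0 <= f (t - s) * g s) -> 0 <= convol f g t.
Proof. by move=> h; apply: Rintegral_ge0. Qed.

Lemma measurable_convol f g : measurable_fun setT f -> measurable_fun setT g ->
  measurable_fun setT (convol f g).
Proof.
move=> mf mg.
pose F (z : measurableTypeR R * measurableTypeR R) := (f (z.1 - z.2) * g z.2)%:E.
have mF : measurable_fun setT F.
  apply: (@measurableT_comp _ _ _ _ _ _ EFin) => //; apply: measurable_funM.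
    apply: (measurableT_comp mf); apply: measurable_funB;
      [exact: measurable_fst|exact: measurable_snd].
  by apply: (measurableT_comp mg); exact: measurable_snd.
have -> : convol f g = fun t => fine (\int[mu]_s F^\+ (t, s) - \int[mu]_s F^\- (t, s))%E.
  apply/funext => t; rewrite /convol /Rintegral integralE; congr (fine (_ - _));
    by apply: eq_integral => s _; rewrite ?funeposE ?funenegE.
have H : measurable_fun setT (fun t : measurableTypeR R =>
  (\int[mu]_s F^\+ (t, s) - \int[mu]_s F^\- (t, s))%E).
  apply: emeasurable_funB.
    by apply: (measurable_fun_fubini_tonelli_F F^\+%E) => //; exact: measurable_funepos.
  by apply: (measurable_fun_fubini_tonelli_F F^\-%E) => //; exact: measurable_funeneg.
have H2 := measurableT_comp (@fine_measurable R setT measurableT) H.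
exact: H2.
Qed.

(** Fubini for f(t - s) g(s - u) h(u). Since f and g are nonnegative, integrating the absolute value
    in s first gives (f * g)(t - u) |h(u)|, integrable by assumption. The last conclusion, existence
    of the inner convolution, is how almost everywhere convergence of singular convolutions is
    obtained later. *)
Lemma convolA f g h t : measurable_fun setT f -> measurable_fun setT g -> measurable_fun setT h ->
  (forall x, 0 <= f x) -> (forall x, 0 <= g x) ->
  (forall x, convolvable f g x) -> convolvable (convol f g) h t ->
  [/\ convolvable f (convol g h) t, convol f (convol g h) t = convol (convol f g) h t &
    {ae mu, forall s, f (t - s) != 0 -> convolvable g h s}].
Proof.
move=> mf mg mh f0 g0 fg fgh.
pose F (z : measurableTypeR R * measurableTypeR R) := (f (t - z.1) * (g (z.1 - z.2) * h z.2))%:E.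
have mF : measurable_fun setT F.
  apply: (@measurableT_comp _ _ _ _ _ _ EFin) => //; apply: measurable_funM.
    apply: (measurableT_comp mf); apply: measurable_funB => //; exact: measurable_fst.
  apply: measurable_funM.
    by apply: (measurableT_comp mg); apply: measurable_funB;
      [exact: measurable_fst|exact: measurable_snd].
  by apply: (measurableT_comp mh); exact: measurable_snd.
(* For fixed [u], the integral in [s] is a translate of [convol f g]. *)
have Ki u : mu.-integrable setT (fun s : R => (f (t - s) * g (s - u))%:E) /\
    (\int[mu]_s (f (t - s) * g (s - u))%:E = (convol f g (t - u))%:E)%E.
  have m1 : measurable_fun setT (fun s : R =>
    (f (t - u - s) * g s)%:E) by exact: measurable_convol_EFin.
  have E (s : R) : (f (t - s) * g (s - u))%:E = (fun s : R => (f (t - u - s) * g s)%:E) (s - u).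
    by congr (_ * _)%:E; congr f; lra.
  have m2 : measurable_fun setT (fun s : R => (f (t - s) * g (s - u))%:E).
    apply: measurableT_comp => //; apply: measurable_funM.
      by apply: (measurableT_comp mf); exact: measurable_funB.
    by apply: (measurableT_comp mg); exact: measurable_funB.
  have I : (\int[mu]_s (f (t - s) * g (s - u))%:E = (convol f g (t - u))%:E)%E.
    under eq_integral do rewrite E.
    by rewrite (integral_translate u m1) EFin_convol.
  split => //; apply/integrableP; split => //.
  under eq_integral do rewrite /= ger0_norm ?mulr_ge0//.
  by rewrite I ltry.
have intF : (mu \x mu)%E.-integrable setT F.
  apply/(integrable21ltyP mu mu mF).
  have -> : (\int[mu]_y \int[mu]_x `|F (x, y)| = \int[mu]_y `|(convol f g (t - y) * h y)%:E|)%E.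
    apply: eq_integral => u _; rewrite /F /=.
    under eq_integral => s _ do rewrite mulrA normrM EFinM (ger0_norm (mulr_ge0 (f0 _) (g0 _))).
    have [k1 k2] := Ki u.
    rewrite ge0_integralZr //; last 2 first.
    - exact: measurable_int k1.
    - by move=> s _; rewrite lee_fin mulr_ge0.
    rewrite k2 -EFinM normrM (@ger0_norm _ (convol f g (t - u)))//.
    by apply: convol_ge0 => s; exact: mulr_ge0.
  by case/integrableP : fgh.
have A0 : {ae mu, forall s, f (t - s) != 0 -> convolvable g h s}.
  have := ae_integrable1 intF.
  apply: filterS => s Fi nz.
  have := integrableZl measurableT (f (t - s))^-1 Fi.
  by apply: eq_integrable => // u _; rewrite /F /= -EFinM mulKf.
(* Where [f (t - s)] is 0 both sides vanish, even if the convolution of [g] and [h] diverges at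
   [s]. *)
have A1 : {ae mu, forall s, (\int[mu]_u F (s, u) = (f (t - s) * convol g h s)%:E)%E}.
  have := A0; apply: (@filterS _ _ (ae_filter_ringOfSetsType mu)) => s; rewrite /F /=.
  have [z _|nz /(_ isT) gi] := eqVneq (f (t - s)) 0.
    by rewrite z mul0r; under eq_integral do rewrite mul0r; rewrite integral0.
  by under eq_integral do rewrite EFinM; rewrite integralZl // -EFin_convol.
have m3 : measurable_fun setT (fun s : R => (f (t - s) * convol g h s)%:E).
  by apply: measurable_convol_EFin => //; exact: measurable_convol.
have iF := integrable_fubini_F intF.
split => //.
  apply/integrableP; split => //.
  have /integrableP[_] := iF; apply: le_lt_trans.
  rewrite le_eqVlt; apply/orP; left; apply/eqP.
  apply: ae_eq_integral => //; try exact: measurableT_comp.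
    by apply: measurableT_comp => //; exact: measurable_int iF.
  by apply: filterS A1 => s E _; rewrite /= ?/fubini_F E.
rewrite /convol /Rintegral; congr fine.
transitivity (\int[mu]_s \int[mu]_u F (s, u))%E.
  apply: ae_eq_integral => //; first exact: measurable_int iF.
  by apply: filterS A1 => s E _; rewrite /= ?/fubini_F E.
rewrite (Fubini intF); apply: eq_integral => u _; rewrite /F /=.
under eq_integral => s _ do rewrite mulrA EFinM.
have [k1 k2] := Ki u.
by rewrite integralZr // k2 EFinM.
Qed.

End convolution.

(** * Power kernels and the beta identity *)

Section power_kernels.
Context {R : realType}.
Local Notation mu := (@lebesgue_measure R).
Implicit Types (a b t x : R).

(** The index is the order of integration, so that convolution adds indices. [powk 1] is the
    Heaviside function, and convolving with it integrates from 0. *)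
Definition powk b : R -> R := fun t => if 0 < t then t `^ (b - 1) else 0.

Lemma powk_ge0 b t : 0 <= powk b t.
Proof. by rewrite /powk; case: ifP => // _; exact: powR_ge0. Qed.

Lemma powk_gt0 b t : 0 < t -> 0 < powk b t.
Proof. by move=> t0; rewrite /powk t0 powR_gt0. Qed.

Lemma powk0 b t : t <= 0 -> powk b t = 0.
Proof. by move=> t0; rewrite /powk ltNge t0. Qed.

Lemma powk1 t : 0 < t -> powk 1 t = 1.
Proof. by move=> t0; rewrite /powk t0 subrr powRr0. Qed.

Lemma measurable_powk b : measurable_fun setT (powk b).
Proof.
apply: measurable_fun_ifT.
- exact: measurable_fun_ltr.
- exact: measurable_powR.
- exact: measurable_cst.
Qed.

(** Away from the singularity, on [1/(n+1), 1], the primitive t^b / b bounds the integral by [b^-1];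
    monotone convergence exhausts the interval. *)
Lemma integral_powR_lt_pinfty b : 0 < b ->
  (\int[mu]_(x in `]0%R, 1%R]) (x `^ (b - 1))%:E < +oo)%E.
Proof.
move=> b0.
pose F (n : nat) : set R := `[n.+1%:R^-1, 1]%classic.
have U : \bigcup_n F n = `]0, 1]%classic.
  apply/seteqP; split => x /=.
    move=> [n _]; rewrite /F /= !in_itv /= => /andP[h ->]; rewrite andbT.
    by apply: lt_le_trans h; rewrite invr_gt0.
  rewrite in_itv /= => /andP[x0 x1].
  exists (Num.truncn x^-1) => //; rewrite /F /= in_itv /= x1 andbT.
  rewrite -[leRHS]invrK lef_pV2 ?posrE ?invr_gt0//.
  by apply/ltW/truncnS_gt.
rewrite -U.
apply: (@le_lt_trans _ _ (b^-1)%:E); last exact: ltry.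
have C : (\int[mu]_(x in F i) (x `^ (b - 1))%:E @[i --> \oo] --> \int[mu]_(x in \bigcup_i F i)
  (x `^ (b - 1))%:E)%E.
  apply: ge0_nondecreasing_set_cvg_integral.
  - apply/nondecreasing_seqP => n; rewrite subsetEset => x;
    rewrite /F /= !in_itv /= => /andP[h ->].
    rewrite andbT; apply: le_trans h; rewrite lef_pV2 ?posrE ?ltr0n// ler_nat; exact: leqnSn.
  - by move=> i; exact: measurable_itv.
  - move=> i; apply: measurableT_comp => //; apply: measurable_funTS; exact: measurable_powR.
  - by move=> i x _; rewrite lee_fin powR_ge0.
rewrite -(cvg_lim _ C) //; apply: lime_le; first by apply/cvg_ex; eexists; exact: C.
apply: nearW => n.
have [->|n0] := eqVneq n 0%N.
  rewrite /F invr1 set_itv1 integral_set1 lee_fin invr_ge0; exact: ltW.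
have n1 : n.+1%:R^-1 < 1 :> R by rewrite invf_lt1 ?ltr0n// ltr1n ltnS lt0n.
have np : 0 < n.+1%:R^-1 :> R by rewrite invr_gt0 ltr0n.
have dP x : 0 < x -> is_derive x 1 (fun x => b^-1 * x `^ b) (x `^ (b - 1)).
  move=> x0; have h := is_derive1_powR b x0.
  have -> : (fun x => b^-1 * x `^ b) = b^-1 \*: (fun x : R => x `^ b) by [].
  apply: is_derive_eq.
  by rewrite /GRing.scale /= mulKf // gt_eqF.
have cP x : 0 < x -> {for x, continuous (fun x : R => b^-1 * x `^ b)}.
  move=> x0; apply/differentiable_continuous/derivable1_diffP.
  by have [] := dP x x0.
rewrite (@continuous_FTC2 _ _ (fun x => b^-1 * x `^ b)) //.
- rewrite powR1 mulr1 -EFinD lee_fin gerBl mulr_ge0 ?powR_ge0// invr_ge0; exact: ltW.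
- apply: continuous_in_subspaceT => x; rewrite inE /= in_itv /= => /andP[h _].
  have x0 : 0 < x := lt_le_trans np h.
  apply/differentiable_continuous/derivable1_diffP.
  by have [] := is_derive1_powR (b - 1) x0.
- split.
  + move=> x; rewrite in_itv /= => /andP[h _].
    by have [] := dP x (lt_trans np h).
  + by apply: cvg_at_right_filter; exact: cP.
  + by apply: cvg_at_left_filter; exact: cP.
- move=> x; rewrite in_itv /= => /andP[h _].
  rewrite derive1E; by have [_ ->] := dP x (lt_trans np h).
Qed.

Lemma powR_antitone c x y : c <= 0 -> 0 < x -> x <= y -> y `^ c <= x `^ c.
Proof.
move=> c0 x0 xy; have y0 := lt_le_trans x0 xy.
rewrite -[c]opprK !(powRN _ (- c)) lef_pV2 ?posrE ?powR_gt0//.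
have c0' : 0 <= - c by rewrite oppr_ge0.
by apply: (ge0_ler_powR c0') xy; rewrite nnegrE ltW.
Qed.

(** One constant covers both the increasing case (1 <= a) and the decreasing one. *)
Lemma powk_le_half a x : 2^-1 <= x -> x <= 1 -> powk a x <= 1 + 2^-1 `^ (a - 1).
Proof.
move=> hx x1; have h0 : 0 < (2^-1 : R) by rewrite invr_gt0.
have x0 := lt_le_trans h0 hx.
rewrite /powk x0; have [a1|a1] := leP 1 a.
  apply: (@le_trans _ _ 1); last by rewrite lerDl powR_ge0.
  have a1' : 0 <= a - 1 by rewrite subr_ge0.
  have := ge0_ler_powR a1' _ _ x1; rewrite powR1; apply; rewrite nnegrE ?ler01//.
  exact: ltW.
apply: (@le_trans _ _ (2^-1 `^ (a - 1))); last by rewrite lerDr ler01.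
by apply: powR_antitone; rewrite ?subr_le0 ?(ltW a1).
Qed.

Let P b := fun x => powk b x * \1_`]0, 1]%classic x : R.

Let measurable_P b : measurable_fun setT (P b).
Proof.
apply: measurable_funM; first exact: measurable_powk.
by apply: measurable_indic; exact: measurable_itv.
Qed.

Let integrable_P b : 0 < b -> mu.-integrable setT (EFin \o P b).
Proof.
move=> b0; apply/integrableP; split.
  by apply/measurable_EFinP; exact: measurable_P.
apply: le_lt_trans (integral_powR_lt_pinfty b0).
rewrite [leRHS]integral_mkcond le_eqVlt; apply/orP; left; apply/eqP.
apply: eq_integral => x _; rewrite /= patchE /P indicE.
case: ifPn => [xin|_]; last by rewrite mulr0 normr0.
rewrite mulr1 ger0_norm ?powk_ge0// /powk.
by move: xin; rewrite inE /= in_itv /= => /andP[-> _].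
Qed.

(** The two singularities sit at opposite ends of (0, 1): on each half one factor is bounded and the
    other integrable. *)
Lemma convolvable_powk1 a b : 0 < a -> 0 < b -> convolvable (powk a) (powk b) 1.
Proof.
move=> a0 b0.
have I1 : mu.-integrable setT (fun s : R => (P a (1 - s))%:E).
  apply/integrableP; split.
    apply: measurableT_comp => //; apply: (measurableT_comp (measurable_P a)).
    exact: measurable_funB.
  have /integrableP[_] := integrable_P a0.
  rewrite -(@integral_reflect _ 1 (abse \o (EFin \o P a))) //.
  by apply: measurableT_comp => //; apply/measurable_EFinP; exact: measurable_P.
have I2 := integrableD measurableT (integrableZl measurableT (1 + 2^-1 `^ (a - 1))
  (integrable_P b0))
  (integrableZl measurableT (1 + 2^-1 `^ (b - 1)) I1).
apply: le_integrable I2 => //.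
  by apply: measurable_convol_EFin; exact: measurable_powk.
move=> s _; rewrite /= lee_fin.
rewrite (ger0_norm (mulr_ge0 (powk_ge0 _ _) (powk_ge0 _ _))).
have C0 (c : R) : 0 <= 1 + 2^-1 `^ (c - 1) :> R by rewrite addr_ge0 ?powR_ge0.
have P0 c x : 0 <= P c x by rewrite mulr_ge0 ?powk_ge0// indicE.
have Q1 := mulr_ge0 (C0 a) (P0 b s).
have Q2 := mulr_ge0 (C0 b) (P0 a (1 - s)).
rewrite (ger0_norm (addr_ge0 Q1 Q2)).
have [s0|s0] := leP s 0; first by rewrite (powk0 b s0) mulr0 addr_ge0.
have [s1|s1] := leP 1 s.
  by rewrite (@powk0 a (1 - s)) ?subr_le0// mul0r addr_ge0.
have [sh|sh] := leP s 2^-1.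
  apply: (@le_trans _ _ ((1 + 2^-1 `^ (a - 1)) * P b s)); last by rewrite lerDl.
  rewrite /P indicE mem_set ?mulr1/= ?in_itv/= ?s0 ?(ltW s1)//.
  apply: ler_wpM2r; first exact: powk_ge0.
  by apply: powk_le_half; lra.
apply: (@le_trans _ _ ((1 + 2^-1 `^ (b - 1)) * P a (1 - s))); last by rewrite lerDr.
rewrite /P indicE mem_set ?mulr1/= ?in_itv/=; last by apply/andP; split; lra.
rewrite mulrC; apply: ler_wpM2r; first exact: powk_ge0.
by apply: powk_le_half; lra.
Qed.

(** Euler's beta function B(a, b). Its values never matter, only its sign and the decay of B(al, n
    al) in n. *)
Definition powk_beta a b : R := convol (powk a) (powk b) 1.

Lemma Rintegral_gt0 (f : R -> R) : (forall x, 0 <= f x) -> mu.-integrable setT (EFin \o f) ->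
  (forall x, 0 < x < 1 -> 0 < f x) -> 0 < \int[mu]_x f x.
Proof.
move=> f0 fi fp; rewrite lt_neqAle; apply/andP; split; last by apply: Rintegral_ge0.
apply/negP => /eqP E.
have mf := measurable_int _ fi.
have I0 : (\int[mu]_x `|(EFin \o f) x| = 0)%E.
  under eq_integral do rewrite /= ger0_norm//.
  have : (\int[mu]_x (EFin \o f) x)%E \is a fin_num by exact: integrable_fin_num.
  by move=> h; rewrite -(fineK h) -[fine _]/(Rintegral mu setT f) -E.
have /(ae_eq_integral_abs mu measurableT mf)[N [mN N0 sub]] := I0.
have : (mu `]0%R, 1%R[ <= mu N)%E.
  apply: le_measure; rewrite ?inE//.
  move=> x; rewrite /= in_itv /= => hx; apply: sub => /= /(_ I) [] h.
  by have := fp x hx; rewrite h ltxx.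
by rewrite lebesgue_measure_itv /= lte_fin ltr01 N0 oppr0 adde0 lee_fin ler10.
Qed.

Lemma powk_beta_gt0 a b : 0 < a -> 0 < b -> 0 < powk_beta a b.
Proof.
move=> a0 b0; apply: Rintegral_gt0.
- by move=> x; rewrite mulr_ge0 ?powk_ge0.
- exact: convolvable_powk1.
- by move=> x /andP[x0 x1]; rewrite mulr_gt0// powk_gt0// subr_gt0.
Qed.

Lemma powkM b t x : 0 < t -> powk b (t * x) = t `^ (b - 1) * powk b x.
Proof.
move=> t0; rewrite /powk pmulr_rgt0//; case: ifPn => x0; last by rewrite mulr0.
by rewrite powRM // ltW.
Qed.

(** Scaling the variable by [t] reduces to [t = 1], the beta integral; for t <= 0 the integrand is
    zero. *)
Lemma convol_powk a b t : 0 < a -> 0 < b ->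
  convolvable (powk a) (powk b) t /\ convol (powk a) (powk b) t = powk_beta a b * powk (a + b) t.
Proof.
move=> a0 b0.
have [t0|t0] := leP t 0.
  have Z s : powk a (t - s) * powk b s = 0.
    have [s0|s0] := leP s 0; first by rewrite (powk0 b s0) mulr0.
    by rewrite (@powk0 a) ?mul0r//; lra.
  split.
    have := @integrable0 _ _ R mu setT.
    by apply: eq_integrable => // s _; rewrite Z.
  by rewrite /convol; under eq_Rintegral do rewrite Z;
    rewrite Rintegral_cst ?mul0r// powk0 ?mulr0.
have mk : measurable_fun setT (fun s : R => (powk a (t - s) * powk b s)%:E).
  by apply: measurable_convol_EFin; exact: measurable_powk.
have I : (\int[mu]_s (powk a (t - s) * powk b s)%:E = (powk_beta a b * powk (a + b) t)%:E)%E.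
  have -> : (\int[mu]_s (powk a (t - s) * powk b s)%:E
      = t%:E * \int[mu]_s (powk a (t - (t * s + 0)) * powk b (t * s + 0))%:E)%E.
    rewrite (@ge0_integral_affine _ t 0 (fun s => (powk a (t - s) * powk b s)%:E)) //; last first.
      by move=> x; rewrite lee_fin mulr_ge0 ?powk_ge0.
    by rewrite muleA -EFinM divff ?mul1e// gt_eqF.
  have E s : powk a (t - (t * s + 0)) * powk b (t * s + 0)
      = t `^ (a - 1) * t `^ (b - 1) * (powk a (1 - s) * powk b s).
    rewrite addr0 -{1}(mulr1 t) -mulrBr !powkM//; ring.
  under eq_integral do rewrite E EFinM.
  rewrite integralZl //; last exact: convolvable_powk1.
  rewrite -EFin_convol; last exact: convolvable_powk1.
  rewrite -!EFinM; congr EFin; rewrite -/(powk_beta a b) /powk t0.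
  have -> : t `^ (a + b - 1) = t * (t `^ (a - 1) * t `^ (b - 1)).
    rewrite -{2}(powRr1 (ltW t0)) -!powRD; try by rewrite (gt_eqF t0) implybT.
    by congr (_ `^ _); ring.
  by ring.
have Ci : convolvable (powk a) (powk b) t.
  apply/integrableP; split => //.
  under eq_integral do rewrite /= ger0_norm ?mulr_ge0 ?powk_ge0//.
  by rewrite I ltry.
by split => //; rewrite /convol /Rintegral I.
Qed.

End power_kernels.

(** * Geometric bounds on series and sequences *)

Section series.
Context {R : realType}.

Lemma geometric_series_dist (V : completeNormedModType R) (a : nat -> V) (C q : R) :
  0 <= q < 1 -> (forall n, `|a n| <= C * q ^+ n) ->
  series a @ \oo --> limn (series a) /\
  forall N, `|limn (series a) - series a N| <= C * q ^+ N / (1 - q).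
Proof.
move=> /andP[q0 q1] aC.
have C0 : 0 <= C by have := aC 0%N; rewrite expr0 mulr1; exact: le_trans.
have convol : cvgn (series a).
  apply: normed_cvg.
  have gc : cvgn (series (geometric C q)) by apply: is_cvg_geometric_series; rewrite ger0_norm.
  apply: (series_le_cvg _ _ _ gc) => n //=.
  by rewrite mulr_ge0 ?exprn_ge0.
split => // N.
have d0 : 1 - q != 0 by rewrite subr_eq0 gt_eqF.
have d1 : 0 < 1 - q by rewrite subr_gt0.
have B k : `|series a (k + N)%N - series a N| <= C * q ^+ N / (1 - q) * (1 - q ^+ k).
  elim: k => [|k IH]; first by rewrite add0n subrr normr0 expr0 subrr mulr0.
  rewrite addSn seriesSr addrAC; apply: (le_trans (ler_normD _ _)).
  apply: (le_trans (lerD IH (aC _))).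
  rewrite exprD exprSr le_eqVlt; apply/orP; left; apply/eqP; by field.
have C' : `|series a (k + N)%N - series a N| @[k --> \oo] --> `|limn (series a) - series a N|.
  apply: cvg_norm; apply: cvgB; last exact: cvg_cst.
  by rewrite (cvg_shiftn N (series a)).
rewrite -(cvg_lim _ C') //; apply: limr_le; first by apply/cvg_ex; eexists; exact: C'.
apply: nearW => k; apply: (le_trans (B k)); rewrite -[leRHS]mulr1.
apply: ler_wpM2l; last by rewrite gerBl exprn_ge0.
by rewrite !mulr_ge0 ?exprn_ge0// invr_ge0 ltW.
Qed.

(** Induction on [N]: the first term is peeled off and absorbed, with the shift, into the
    constant. *)
Lemma eventually_halving (a : nat -> R) (N : nat) : (forall n, 0 <= a n) ->
  (forall n, (N <= n)%N -> a n.+1 <= a n / 2) ->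
  exists2 C, 0 <= C & forall n, a n <= C * (2^-1) ^+ n.
Proof.
elim: N a => [|N IH] a a0 h.
  exists (a 0%N) => //; elim => [|n IHn]; first by rewrite expr0 mulr1.
  apply: (le_trans (h n (leq0n _))); rewrite exprS mulrCA mulrC.
  by apply: ler_wpM2l; rewrite ?invr_ge0.
have [C C0 hC] := IH (fun n => a n.+1) (fun n => a0 n.+1) (fun n Nn => h n.+1 Nn).
exists (a 0%N + 2 * C); first by rewrite addr_ge0 ?mulr_ge0.
move=> [|n]; first by rewrite expr0 mulr1 lerDl mulr_ge0.
apply: (le_trans (hC n)); rewrite exprS mulrA.
apply: ler_wpM2r; first by rewrite exprn_ge0 ?invr_ge0.
rewrite mulrDl mulrAC divff ?mul1r ?pnatr_eq0// lerDr.
by rewrite mulr_ge0 ?invr_ge0.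
Qed.

Lemma eq0_geometric_bound (x C q : R) : 0 <= q < 1 -> (forall N, `|x| <= C * q ^+ N) -> x = 0.
Proof.
move=> /andP[q0 q1] h; apply/eqP; rewrite -normr_le0.
have c : C * q ^+ n @[n --> \oo] --> (0 : R).
  rewrite -[X in _ --> X](mulr0 C); apply: cvgM; first exact: cvg_cst.
  by apply: cvg_expr; rewrite ger0_norm.
by rewrite -(cvg_lim _ c) //; apply: limr_ge; [apply/cvg_ex; exists 0|apply: nearW].
Qed.

End series.

(** * The resolvent kernel as a series *)

Section resolvent_series.
Context {R : realType} (al ka : R).
Hypotheses (al0 : 0 < al) (al1 : al < 1) (ka0 : 0 < ka).
Local Notation mu := (@lebesgue_measure R).
Local Notation k := (@powk R al).

Definition beta_step (n : nat) : R := powk_beta al (n.+1%:R * al).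

Let na0 n : 0 < n.+1%:R * al. Proof. by rewrite mulr_gt0. Qed.

Lemma beta_step_gt0 n : 0 < beta_step n.
Proof. exact: powk_beta_gt0. Qed.

(** A series of these kernels is [k] times a power series in t^al, which isolates the singularity at
    0 in the factor [k]. *)
Lemma powk_mulrn n t : 0 < t -> powk (n.+1%:R * al) t = k t * (t `^ al) ^+ n.
Proof.
move=> t0; rewrite /powk t0 -powR_mulrn ?powR_ge0// -powRrM -powRD;
  last by rewrite (gt_eqF t0) implybT.
by congr (_ `^ _); rewrite -natr1; ring.
Qed.

(** The beta integrand carries the factor (s^al)^n with s^al < 1 on (0, 1), so dominated convergence
    applies with the term n = 0 as majorant; asymptotics of the Gamma function are thereby
    avoided. *)
Lemma cvg_beta_step : beta_step @ \oo --> (0 : R).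
Proof.
pose f n : R -> \bar R := fun s => (k (1 - s) * powk (n.+1%:R * al) s)%:E.
have i0 n : convolvable k (powk (n.+1%:R * al)) 1 by apply: (convol_powk _ _ _).1.
have pt s : 0 < s < 1 -> k (1 - s) * powk (n.+1%:R * al) s @[n --> \oo] --> (0 : R).
  move=> /andP[s0 s1].
  have -> : (fun n => k (1 - s) * powk (n.+1%:R * al) s) = (fun n =>
    k (1 - s) * k s * (s `^ al) ^+ n).
    by apply/funext => n; rewrite powk_mulrn// mulrA.
  rewrite -[X in _ --> X](mulr0 (k (1 - s) * k s)); apply: cvgM; first exact: cvg_cst.
  apply: cvg_expr; rewrite ger0_norm ?powR_ge0//.
  have := gt0_ltr_powR al0 _ _ s1; rewrite powR1; apply; rewrite nnegrE ?ler01//; exact: ltW.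
have Z s : ~~ (0 < s < 1) -> forall n, k (1 - s) * powk (n.+1%:R * al) s = 0.
  move=> h n; have [s0|s0] := leP s 0; first by rewrite (powk0 _ s0) mulr0.
  by rewrite (@powk0 _ al) ?mul0r//; move: h; rewrite s0 /= -leNgt subr_le0.
have mf n : measurable_fun setT (f n) by exact: measurable_int (i0 n).
have A1 : {ae mu, forall x, setT x -> f ^~ x @ \oo --> (0 : R)%:E}.
  apply: aeW => s _; have [h|h] := boolP (0 < s < 1).
    by apply: cvg_EFin; [exact: nearW|exact: pt].
  by rewrite /f; under eq_fun do rewrite (Z _ h); exact: cvg_cst.
have A2 : {ae mu, forall x n, setT x -> (`|f n x| <= f 0%N x)%E}.
  apply: aeW => s n _; rewrite /f /= lee_fin.
  rewrite ger0_norm ?mulr_ge0 ?powk_ge0//.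
  have [h|h] := boolP (0 < s < 1); last by rewrite !(Z _ h).
  apply: ler_wpM2l; first exact: powk_ge0.
  move/andP: h => [s0 s1]; rewrite !powk_mulrn//; apply: ler_wpM2l; first exact: powk_ge0.
  rewrite expr0; apply: exprn_ile1; first exact: powR_ge0.
  by have := ge0_ler_powR (ltW al0) _ _ (ltW s1); rewrite powR1; apply;
    rewrite nnegrE ?ler01//; exact: ltW.
have [_ _] := @dominated_convergence _ _ R mu setT measurableT f (cst 0%E) (f 0%N)
  mf (measurable_cst _) A1 (i0 0%N) A2.
rewrite integral0 => c.
have E : (fun n => \int[mu]_x f n x)%E = (fun n => (beta_step n)%:E).
  by apply/funext => n; rewrite -EFin_convol.
by move: c; rewrite E => /fine_cvgP[].
Qed.

(* The kernel is the Neumann series of [r + ka * (k * r) = ka * k]; by the beta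
   identity every convolution power of [k] is a multiple of some [powk]. *)
Fixpoint resolvent_kernel_coef (n : nat) : R :=
  if n is n'.+1 then - ka * beta_step n' * resolvent_kernel_coef n' else ka.

Lemma resolvent_kernel_coef_bound y : 0 <= y ->
  exists2 C, 0 <= C & forall n, `|resolvent_kernel_coef n| * y ^+ n <= C * (2^-1) ^+ n.
Proof.
(* With this [e] the ratio [ka * beta_step n * y] of consecutive terms is eventually at most
   [ka * e * (y + 1)], which is 1/2; [y + 1] in place of [y] keeps the divisor positive. *)
move=> y0; pose e := (2 * ka * (y + 1))^-1.
have e0 : 0 < e by rewrite invr_gt0 !mulr_gt0// ltr_wpDl.
have /cvgrPdist_lt /(_ e e0) [N _ hN] := cvg_beta_step.
apply: (@eventually_halving _ _ N) => [n|n Nn]; first by rewrite mulr_ge0 ?exprn_ge0.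
have b := hN n Nn; rewrite /= sub0r normrN ger0_norm ?(ltW (beta_step_gt0 n))// in b.
rewrite /= !normrM normrN (gtr0_norm ka0) (gtr0_norm (beta_step_gt0 n)) exprS.
rewrite [leLHS](_ : _ = (ka * beta_step n * y) * (`|resolvent_kernel_coef n| * y ^+ n));
  last by ring.
rewrite [leRHS]mulrC; apply: ler_wpM2r; first by rewrite mulr_ge0 ?exprn_ge0.
apply: (@le_trans _ _ (ka * e * (y + 1))).
  apply: ler_pM => //; last by rewrite lerDl.
    by rewrite mulr_ge0 ?ltW ?beta_step_gt0.
  by apply: ler_wpM2l; exact: ltW.
by rewrite /e le_eqVlt; apply/orP; left; apply/eqP; field; rewrite ?gt_eqF// ltr_wpDl.
Qed.

(** In closed form ka Gamma(al) E(- ka Gamma(al) y), with E the Mittag-Leffler function of indices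
    al, al. *)
Definition resolvent_kernel_series (y : R) : R := limn (series (fun n =>
  resolvent_kernel_coef n * y ^+ n)).

Lemma resolvent_kernel_series_bound Y : 0 <= Y -> exists2 C, 0 <= C &
  forall y N, 0 <= y <= Y ->
  `|resolvent_kernel_series y - series (fun n =>
    resolvent_kernel_coef n * y ^+ n) N| <= C * (2^-1) ^+ N.
Proof.
move=> Y0; have [C C0 hC] := resolvent_kernel_coef_bound Y0.
exists (C / (1 - 2^-1)).
  by apply: divr_ge0 => //; lra.
move=> y N /andP[y0 yY].
have h2 : 0 <= (2^-1 : R) < 1 by apply/andP; split; lra.
have b n : `|resolvent_kernel_coef n * y ^+ n| <= C * 2^-1 ^+ n.
  apply: le_trans (hC n); rewrite normrM normrX (ger0_norm y0).
  by apply: ler_wpM2l => //; apply: lerXn2r.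
have [_ /(_ N)] := @geometric_series_dist R R^o _ C 2^-1 h2 b.
by move=> h; rewrite mulrAC.
Qed.

Lemma resolvent_kernel_series0 : resolvent_kernel_series 0 = ka.
Proof.
rewrite /resolvent_kernel_series; apply: cvg_lim => //.
rewrite -(cvg_shiftS); apply: cvg_near_cst; apply: nearW => n /=.
rewrite /series /= big_nat_recl// expr0 mulr1 big1 ?addr0// => i _.
by rewrite exprS mul0r mulr0.
Qed.

(** Partial sums are polynomials and the tail is uniformly small on [0, y + 1]. The statement is
    one-sided at 0 because the tail bound covers nonnegative arguments, the only values of t^al. *)
Lemma resolvent_kernel_series_continuous y e : 0 <= y -> 0 < e -> exists2 d, 0 < d &
  forall z, 0 <= z -> `|z - y| < d ->
    `|resolvent_kernel_series z - resolvent_kernel_series y| < e.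
Proof.
move=> y0 e0.
have y10 : 0 <= y + 1 by rewrite addr_ge0.
have [C C0 hC] := resolvent_kernel_series_bound y10.
have c : C * (2^-1) ^+ n @[n --> \oo] --> (0 : R).
  rewrite -[X in _ --> X](mulr0 C); apply: cvgM; first exact: cvg_cst.
  by apply: cvg_expr; rewrite ger0_norm; lra.
have e30 : 0 < e / 3 by rewrite divr_gt0.
have /cvgrPdist_lt /(_ _ e30) [N _ /(_ N (leqnn N))] := c.
rewrite /= sub0r normrN ger0_norm => [eN|]; last by rewrite mulr_ge0 ?exprn_ge0 ?invr_ge0.
pose p := \poly_(i < N) resolvent_kernel_coef i.
have pE z : series (fun n => resolvent_kernel_coef n * z ^+ n) N = p.[z].
  by rewrite horner_poly /series /= big_mkord.
have /cvgrPdist_lt /(_ _ e30) [d /= d0 hd] := @continuous_horner R p y.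
exists (Order.min d 1); first by rewrite lt_min d0 ltr01.
move=> z z0; rewrite lt_min => /andP[zd z1].
have zy : 0 <= z <= y + 1 by rewrite z0 /=; move: z1; rewrite ltr_norml; lra.
have yy : 0 <= y <= y + 1 by rewrite y0 /=; lra.
have h1 := hC _ N zy; have h2 := hC _ N yy; rewrite !pE in h1 h2.
have h3 : `|p.[y] - p.[z]| < e / 3 by apply: hd; rewrite /= distrC.
have -> : resolvent_kernel_series z - resolvent_kernel_series y =
  (resolvent_kernel_series z - p.[z]) - (resolvent_kernel_series y - p.[y]) - (p.[y] - p.[z])
    by ring.
apply: (le_lt_trans (ler_normB _ _)).
apply: (@le_lt_trans _ _ (e / 3 + e / 3 + `|p.[y] - p.[z]|)).
  rewrite lerD2r; apply: (le_trans (ler_normB _ _)); apply: lerD;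
    exact/ltW/(le_lt_trans _ eN).
by lra.
Qed.

Definition resolvent_kernel (t : R) : R := k t * resolvent_kernel_series (t `^ al).
Local Notation rk := resolvent_kernel.

Let rkN (N : nat) (t : R) : R := \sum_(n < N) resolvent_kernel_coef n * powk (n.+1%:R * al) t.

Let rkN_E N t : 0 < t -> rkN N t = k t * series (fun n =>
  resolvent_kernel_coef n * (t `^ al) ^+ n) N.
Proof.
move=> t0; rewrite /rkN /series /= big_mkord mulr_sumr; apply: eq_bigr => i _.
by rewrite powk_mulrn// mulrCA.
Qed.

Lemma resolvent_kernel_le0 t : t <= 0 -> rk t = 0.
Proof. by move=> t0; rewrite /rk powk0// mul0r. Qed.

Let resolvent_kernel_dist T : exists2 C, 0 <= C & forall t N, t <= T ->
  `|rk t - rkN N t| <= C * (2^-1) ^+ N * k t.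
Proof.
have [C C0 hC] := resolvent_kernel_series_bound (powR_ge0 T al).
exists C => // t N tT; have [t0|t0] := leP t 0.
  rewrite resolvent_kernel_le0// /rkN big1 ?subrr ?normr0 ?mulr_ge0 ?exprn_ge0 ?invr_ge0
    ?powk_ge0//.
  by move=> i _; rewrite powk0 ?mulr0.
rewrite rkN_E// /rk -mulrBr normrM ger0_norm ?powk_ge0// mulrC.
apply: ler_wpM2r; first exact: powk_ge0.
apply: hC; rewrite powR_ge0 /=.
by have T0 := lt_le_trans t0 tT; apply: (ge0_ler_powR (ltW al0)) tT; rewrite nnegrE ltW.
Qed.

Let measurable_rkN N : measurable_fun setT (rkN N).
Proof.
rewrite /rkN; apply: measurable_sum => i.
by apply: measurable_funM; [exact: measurable_cst|exact: measurable_powk].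
Qed.

Lemma measurable_resolvent_kernel : measurable_fun setT rk.
Proof.
apply: (measurable_fun_cvg measurable_rkN) => t _.
have [C C0 hC] := resolvent_kernel_dist t.
apply/cvgrPdist_le => e e0.
have c : C * k t * (2^-1) ^+ n @[n --> \oo] --> (0 : R).
  rewrite -[X in _ --> X](mulr0 (C * k t)); apply: cvgM; first exact: cvg_cst.
  by apply: cvg_expr; rewrite ger0_norm; lra.
have /cvgrPdist_lt /(_ _ e0) := c; apply: filterS => n.
rewrite /= sub0r normrN => h; apply: (le_trans (hC t n (lexx t))).
by rewrite mulrAC; apply: (le_trans (ler_norm _)); exact: ltW.
Qed.

(** The Neumann series telescopes: convolving with [k] raises the index by [al], and the factor
    [- ka * beta_step] yields the next coefficient. Hence the partial sums solve the equation up to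
    one more term on the right. *)
Let convol_rkN N t : convolvable k (rkN N) t /\ ka * convol k (rkN N) t = ka * k t - rkN N.+1 t.
Proof.
have [h1 h2] : convolvable k (rkN N) t /\
    convol k (rkN N) t = \sum_(n < N) resolvent_kernel_coef n * (beta_step n * powk (n.+2%:R *
      al) t).
  elim: N => [|N [IH1 IH2]].
    have -> : rkN 0 = cst 0 by apply/funext => s; rewrite /rkN big_ord0.
    split.
      have := @integrable0 _ _ R mu setT.
      by apply: eq_integrable => // s _; rewrite mulr0.
    rewrite big_ord0 /convol; under eq_Rintegral do rewrite mulr0.
    by rewrite Rintegral_cst// mul0r.
  have -> : rkN N.+1 = fun s => rkN N s + resolvent_kernel_coef N * powk (N.+1%:R * al) s.
    by apply/funext => s; rewrite /rkN big_ord_recr.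
  have [b1 b2] := convol_powk t al0 (na0 N).
  split; first by apply: convolvableDr => //; exact: convolvableZr.
  rewrite convolDr//; last exact: convolvableZr.
  rewrite convolZr// IH2 big_ord_recr /= b2; congr (_ + _ * (_ * powk _ t)).
  by rewrite -[N.+2%:R]natr1; ring.
split => //; rewrite h2 /rkN big_ord_recl /= mul1r opprD addrA subrr sub0r.
by rewrite mulr_sumr -sumrN; apply: eq_bigr => i _ /=; rewrite /bump /= add1n; ring.
Qed.

(** The partial sums differ from [rk] by at most C 2^-N [k], and [k] convolves with itself; the
    defect of the equation is therefore smaller than every term of a geometric sequence. *)
Lemma convol_resolvent_kernel t : convolvable k rk t /\ rk t + ka * convol k rk t = ka * k t.
Proof.
have [C C0 hC] := resolvent_kernel_dist t.
have [kk1 kk2] := convol_powk t al0 al0.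
have dom N s : `|k (t - s) * (rk s - rkN N s)| <= k (t - s) * (C * (2^-1) ^+ N * k s).
  have [st|st] := leP s t; last first.
    by rewrite (@powk0 _ al (t - s)) ?mul0r ?normr0// subr_le0 ltW.
  by rewrite normrM ger0_norm ?powk_ge0//; apply: ler_wpM2l; [exact: powk_ge0|exact: hC].
have i1 N : convolvable k (fun s => rk s - rkN N s) t.
  apply: (le_convolvable (h := fun s => C * (2^-1) ^+ N * k s)) => //; try exact: measurable_powk.
    by apply: measurable_funB => //; exact: measurable_resolvent_kernel.
  exact: convolvableZr.
have ci : convolvable k rk t.
  have := convolvableDr (i1 0%N) (convol_rkN 0 t).1.
  by apply: eq_convolvable => s; rewrite subrK.
split => //.
apply/eqP; rewrite -subr_eq0; apply/eqP.
apply: (@eq0_geometric_bound _ _ (C * k t + ka * (C * convol k k t)) 2^-1) => [|N].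
  by apply/andP; split; lra.
have [n1 n2] := convol_rkN N t.
have e : convol k rk t = convol k (fun s => rk s - rkN N s) t + convol k (rkN N) t.
  by rewrite convolBr// subrK.
have -> : rk t + ka * convol k rk t - ka * k t = (rk t - rkN N.+1 t) + ka * convol k (fun s =>
  rk s - rkN N s) t.
  by rewrite e mulrDr n2; ring.
apply: (le_trans (ler_normD _ _)); rewrite mulrDl; apply: lerD.
  apply: (le_trans (hC t N.+1 (lexx t))); rewrite mulrAC; apply: ler_wpM2l.
    by rewrite mulr_ge0 ?powk_ge0.
  rewrite exprS -[leRHS]mul1r; apply: ler_wpM2r; first by rewrite exprn_ge0 ?invr_ge0.
  by lra.
rewrite normrM gtr0_norm// -mulrA; apply: ler_wpM2l; first exact: ltW.
apply: (le_trans (normr_convol (i1 N) _ (dom N))); first exact: convolvableZr.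
by rewrite convolZr// mulrAC.
Qed.

End resolvent_series.

(** * Positivity and mass of the resolvent kernel *)

Section resolvent_positive.
Context {R : realType} (al ka : R).
Hypotheses (al0 : 0 < al) (al1 : al < 1) (ka0 : 0 < ka).
Local Notation mu := (@lebesgue_measure R).
Local Notation k := (@powk R al).
Local Notation rk := (@resolvent_kernel R al ka).

Lemma powR_continuous_gt0 (b t : R) : 0 < t -> {for t, continuous (fun x : R => x `^ b)}.
Proof.
move=> t0; apply/differentiable_continuous/derivable1_diffP.
by have [] := is_derive1_powR b t0.
Qed.

Lemma resolvent_kernel_continuous (t : R) : 0 < t -> {for t, continuous rk}.
Proof.
move=> t0; rewrite /resolvent_kernel; apply: cvgM.
  apply/(@cvgrPdist_lt _ _ _ (nbhs t)) => e e0.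
  have /cvgrPdist_lt /(_ _ e0) h := @powR_continuous_gt0 (al - 1) t t0.
  near=> x; rewrite /powk t0 ifT; first by near: x.
  by near: x; exact: lt_nbhsr.
apply/(@cvgrPdist_lt _ _ _ (nbhs t)) => e e0.
have [d d0 hd] := resolvent_kernel_series_continuous al0 ka0 (powR_ge0 t al) e0.
have /cvgrPdist_lt /(_ _ d0) := @powR_continuous_gt0 al t t0.
apply: filterS => x h; rewrite distrC; apply: hd; first exact: powR_ge0.
by rewrite distrC.
Unshelve. all: end_near. Qed.

Lemma resolvent_kernel_gt0_small : exists2 d, 0 < d & forall t, 0 < t -> t < d -> 0 < rk t.
Proof.
have [d d0 hd] := resolvent_kernel_series_continuous al0 ka0 (lexx 0) ka0.
(* The series is within [ka] of its value [ka] at 0 as long as t^al < d. *)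
exists (d `^ al^-1); first exact: powR_gt0.
move=> t t0 td; rewrite /resolvent_kernel mulr_gt0 ?powk_gt0//.
have : `|t `^ al - 0| < d.
  rewrite subr0 ger0_norm ?powR_ge0//.
  have := @gt0_ltr_powR _ _ al0 t (d `^ al^-1).
  rewrite -powRrM mulVf ?gt_eqF// powRr1 ?ltW//; apply => //; rewrite nnegrE ?powR_ge0//.
  exact: ltW.
move=> /(hd _ (powR_ge0 _ _)); rewrite resolvent_kernel_series0// ltr_norml => /andP[h _].
by move: h; rewrite ltrBrDl subrr.
Qed.

(** Multiplied out, both sides are powers with exponent al - 1 <= 0, and the claim becomes t0 (t1 -
    s) <= (t0 - s) t1, that is t1 <= t0. *)
Lemma powk_log_convex (t0 t1 s : R) : 0 < s < t1 -> t1 < t0 ->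
  k (t0 - s) <= k t0 / k t1 * k (t1 - s).
Proof.
move=> /andP[s0 st] tt.
have t10 : 0 < t1 by lra.
rewrite mulrAC ler_pdivlMr ?powk_gt0// /powk !ifT; try lra.
rewrite -!powRM; try lra.
by apply: powR_antitone; [rewrite subr_le0 ltW|apply: mulr_gt0; lra|nra].
Qed.

(* At a first zero [t0], let [ts] maximize [rk] just before [t0] and let
   [c = k t0 / k ts].  Log-convexity of [k] gives
   [(k * rk) t0 <= c * (k * rk) ts + small * rk ts], so that the equations at
   [t0] and [ts] contradict [rk t0 <= 0]. *)
Let resolvent_kernel_no_first_zero (t0 : R) : 0 < t0 -> (forall s : R, 0 < s -> s < t0 ->
  0 < rk s) ->
  0 < rk t0.
Proof.
move=> t00 below; rewrite ltNge; apply/negP => r0.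
have m0 : 0 < powk_beta al 1 by exact: powk_beta_gt0.
set m := powk_beta al 1 in m0.
(* The mass of [ka * k] on (0, d) is at most 1/4, whereas the ratio [k t0 / k ts] will be at least
   1/2: this gap is the contradiction. *)
have [d [d0 dt dz]] : exists d, [/\ 0 < d, d <= t0 / 2 & ka * (m * d `^ al) <= 4^-1].
  have z0 : 0 < (4 * ka * m)^-1 `^ al^-1 by rewrite powR_gt0// invr_gt0 !mulr_gt0.
  exists (Order.min (t0 / 2) ((4 * ka * m)^-1 `^ al^-1)); split.
  - by rewrite lt_min z0 divr_gt0.
  - by rewrite ge_min lexx.
  - set d := Order.min _ _.
    have d0 : 0 < d by rewrite lt_min z0 divr_gt0.
    have h : d `^ al <= (4 * ka * m)^-1.
      have <- : ((4 * ka * m)^-1 `^ al^-1) `^ al = (4 * ka * m)^-1.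
        by rewrite -powRrM mulVf ?gt_eqF// powRr1// invr_ge0 !mulr_ge0 ?ltW.
      by apply: (ge0_ler_powR (ltW al0)); rewrite ?nnegrE ?(ltW d0) ?(ltW z0)// ge_min lexx orbT.
    rewrite mulrA; apply: (le_trans (ler_wpM2l (mulr_ge0 (ltW ka0) (ltW m0)) h)).
    by rewrite le_eqVlt; apply/orP; left; apply/eqP; field; rewrite !gt_eqF.
(* Half of the stretch, so that the cut-off at [t0 - d] in [g1] is already 1 on [t1, t0]. *)
have [t1 t1E] : exists t1, t1 = t0 - d / 2 by eexists.
have t10 : t1 < t0 by clear - t1E d0; lra.
have [ts tsin tsmax] : exists2 c, c \in `[t1, t0] & forall x, x \in `[t1, t0] -> rk x <= rk c.
  apply: EVT_max; first exact: ltW.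
  apply: continuous_in_subspaceT => x; rewrite inE /= in_itv /= => /andP[h _].
  apply: resolvent_kernel_continuous; clear - h t1E dt d0 t00; lra.
move: tsin; rewrite in_itv /= => /andP[ts1 ts2].
have r1 : 0 < rk t1 by apply: below => //; clear - t1E dt d0 t00; lra.
have M0 : 0 < rk ts.
  by apply: (lt_le_trans r1); apply: tsmax; rewrite in_itv /= lexx ltW.
have tst : ts < t0.
  rewrite lt_neqAle ts2 andbT; apply/eqP => E.
  by move: M0; rewrite E ltNge r0.
have [tsp ts2t] : 0 < ts /\ t0 <= 2 * ts by clear - ts1 t1E dt d0 t00; split; lra.
have [ci0 e0] := convol_resolvent_kernel al0 ka0 t0.
have [cis es] := convol_resolvent_kernel al0 ka0 ts.
have kts : 0 < k ts by exact: powk_gt0.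
have c0 : 0 < k t0 / k ts by rewrite divr_gt0 ?powk_gt0.
(* Because t0 <= 2 ts and 2^(al - 1) >= 1/2. *)
have ch : 2^-1 <= k t0 / k ts.
  rewrite ler_pdivlMr// /powk t00 tsp.
  have h : (2 * ts) `^ (al - 1) <= t0 `^ (al - 1).
    by apply: powR_antitone => //; rewrite subr_le0 ltW.
  rewrite powRM ?ler0n ?(ltW tsp)// in h.
  apply: le_trans h; apply: ler_wpM2r; first exact: powR_ge0.
  have := @ler_powR _ 2 _ (-1) (al - 1); rewrite powR_inv1//; apply; first by rewrite ler1n.
  by rewrite lerBrDr addNr ltW.
have ckE : k t0 / k ts * k ts = k t0 by rewrite divfK ?gt_eqF.
set c := k t0 / k ts in c0 ch ckE.
(* [k (t0 - s)] restricted to s > t0 - d; a translation turns its integral into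
   [convol k (powk 1) d]. *)
pose g1 (s : R) := k (t0 - s) * powk 1 (s - (t0 - d)).
have [i1 i1E] := convol_powk (t0 - (t0 - d)) al0 (@ltr01 R).
have mg0 : measurable_fun setT (fun s : R => (k (t0 - (t0 - d) - s) * powk 1 s)%:E).
  by apply: measurable_convol_EFin; exact: measurable_powk.
have Ig : (\int[mu]_s (g1 s)%:E = (m * d `^ al)%:E)%E.
  transitivity (\int[mu]_(s in setT) (k (t0 - (t0 - d) - (s - (t0 - d))) * powk 1 (s - (t0 -
    d)))%:E)%E.
    by apply: eq_integral => s _; rewrite /g1; congr (k _ * _)%:E; ring.
  rewrite (integral_translate (t0 - d) mg0) -EFin_convol// i1E /powk subKr d0.
  by rewrite addrK.
have g1i : mu.-integrable setT (EFin \o g1).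
  apply/integrableP; split.
    apply: measurableT_comp => //; apply: measurable_funM.
      by apply: (measurableT_comp (measurable_powk _)); exact: measurable_funB.
    by apply: (measurableT_comp (measurable_powk _)); exact: measurable_funB.
  under eq_integral do rewrite /= ger0_norm ?mulr_ge0 ?powk_ge0//.
  by rewrite Ig ltry.
have gi2 : mu.-integrable setT (EFin \o (fun s => rk ts * g1 s)).
  have := integrableZl measurableT (rk ts) g1i.
  by apply: eq_integrable => // s _.
have gi3 : mu.-integrable setT (EFin \o (fun s => c * (k (ts - s) * rk s))).
  have := integrableZl measurableT c cis.
  by apply: eq_integrable => // s _.
have main : convol k rk t0 <= c * convol k rk ts + rk ts * (m * d `^ al).
  have -> : m * d `^ al = \int[mu]_s g1 s by rewrite /Rintegral Ig.
  rewrite /convol -RintegralZl// -[X in _ + X]RintegralZl//.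
  rewrite -RintegralD//; apply: le_Rintegral => //.
    have := integrableD measurableT gi3 gi2.
    by apply: eq_integrable => // s _.
  move=> s _.
  have g10 : 0 <= rk ts * g1 s by rewrite mulr_ge0 ?(ltW M0)// mulr_ge0 ?powk_ge0.
  have [s0|s0] := leP s 0; first by rewrite resolvent_kernel_le0// !mulr0 add0r.
  have [sts|tss] := ltP s ts.
    have rs : 0 < rk s by apply: below => //; exact: lt_trans sts tst.
    apply: (@le_trans _ _ (c * (k (ts - s) * rk s))); last by rewrite lerDl.
    rewrite mulrA; apply: ler_wpM2r; first exact: ltW.
    by apply: powk_log_convex => //; rewrite s0.
  rewrite (@powk0 _ al (ts - s)) ?subr_le0// mul0r mulr0 add0r.
  have [st|ts0] := leP t0 s.
    by rewrite (@powk0 _ al (t0 - s)) ?subr_le0// mul0r.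
  rewrite /g1 powk1; last by clear - tss ts1 t1E d0; lra.
  rewrite mulr1 mulrC; apply: ler_wpM2r; first exact: powk_ge0.
  by apply: tsmax; rewrite in_itv /= (le_trans ts1 tss) ltW.
have h1 : ka * convol k rk t0 <= c * (ka * k ts - rk ts) + rk ts * (ka * (m * d `^ al)).
  have -> : ka * k ts - rk ts = ka * convol k rk ts by rewrite -es addrC addKr.
  apply: (le_trans (ler_wpM2l (ltW ka0) main)).
  by rewrite le_eqVlt; apply/orP; left; apply/eqP; ring.
have h2 : ka * k t0 <= ka * convol k rk t0 by rewrite -e0 gerDr.
have h3 := le_trans h2 h1.
rewrite mulrBr [c * (ka * k ts)]mulrCA ckE -addrA lerDl addrC in h3.
have h4 : rk ts * (ka * (m * d `^ al)) <= rk ts * 4^-1 by exact: (ler_wpM2l (ltW M0) dz).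
have h5 : 2^-1 * rk ts <= c * rk ts by exact: (ler_wpM2r (ltW M0) ch).
clear - h3 h4 h5 M0; lra.
Qed.

(** The infimum of the points where [rk] is nonpositive is itself positive, as [rk] is positive near
    0. Everything below it is positive, hence so is [rk] there, and continuity keeps such points
    away from it. *)
Lemma resolvent_kernel_gt0 (t : R) : 0 < t -> 0 < rk t.
Proof.
have [dl dl0 small] := resolvent_kernel_gt0_small.
move=> tp; rewrite ltNge; apply/negP => rt.
pose Z : set R := [set x | 0 < x /\ rk x <= 0].
have Zlb : lbound Z dl.
  move=> x [x0 rx]; rewrite leNgt; apply/negP => xd.
  by have := small x x0 xd; rewrite ltNge rx.
have hZ : has_inf Z by split; [exists t|exists dl].
have t00 : 0 < inf Z by apply: (lt_le_trans dl0); apply: lb_le_inf => //; exists t.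
have rp : 0 < rk (inf Z).
  apply: resolvent_kernel_no_first_zero => // s s0 st; rewrite ltNge; apply/negP => rs.
  by have := ge_inf hZ.2 (conj s0 rs : Z s); rewrite leNgt st.
have /cvgrPdist_lt /(_ _ rp) [d /= d0 hd] := resolvent_kernel_continuous t00.
have [x [x0 rx] xd] := @inf_adherent _ Z d d0 hZ.
have x1 : inf Z <= x := ge_inf hZ.2 (conj x0 rx : Z x).
have : `|rk (inf Z) - rk x| < rk (inf Z).
  by apply: hd; rewrite /= distrC ger0_norm ?subr_ge0// ltrBlDl.
by rewrite ltr_norml => /andP[_]; rewrite ltrBlDr ltrDl ltNge rx.
Qed.

Lemma resolvent_kernel_ge0 (t : R) : 0 <= rk t.
Proof. by have [t0|t0] := leP t 0;
  [rewrite resolvent_kernel_le0|exact/ltW/resolvent_kernel_gt0]. Qed.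

Lemma resolvent_kernel_le t : rk t <= ka * k t.
Proof.
have [ci <-] := convol_resolvent_kernel al0 ka0 t; rewrite lerDl mulr_ge0 ?(ltW ka0)//.
by apply: convol_ge0 => s; rewrite mulr_ge0 ?powk_ge0// resolvent_kernel_ge0.
Qed.

Lemma convolvable_resolvent_kernel (g : R -> R) (t : R) : measurable_fun setT g ->
  convolvable k (fun s => `|g s|) t -> convolvable rk g t.
Proof.
move=> mg ci; apply: le_integrable (integrableZl measurableT ka ci) => //.
  by apply: measurable_convol_EFin => //; exact: measurable_resolvent_kernel.
move=> s _; rewrite /= lee_fin normrM (ger0_norm (resolvent_kernel_ge0 _)).
apply: le_trans (ler_norm _).
by rewrite mulrA; apply: ler_wpM2r => //; exact: resolvent_kernel_le.
Qed.

Definition resolvent_mass (t : R) : R := convol rk (powk 1) t.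
Local Notation rho := resolvent_mass.

Lemma convolvable_resolvent_kernel_powk1 t : convolvable rk (powk 1) t.
Proof.
apply: convolvable_resolvent_kernel; first exact: measurable_powk.
have := (convol_powk t al0 (@ltr01 R)).1.
by apply: eq_convolvable => s; rewrite ger0_norm ?powk_ge0.
Qed.

Lemma resolvent_mass_ge0 t : 0 <= rho t.
Proof. by apply: convol_ge0 => s; rewrite mulr_ge0 ?powk_ge0// resolvent_kernel_ge0. Qed.

Lemma resolvent_mass_le (s t : R) : s <= t -> rho s <= rho t.
Proof.
move=> st; have mr := measurable_resolvent_kernel al0 ka0; have mk := @measurable_powk R 1.
(* After commuting, the dependence on the time sits in the Heaviside factor, which is monotone. *)
rewrite /rho !(convolC _ mr mk).
have i u : convolvable (powk 1) rk u by apply: convolvableC => //;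
  exact: convolvable_resolvent_kernel_powk1.
apply: le_Rintegral => //; [exact: i|exact: i|] => u _.
apply: ler_wpM2r; first exact: resolvent_kernel_ge0.
rewrite /powk !subrr !powRr0; case: ifPn => [h|_]; last by case: ifP.
by rewrite ifT//; lra.
Qed.

(* [k] decreases, so [rk t + ka * k t * rho t <= ka * k t]. *)
Lemma resolvent_mass_lt1 (t : R) : 0 < t -> rho t < 1.
Proof.
move=> t0; have [ci e] := convol_resolvent_kernel al0 ka0 t.
have kt := powk_gt0 al t0.
have mr := measurable_resolvent_kernel al0 ka0; have mk := @measurable_powk R 1.
have h : k t * rho t <= convol k rk t.
  rewrite /rho convolC// -convolZl; last by apply: convolvableC => //;
    exact: convolvable_resolvent_kernel_powk1.
  apply: le_Rintegral => //.
    by apply: convolvableZl; apply: convolvableC => //; exact: convolvable_resolvent_kernel_powk1.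
  move=> s _; have [s0|s0] := leP s 0; first by rewrite resolvent_kernel_le0// !mulr0.
  apply: ler_wpM2r; first exact: resolvent_kernel_ge0.
  have [ts|st] := leP t s; first by rewrite (@powk0 _ 1) ?subr_le0// mulr0 powk_ge0.
  rewrite powk1 ?subr_gt0// mulr1 /powk t0 subr_gt0 st.
  by apply: powR_antitone; [rewrite subr_le0 ltW|lra|lra].
have r0 := resolvent_kernel_gt0 t0.
have : ka * k t * rho t < ka * k t * 1.
  rewrite mulr1 -[ltRHS]e -mulrA; apply: (le_lt_trans (ler_wpM2l (ltW ka0) h)).
  by rewrite ltrDr.
by rewrite ltr_pM2l// mulr_gt0.
Qed.

End resolvent_positive.

(** * Bounded functions supported in positive time *)

Section causal.
Context {R : realType}.
Implicit Types (M t : R) (h : R -> R).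

(** The bound holds at every point, not almost everywhere, so that convolutions with [k] and [rk]
    exist and can be estimated at every time. *)
Definition causal M h : Prop :=
  [/\ measurable_fun setT h, forall s : R, s <= 0 -> h s = 0 & forall s : R, `|h s| <= M].

Lemma causal_le M h s : causal M h -> `|h s| <= M * powk 1 s.
Proof.
move=> [_ h0 hM]; have [s0|s0] := leP s 0; first by rewrite h0// normr0 powk0 ?mulr0.
by rewrite powk1// mulr1.
Qed.

Lemma causal_ge0 M h : causal M h -> 0 <= M.
Proof. by move=> [_ _ /(_ 0)]; exact: le_trans. Qed.

Lemma causal_powk1 : causal 1 (@powk R 1).
Proof.
split; [exact: measurable_powk|by move=> s; exact: powk0|move=> s].
rewrite /powk; case: ifP => _; rewrite ?normr0 ?ler01//.
by rewrite subrr powRr0 normr1.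
Qed.

Lemma causalD M N h g : causal M h -> causal N g -> causal (M + N) (fun s => h s + g s).
Proof.
move=> [mh h0 hM] [mg g0 gN]; split; first exact: measurable_funD.
  by move=> s s0; rewrite h0// g0// addr0.
by move=> s; apply: (le_trans (ler_normD _ _)); exact: lerD.
Qed.

Lemma causalZ M h (a : R) : causal M h -> causal (`|a| * M) (fun s => a * h s).
Proof.
move=> [mh h0 hM]; split; first exact: measurable_funM.
  by move=> s s0; rewrite h0// mulr0.
by move=> s; rewrite normrM; apply: ler_wpM2l.
Qed.

Lemma causal_le_bound M N h : M <= N -> causal M h -> causal N h.
Proof. by move=> MN [mh h0 hM]; split => // s; apply: le_trans MN. Qed.

Lemma causal_ext M h g : h =1 g -> causal M h -> causal M g.
Proof. by move=> /funext ->. Qed.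

Context (al : R) (al0 : 0 < al).
Local Notation k := (@powk R al).

Lemma convolvable_k_causal M h t : causal M h -> convolvable k h t.
Proof.
move=> ch; have [mh _ _] := ch.
have i := convolvableZr M (convol_powk t al0 (@ltr01 R)).1.
apply: le_convolvable i => //; first exact: measurable_powk.
by move=> s; rewrite normrM ger0_norm ?powk_ge0//; apply: ler_wpM2l;
  [exact: powk_ge0|exact: causal_le].
Qed.

End causal.

(** * Convolution with the resolvent kernel and the coefficients of the solution *)

Section resolvent_family.
Context {R : realType} (al ka : R).
Hypotheses (al0 : 0 < al) (al1 : al < 1) (ka0 : 0 < ka).
Local Notation k := (@powk R al).
Local Notation rk := (@resolvent_kernel R al ka).
Local Notation rho := (@resolvent_mass R al ka).
Implicit Types (M t : R) (h : R -> R).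

Let mk : measurable_fun setT k. Proof. exact: measurable_powk. Qed.
Let mr : measurable_fun setT rk. Proof. exact: measurable_resolvent_kernel. Qed.
Let k0 t : 0 <= k t. Proof. exact: powk_ge0. Qed.
Let r0 t : 0 <= rk t. Proof. exact: resolvent_kernel_ge0. Qed.

Lemma convolvable_resolvent_kernel_causal M h t : causal M h -> convolvable rk h t.
Proof.
move=> [mh h0 hM]; apply: convolvable_resolvent_kernel => //;
  apply: (convolvable_k_causal (M := M) al0) => //; split.
- exact: measurableT_comp.
- by move=> s /h0 ->; rewrite normr0.
- by move=> s; rewrite normr_id.
Qed.

Lemma convol_resolvent_kernel_causal_le M h t : causal M h -> `|convol rk h t| <= M * rho t.
Proof.
move=> ch; have c1 := convolvable_resolvent_kernel_powk1 al0 al1 ka0 t.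
rewrite /resolvent_mass -convolZr//; apply: normr_convol;
  [exact: (convolvable_resolvent_kernel_causal _ ch)|exact: convolvableZr|].
by move=> s; rewrite normrM ger0_norm//; apply: ler_wpM2l => //; exact: causal_le.
Qed.

Lemma resolvent_mass_le1 t : rho t <= 1.
Proof.
have [t0|t0] := leP t 0; last by apply/ltW/resolvent_mass_lt1.
apply: (@le_trans _ _ (rho 1)); last by apply/ltW/resolvent_mass_lt1.
by apply: resolvent_mass_le => //; apply: le_trans t0 _.
Qed.

Lemma causal_convol_resolvent_kernel M h : causal M h -> causal M (convol rk h).
Proof.
move=> ch; have [mh h0 hM] := ch; have M0 := causal_ge0 ch; split.
- exact: measurable_convol.
- move=> s s0; rewrite /convol /Rintegral (eq_integral (cst 0%E)) ?integral0// => u _.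
  have [u0|u0] := leP u 0; first by rewrite h0// mulr0.
  by rewrite resolvent_kernel_le0 ?mul0r//; lra.
- move=> s; apply: (le_trans (convol_resolvent_kernel_causal_le s ch)).
  by rewrite -[leRHS]mulr1; apply: ler_wpM2l => //; exact: resolvent_mass_le1.
Qed.

Let convol_k_resolvent_kernel : convol k rk = fun t => k t - ka^-1 * rk t.
Proof.
apply/funext => t; have [_ e] := convol_resolvent_kernel al0 ka0 t.
have kn : ka != 0 by rewrite gt_eqF.
by rewrite -[k t](mulKf kn) -e mulrDr mulKf// addrAC subrr add0r.
Qed.

Let cviK M h t : causal M h -> convolvable (fun t => k t - ka^-1 * rk t) h t.
Proof.
by move=> ch; apply: convolvableBl;
  [exact: (convolvable_k_causal al0 _ ch)|apply: convolvableZl;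
  exact: (convolvable_resolvent_kernel_causal _ ch)].
Qed.

Let cvK M h t : causal M h -> convol (fun t =>
  k t - ka^-1 * rk t) h t = convol k h t - ka^-1 * convol rk h t.
Proof.
move=> ch; have c1 := convolvable_resolvent_kernel_causal t ch.
by rewrite convolBl ?convolZl//; [exact: (convolvable_k_causal al0 _ ch)|exact: convolvableZl].
Qed.

(** Associativity, combined with the resolvent equation in the form k * rk = k - ka^-1 rk. *)
Lemma convol_k_convol_resolvent_kernel M h t : causal M h ->
  convol k (convol rk h) t = convol k h t - ka^-1 * convol rk h t.
Proof.
move=> ch; have [mh _ _] := ch.
have := @convolA R k rk h t mk mr mh k0 r0 (fun x => (convol_resolvent_kernel al0 ka0 x).1).
by rewrite convol_k_resolvent_kernel => /(_ (cviK t ch))[_ -> _]; exact: (cvK _ ch).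
Qed.

Lemma convol_resolvent_kernel_convol_k M h t : causal M h ->
  convolvable rk (convol k h) t /\ convol rk (convol k h) t = convol k h t - ka^-1 * convol rk
    h t.
Proof.
move=> ch; have [mh _ _] := ch.
have e : convol rk k = fun t => k t - ka^-1 * rk t.
  by rewrite -convol_k_resolvent_kernel; apply/funext => x; rewrite convolC.
have := @convolA R rk k h t mr mk mh r0 k0 (fun x =>
  convolvableC mk mr (convol_resolvent_kernel al0 ka0 x).1).
by rewrite e => /(_ (cviK t ch))[h1 h2 _]; split => //; rewrite h2; exact: (cvK _ ch).
Qed.

(* Iterating [u = (1 - \int r) b + r * (B u)], which is
   [u = b + c k * (l (B u - u))] convolved with [r], expands [u] as
   [\sum_n series_coef n * B^n b] with nonnegative coefficients of sum at most 1. *)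
Fixpoint series_coef (n : nat) : R -> R :=
  if n is n'.+1 then convol rk (series_coef n') else fun t => powk 1 t - rho t.
Local Notation ck := series_coef.

Let c0_01 t : 0 <= ck 0 t /\ ck 0 t <= powk 1 t.
Proof.
rewrite /= subr_ge0 gerBl resolvent_mass_ge0//; split => //.
have := convol_resolvent_kernel_causal_le t (@causal_powk1 R); rewrite mul1r.
have [t0|t0] := leP t 0; last by rewrite powk1// => _; exact: resolvent_mass_le1.
move=> _; have [_ /(_ t t0) e _] := causal_convol_resolvent_kernel (@causal_powk1 R).
by rewrite /resolvent_mass e powk_ge0.
Qed.

Lemma causal_series_coef n : causal 1 (ck n).
Proof.
elim: n => [|n IH]; last exact: causal_convol_resolvent_kernel.
split.
- have [m _ _] := causal_convol_resolvent_kernel (@causal_powk1 R).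
  by apply: measurable_funB => //; exact: measurable_powk.
- move=> s s0; have [h1 h2] := c0_01 s; apply/eqP; rewrite eq_le h1 andbT.
  by apply: (le_trans h2); rewrite powk0.
- move=> s; have [h1 h2] := c0_01 s; rewrite ger0_norm//; apply: (le_trans h2).
  by have [_ _ /(_ s)] := @causal_powk1 R; apply: le_trans; exact: ler_norm.
Qed.

Lemma series_coef_ge0 n t : 0 <= ck n t.
Proof.
elim: n t => [|n IH] t; first exact: (c0_01 t).1.
by apply: convol_ge0 => s; rewrite mulr_ge0.
Qed.

(** Each convolution with [rk] costs at most [rho T] up to time [T], the mass being monotone; the
    series is thus geometric, uniformly for t <= T. *)
Lemma series_coef_le_exp n t T : t <= T -> ck n t <= rho T ^+ n.
Proof.
elim: n t => [|n IH] t tT.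
  have [_ _ /(_ t)] := causal_series_coef 0; rewrite expr0; apply: le_trans; exact: ler_norm.
rewrite exprSr [ck n.+1 t]/=; apply: (@le_trans _ _ (rho T ^+ n * rho t)); last first.
  by apply: ler_wpM2l; [rewrite exprn_ge0// resolvent_mass_ge0|exact: resolvent_mass_le].
have c1 := convolvable_resolvent_kernel_powk1 al0 al1 ka0 t.
rewrite /resolvent_mass -convolZr//; apply: le_convol;
  [exact: (convolvable_resolvent_kernel_causal _ (causal_series_coef n))|exact: convolvableZr|].
move=> s; have [ts|st] := leP t s.
  by rewrite resolvent_kernel_le0 ?mul0r// subr_le0.
apply: ler_wpM2l => //; have [s0|s0] := leP s 0.
  by have [_ cn0 _] := causal_series_coef n; rewrite cn0 ?powk0 ?mulr0.
by rewrite powk1// mulr1; apply: IH; apply/ltW/(lt_le_trans st).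
Qed.

(** Induction: a sum with one more term is (1 - rho) plus [rk] convolved with the previous sum,
    hence at most (1 - rho) + rk * 1 = 1 for t > 0. *)
Lemma sum_series_coef_le N t : \sum_(n < N) ck n t <= powk 1 t.
Proof.
elim: N t => [|N IH] t; first by rewrite big_ord0 powk_ge0.
rewrite big_ord_recl /=.
have [i e] : convolvable rk (fun s => \sum_(n < N) ck n s) t /\
    convol rk (fun s => \sum_(n < N) ck n s) t = \sum_(n < N) ck n.+1 t.
  elim: N {IH} => [|N [IH1 IH2]].
    have E : (fun s : R => \sum_(n < 0) ck n s) = cst 0.
      by apply/funext => s; rewrite big_ord0.
    rewrite E big_ord0; split.
      have := @integrable0 _ _ R (@lebesgue_measure R) setT.
      by apply: eq_integrable => // s _; rewrite mulr0.
    by rewrite /convol; under eq_Rintegral do rewrite mulr0; rewrite Rintegral_cst// mul0r.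
  have E : (fun s : R => \sum_(n < N.+1) ck n s) = (fun s => \sum_(n < N) ck n s + ck N s).
    by apply/funext => s; rewrite big_ord_recr.
  have ci := convolvable_resolvent_kernel_causal t (causal_series_coef N).
  by rewrite E; split; [exact: convolvableDr|rewrite convolDr// IH2 big_ord_recr].
have {}e : \sum_(i < N) convol rk (ck i) t = convol rk (fun s =>
  \sum_(n < N) ck n s) t by rewrite e.
rewrite e -lerBrDl opprD opprK addrA subrr add0r.
apply: le_convol => //; first exact: convolvable_resolvent_kernel_powk1.
by move=> s; apply: ler_wpM2l.
Qed.

(** This and the next lemma compare the coefficients of [b] and of [iter n.+1 B b] in u + ka (k * u)
    = b + ka (k * B u). *)
Lemma series_coef_eq0 t : ck 0 t + ka * convol k (ck 0) t = powk 1 t.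
Proof.
have c1 := @causal_powk1 R.
rewrite [convol k _ t]convolBr;
  [|exact: (convolvable_k_causal al0 _ c1)|exact: (convolvable_k_causal al0 _
  (causal_convol_resolvent_kernel c1))].
by rewrite (convol_k_convol_resolvent_kernel t c1) opprB addrC subrKC mulrA divff ?gt_eqF//
  mul1r subrKC.
Qed.

Lemma series_coef_eqS n t : ck n.+1 t + ka * convol k (ck n.+1) t = ka * convol k (ck n) t.
Proof.
rewrite [convol k (ck n.+1) t](convol_k_convol_resolvent_kernel t (causal_series_coef n))
  mulrBr mulrA divff ?gt_eqF// mul1r.
by rewrite subrKC.
Qed.

End resolvent_family.

(** * Inner product: Cauchy-Schwarz and duality *)

Section dot_product.
Context {R : realType} {X : completeNormedModType R} (dot : {dot X for idfun}).
Hypothesis dotn : forall x : X, dot x x = `|x| ^+ 2.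

Lemma dotC (x y : X) : dot x y = dot y x.
Proof. by rewrite (hermC dot x y) /= expr0 mul1r. Qed.

Lemma dotPl (a : R) (x y z : X) : dot (a *: x + y) z = a * dot x z + dot y z.
Proof. by rewrite linearDl /= linearZl_LR. Qed.

Lemma dotDl (x y z : X) : dot (x + y) z = dot x z + dot y z.
Proof. by rewrite -[x]scale1r dotPl scale1r mul1r. Qed.

Lemma dot0l (z : X) : dot 0 z = 0.
Proof. by have := dotDl 0 0 z; rewrite addr0 => /eqP;
  rewrite -subr_eq0 opprD addrA subrr sub0r oppr_eq0 => /eqP. Qed.

Lemma dotZl (a : R) (x z : X) : dot (a *: x) z = a * dot x z.
Proof. by rewrite -[a *: x]addr0 dotPl dot0l addr0. Qed.

Lemma dotNl (x z : X) : dot (- x) z = - dot x z.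
Proof. by rewrite -scaleN1r dotZl mulN1r. Qed.

Lemma dotBl (x y z : X) : dot (x - y) z = dot x z - dot y z.
Proof. by rewrite dotDl dotNl. Qed.

Lemma dot_suml n (F : 'I_n -> X) z : dot (\sum_(i < n) F i) z = \sum_(i < n) dot (F i) z.
Proof.
elim: n F => [|n IH] F; first by rewrite !big_ord0 dot0l.
by rewrite !big_ord_recl dotDl IH.
Qed.

Lemma dot_CS (x y : X) : `|dot x y| <= `|x| * `|y|.
Proof.
have [->|y0] := eqVneq y 0; first by rewrite dotC dot0l !normr0 mulr0.
have ny : 0 < `|y| by rewrite normr_gt0.
have h : 0 <= `|x - (dot x y / `|y| ^+ 2) *: y| ^+ 2 by rewrite exprn_ge0.
set s := dot x y / `|y| ^+ 2 in h.
have e : s * `|y| ^+ 2 = dot x y by rewrite /s divfK// expf_neq0// gt_eqF.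
have h2 : (dot x y) ^+ 2 <= (`|x| * `|y|) ^+ 2.
  move: h; rewrite -dotn dotBl dotZl (dotC x (_ - _)) (dotC y (_ - _)) !dotBl !dotZl (dotC y x).
  rewrite !dotn e subrr mulr0 subr0 subr_ge0.
  by rewrite /s mulrAC ler_pdivrMr ?exprn_gt0// -expr2 exprMn.
rewrite -[leRHS]ger0_norm ?mulr_ge0// -ler_sqr ?nnegrE// !real_normK ?num_real//.
Qed.

Lemma dot_norm_le (x : X) (C : R) : 0 <= C -> (forall z, dot x z <= C * `|z|) -> `|x| <= C.
Proof.
move=> C0 /(_ x); rewrite dotn expr2.
have [->|x0] := eqVneq x 0; first by rewrite normr0.
by rewrite ler_pM2r// normr_gt0.
Qed.

Lemma dot_inj (x y : X) : (forall z, dot x z = dot y z) -> x = y.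
Proof.
move=> h; apply/eqP; rewrite -subr_eq0 -normr_eq0 -sqrf_eq0 -dotn dotBl h subrr//.
Qed.

Lemma cvg_dotl (F : set_system nat) {FF : ProperFilter F} (u : nat -> X) (x z : X) :
  u @ F --> x -> dot (u n) z @[n --> F] --> dot x z.
Proof.
move=> ux; apply/cvgrPdist_le => e e0.
have z1 : 0 < `|z| + 1 by rewrite ltr_wpDl.
have ez : 0 < e / (`|z| + 1) by rewrite divr_gt0.
have /cvgrPdist_le /(_ _ ez) := ux; apply: filterS => n h.
rewrite -dotBl; apply: (le_trans (dot_CS _ _)).
apply: (le_trans (ler_wpM2r (normr_ge0 z) h)).
rewrite mulrAC ler_pdivrMr//; apply: ler_wpM2l; first exact: ltW.
by rewrite lerDl.
Qed.

End dot_product.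

(** * Resolvents and the contractions approximating the identity *)

Section resolvents.
Context {R : realType} {X : completeNormedModType R} (A : linear_operator X).
Hypothesis hrho : [set l : R | 0 < l] `<=` resolvent_set A.
Hypothesis hres : forall l : R, 0 < l -> l * operator_norm (resolvent A l) <= 1.
Implicit Types (l m : R) (x y : X).

Lemma op_domD x y : op_dom A x -> op_dom A y -> op_dom A (x + y).
Proof. by move=> hx hy; rewrite -[x]scale1r; exact: op_domP. Qed.

Lemma op_domZ (a : R) x : op_dom A x -> op_dom A (a *: x).
Proof. by move=> hx; rewrite -[_ *: x]addr0; apply: op_domP => //; exact: op_dom0. Qed.

Lemma op_domB x y : op_dom A x -> op_dom A y -> op_dom A (x - y).
Proof. by move=> hx hy; apply: op_domD => //; rewrite -scaleN1r; exact: op_domZ. Qed.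

Lemma opD x y : op_dom A x -> op_dom A y -> A (x + y) = A x + A y.
Proof. by move=> hx hy; rewrite -{1}[x]scale1r op_linear// scale1r. Qed.

Lemma op0 : A 0 = 0.
Proof.
have := opD (op_dom0 A) (op_dom0 A); rewrite addr0 => /eqP.
by rewrite -subr_eq0 opprD addrA subrr sub0r oppr_eq0 => /eqP.
Qed.

Lemma opZ (a : R) x : op_dom A x -> A (a *: x) = a *: A x.
Proof.
move=> hx; rewrite -[a *: x]addr0 op_linear//; last exact: op_dom0.
by rewrite op0 addr0.
Qed.

Lemma opB x y : op_dom A x -> op_dom A y -> A (x - y) = A x - A y.
Proof.
move=> hx hy; have hN : op_dom A (-1 *: y) by exact: op_domZ.
by rewrite -[in LHS]scaleN1r opD// opZ// scaleN1r.
Qed.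

Lemma resolventP l y : 0 < l ->
  op_dom A (resolvent A l y) /\ l *: resolvent A l y - A (resolvent A l y) = y.
Proof.
move=> l0; have [/(_ y)[x [hx _]] _] := hrho l0.
exact: (@xgetPex _ 0 [set x | op_dom A x /\ l *: x - A x = y] (ex_intro _ x hx)).
Qed.

Lemma op_dom_resolvent l y : 0 < l -> op_dom A (resolvent A l y).
Proof. by move=> /(resolventP y)[]. Qed.

Lemma op_resolvent l y : 0 < l -> A (resolvent A l y) = l *: resolvent A l y - y.
Proof. by move=> /(resolventP y)[_ e]; rewrite -{3}e opprB addrC subrK. Qed.

Lemma resolvent_unique l x y : 0 < l -> op_dom A x -> l *: x - A x = y -> resolvent A l y = x.
Proof.
move=> l0 dx ex; have [/(_ y)[z [hz uz]] _] := hrho l0.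
by rewrite -(uz x (conj dx ex)); apply/esym/uz; exact: resolventP.
Qed.

Lemma resolventK l x : 0 < l -> op_dom A x -> resolvent A l (l *: x - A x) = x.
Proof. by move=> l0 dx; apply: resolvent_unique. Qed.

Lemma resolvent_linear l (a : R) x y : 0 < l ->
  resolvent A l (a *: x + y) = a *: resolvent A l x + resolvent A l y.
Proof.
move=> l0; have [dx ex] := resolventP x l0; have [dy ey] := resolventP y l0.
apply: resolvent_unique => //; first exact: op_domP.
rewrite op_linear// -{3}ex -{3}ey scalerDr scalerBr !scalerA mulrC opprD addrACA.
by [].
Qed.

Lemma op_resolvent_comm l x : 0 < l -> op_dom A x -> A (resolvent A l x) = resolvent A l (A x).
Proof.
move=> l0 dx; have [dr er] := resolventP x l0.
apply/esym/resolvent_unique => //.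
  by rewrite op_resolvent//; apply: op_domB => //; exact: op_domZ.
rewrite {2}op_resolvent// opB ?opZ//; last exact: op_domZ.
by rewrite opprB addrC subrK.
Qed.

Lemma resolvent0 l : 0 < l -> resolvent A l 0 = 0.
Proof.
by move=> l0; apply: resolvent_unique => //; [exact: op_dom0|rewrite scaler0 op0 subr0].
Qed.

Lemma resolventZ l (a : R) x : 0 < l -> resolvent A l (a *: x) = a *: resolvent A l x.
Proof. by move=> l0; rewrite -[a *: x]addr0 resolvent_linear// resolvent0// addr0. Qed.

Lemma resolventB l x y : 0 < l -> resolvent A l (x - y) = resolvent A l x - resolvent A l y.
Proof. by move=> l0; rewrite addrC -scaleN1r resolvent_linear// scaleN1r addrC. Qed.

Lemma resolvent_comm l m x : 0 < l -> 0 < m ->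
  resolvent A l (resolvent A m x) = resolvent A m (resolvent A l x).
Proof.
move=> l0 m0; have [dz ez] := resolventP x m0.
apply/esym/resolvent_unique => //; first exact: op_dom_resolvent.
by rewrite op_resolvent_comm// -resolventZ// -resolventB// ez.
Qed.

(** [operator_norm] is a supremum of reals, an upper bound only because [resolvent_set] includes
    boundedness of the resolvent. *)
Lemma resolvent_le l x : 0 < l -> l * `|resolvent A l x| <= `|x|.
Proof.
move=> l0; have [->|x0] := eqVneq x 0; first by rewrite resolvent0// normr0 mulr0.
have nx : 0 < `|x| by rewrite normr_gt0.
have [_ [M hM]] := hrho l0.
have : `|resolvent A l (`|x|^-1 *: x)| <= operator_norm (resolvent A l).
  apply: ub_le_sup.
    exists `|M| => _ [y /= y1 <-]; apply: (le_trans (hM y)).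
    apply: (le_trans (ler_wpM2r (normr_ge0 y) (ler_norm M))).
    by rewrite -[leRHS]mulr1; apply: ler_wpM2l.
  exists (`|x|^-1 *: x) => //=.
  by rewrite normrZ ger0_norm ?invr_ge0// mulVf// gt_eqF.
rewrite resolventZ// normrZ ger0_norm ?invr_ge0// -(ler_pM2l l0) => /le_trans /(_ (hres l0)).
by rewrite mulrCA mulrC ler_pdivrMr// mul1r.
Qed.

(** The Yosida approximation of [A] itself is [A (yosida l x)], equal to [l *: (yosida l x - x)]. *)
Definition yosida l x : X := l *: resolvent A l x.

Lemma yosida_linear l (a : R) x y : 0 < l ->
  yosida l (a *: x + y) = a *: yosida l x + yosida l y.
Proof. by move=> l0; rewrite /yosida resolvent_linear// scalerDr !scalerA mulrC. Qed.

Lemma yosidaB l x y : 0 < l -> yosida l (x - y) = yosida l x - yosida l y.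
Proof. by move=> l0; rewrite /yosida resolventB// scalerBr. Qed.

Lemma yosida_le l x : 0 < l -> `|yosida l x| <= `|x|.
Proof. by move=> l0; rewrite normrZ gtr0_norm//; exact: resolvent_le. Qed.

Lemma op_dom_yosida l x : 0 < l -> op_dom A (yosida l x).
Proof. by move=> l0; apply: op_domZ; exact: op_dom_resolvent. Qed.

Lemma op_yosida l x : 0 < l -> A (yosida l x) = l *: (yosida l x - x).
Proof. by move=> l0; rewrite opZ ?op_resolvent//; exact: op_dom_resolvent. Qed.

Lemma op_yosida_comm l x : 0 < l -> op_dom A x -> A (yosida l x) = yosida l (A x).
Proof. by move=> l0 dx; rewrite opZ ?op_resolvent_comm//; exact: op_dom_resolvent. Qed.

Lemma yosida_comm l m x : 0 < l -> 0 < m -> yosida l (yosida m x) = yosida m (yosida l x).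
Proof.
by move=> l0 m0; rewrite /yosida !resolventZ// resolvent_comm// !scalerA mulrC.
Qed.

(** On the domain, [l *: (yosida l x - x)] is [yosida l (A x)], and [yosida l] contracts. *)
Lemma yosida_dist_le l x : 0 < l -> op_dom A x -> l * `|x - yosida l x| <= `|A x|.
Proof.
move=> l0 dx; rewrite distrC -[X in X * _]gtr0_norm// -normrZ -op_yosida//.
by rewrite op_yosida_comm//; exact: yosida_le.
Qed.

Hypothesis hdense : densely_defined A.

Lemma op_dom_dense x (e : R) : 0 < e -> exists2 y, op_dom A y & `|x - y| < e.
Proof.
move=> e0; have ob : open (ball x e) by exact: ball_open.
have [|y [yb yd]] := hdense _ ob; first by exists x; exact: ballxx.
by exists y => //; move: yb; rewrite -ball_normE.
Qed.

Lemma yosida_cvg x (e : R) : 0 < e -> exists2 L, 0 < L & forall l, L <= l ->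
  `|x - yosida l x| <= e.
Proof.
move=> e0; have e3 : 0 < e / 3 by rewrite divr_gt0.
have [y dy xy] := op_dom_dense x e3.
(* From here on |A y| / l <= e / 3; the added 1 makes the threshold positive. *)
exists (3 * (`|A y| + 1) / e); first by rewrite !divr_gt0// mulr_gt0// ltr_wpDl.
move=> l lL.
have l0 : 0 < l by apply: lt_le_trans lL; rewrite !divr_gt0// mulr_gt0// ltr_wpDl.
have h1 := yosida_dist_le l0 dy.
have h2 : `|y - yosida l y| <= e / 3.
  rewrite -(ler_pM2l l0); apply: (le_trans h1).
  rewrite ler_pdivrMr// in lL; rewrite mulrA ler_pdivlMr//.
  apply: le_trans lL; rewrite mulrC; apply: ler_wpM2l => //; by rewrite lerDl.
have -> : x - yosida l x = (x - y) + (y - yosida l y) - yosida l (x - y).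
  by rewrite yosidaB// opprB !addrA !subrK.
apply: (le_trans (ler_normB _ _)).
apply: (@le_trans _ _ (e / 3 + e / 3 + e / 3)); last by lra.
apply: lerD; last by apply: (le_trans (yosida_le _ l0)); exact: ltW.
by apply: (le_trans (ler_normD _ _)); apply: lerD => //; exact: ltW.
Qed.

End resolvents.

(** * The approximate equation for a linear contraction B: solution and stability *)

Section resolvent_operators.
Context {R : realType} {X : completeNormedModType R} (dot : {dot X for idfun}).
Hypothesis dotn : forall x : X, dot x x = `|x| ^+ 2.
Context (al c l : R).
Hypotheses (al0 : 0 < al) (al1 : al < 1) (c0 : 0 < c) (l0 : 0 < l).
Context (B : X -> X).
Hypothesis B_linear : forall (a : R) x y, B (a *: x + y) = a *: B x + B y.
Hypothesis B_le : forall x, `|B x| <= `|x|.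
Local Notation k := (@powk R al).
Local Notation ka := (l * c).
Local Notation ck := (@series_coef R al ka).
Local Notation rk := (@resolvent_kernel R al ka).
Local Notation rho := (@resolvent_mass R al ka).

Let ka0 : 0 < ka. Proof. exact: mulr_gt0. Qed.

Definition yosida_term (t : R) (b : X) (n : nat) : X := ck n t *: iter n B b.

Definition yosida_solution (t : R) (b : X) : X := limn (series (yosida_term t b)).
Local Notation U := yosida_solution.

Lemma linear_map0 (L : X -> X) : (forall (a : R) x y, L (a *: x + y) = a *: L x + L y) -> L 0 = 0.
Proof.
move=> h; have := h 1 0 0; rewrite !scale1r addr0 => /eqP.
by rewrite -subr_eq0 opprD addrA subrr sub0r oppr_eq0 => /eqP.
Qed.

Let iter_le n b : `|iter n B b| <= `|b|.
Proof. by elim: n => [|n IH] //=; exact: le_trans (B_le _) IH. Qed.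

Let rho01 (T : R) : 0 < T -> 0 <= rho T < 1.
Proof. by move=> T0; rewrite resolvent_mass_ge0//= resolvent_mass_lt1. Qed.

Let yosida_term_le (T t : R) b n : t <= T -> `|yosida_term t b n| <= `|b| * rho T ^+ n.
Proof.
move=> tT; rewrite normrZ mulrC (ger0_norm (series_coef_ge0 al0 al1 ka0 n t)).
by apply: ler_pM => //; [exact: series_coef_ge0|exact: series_coef_le_exp].
Qed.

Lemma yosida_solution_series_dist (T t : R) b N : 0 < T -> t <= T ->
  `|U t b - series (yosida_term t b) N| <= `|b| * rho T ^+ N / (1 - rho T).
Proof.
move=> T0 tT.
have [_ h] := geometric_series_dist (rho01 T0) (fun n => yosida_term_le b n tT).
exact: h.
Qed.

Lemma cvg_yosida_solution t b : series (yosida_term t b) @ \oo --> U t b.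
Proof.
have T0 : 0 < `|t| + 1 by rewrite ltr_wpDl.
have tT : t <= `|t| + 1 by apply: (le_trans (ler_norm t)); rewrite lerDl.
by have [h _] := geometric_series_dist (rho01 T0) (fun n => yosida_term_le b n tT).
Qed.

Lemma yosida_solution_le0 t b : t <= 0 -> U t b = 0.
Proof.
move=> t0; apply: cvg_lim => //; rewrite (_ : series _ = cst 0); first exact: cvg_cst.
apply/funext => n; rewrite /series /= big1// => i _.
by have [_ e _] := causal_series_coef al0 al1 ka0 i; rewrite /yosida_term e// scale0r.
Qed.

Lemma yosida_solution_le t b : `|U t b| <= `|b| * powk 1 t.
Proof.
have h : `|series (yosida_term t b) n| @[n --> \oo] --> `|U t b| by apply: cvg_norm;
  exact: cvg_yosida_solution.
rewrite -(cvg_lim _ h) //; apply: limr_le; first by apply/cvg_ex; eexists; exact: h.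
apply: nearW => N; rewrite /series /= big_mkord.
apply: (le_trans (ler_norm_sum _ _ _)).
apply: (@le_trans _ _ (\sum_(i < N) `|b| * ck i t)).
  apply: ler_sum => i _; rewrite normrZ mulrC (ger0_norm (series_coef_ge0 al0 al1 ka0 i t)).
  by apply: ler_wpM2r; [exact: series_coef_ge0|exact: iter_le].
by rewrite -mulr_sumr; apply: ler_wpM2l => //; exact: sum_series_coef_le.
Qed.

Lemma yosida_solution_norm t b : `|U t b| <= `|b|.
Proof.
apply: (le_trans (yosida_solution_le t b)); rewrite -[leRHS]mulr1; apply: ler_wpM2l => //.
by have [_ _ /(_ t)] := @causal_powk1 R; apply: le_trans; exact: ler_norm.
Qed.

Lemma yosida_solution_linear t (a : R) x y : U t (a *: x + y) = a *: U t x + U t y.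
Proof.
apply: cvg_lim => //.
have -> : series (yosida_term t (a *: x + y)) = fun n =>
  a *: series (yosida_term t x) n + series (yosida_term t y) n.
  apply/funext => n; rewrite /series /= scaler_sumr -big_split /=; apply: eq_bigr => i _.
  rewrite /yosida_term; have -> : iter i B (a *: x + y) = a *: iter i B x + iter i B y.
    by elim: i => [|i IH] //=; rewrite IH B_linear.
  by rewrite scalerDr !scalerA mulrC.
by apply: cvgD; [apply: cvgZr; exact: cvg_yosida_solution|exact: cvg_yosida_solution].
Qed.

Lemma yosida_solutionB t x y : U t (x - y) = U t x - U t y.
Proof. by rewrite addrC -scaleN1r yosida_solution_linear scaleN1r addrC. Qed.

(** Applied to [B] itself and to the Yosida contractions at other parameters; the bound on [L]
    carries it through the limit of the series. *)
Lemma yosida_solution_comm (L : X -> X) (K : R) t b :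
  (forall (a : R) x y, L (a *: x + y) = a *: L x + L y) ->
  (forall x, `|L x| <= K * `|x|) -> (forall x, L (B x) = B (L x)) ->
  U t (L b) = L (U t b).
Proof.
move=> Ll LK LB; apply: cvg_lim => //.
have LZ (a : R) x : L (a *: x) = a *: L x by rewrite -[a *: x]addr0 Ll linear_map0// addr0.
have LBB x y : L (x - y) = L x - L y by rewrite addrC -scaleN1r Ll scaleN1r addrC.
have -> : series (yosida_term t (L b)) = fun n => L (series (yosida_term t b) n).
  apply/funext; elim => [|n IH]; first by rewrite /series /= !big_geq// linear_map0.
  rewrite !seriesSr IH.
  have -> : series (yosida_term t b) n + yosida_term t b n = 1 *: series (yosida_term t b) n +
    yosida_term t b n.
    by rewrite scale1r.
  rewrite Ll scale1r; congr (_ + _); rewrite /yosida_term LZ; congr (_ *: _).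
  by elim: n {IH} => [|n IH] //=; rewrite IH LB.
apply/cvgrPdist_le => e e0.
have K0 : 0 < `|K| + 1 by rewrite ltr_wpDl.
have eK : 0 < e / (`|K| + 1) by rewrite divr_gt0.
have /cvgrPdist_le /(_ _ eK) := @cvg_yosida_solution t b; apply: filterS => n h.
rewrite -LBB; apply: (le_trans (LK _)).
apply: (le_trans (ler_wpM2r (normr_ge0 _) (ler_norm K))).
apply: (le_trans (ler_wpM2l (normr_ge0 K) h)).
rewrite mulrCA; rewrite -[leRHS]mulr1; apply: ler_wpM2l; first exact: ltW.
by rewrite ler_pdivrMr// mul1r lerDl.
Qed.

Lemma causal_dot_yosida_solution b x : causal (`|b| * `|x|) (fun t => dot (U t b) x).
Proof.
split.
- apply: (measurable_fun_cvg (h := fun n t => \sum_(i < n) ck i t * dot (iter i B b) x)).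
    move=> n; apply: measurable_sum => i; apply: measurable_funM => //.
    by have [] := causal_series_coef al0 al1 ka0 i.
  move=> t _.
  have E : (fun n : nat => \sum_(i < n) ck i t * dot (iter i B b) x) =
    (fun n : nat => dot (series (yosida_term t b) n) x).
    apply/funext => n; rewrite /series /= big_mkord dot_suml.
    by apply: eq_bigr => i _; rewrite /yosida_term dotZl.
  by rewrite E; exact: (cvg_dotl dotn (@cvg_yosida_solution t b)).
- by move=> s s0; rewrite yosida_solution_le0// dot0l.
- by move=> s; apply: (le_trans (dot_CS dotn _ _)); apply: ler_wpM2r => //;
  exact: yosida_solution_norm.
Qed.

(** The partial sums satisfy the equation up to a shift of one term, and they converge at the rate
    [rho T ^+ N], uniformly up to [T], hence also under the convolution. The datum carries the
    factor [powk 1 t] because [U] vanishes for t <= 0. *)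
Lemma yosida_solution_eq b x t : dot (U t b) x =
  powk 1 t * dot b x + c * convol k (fun s => dot (l *: (B (U s b) - U s b)) x) t.
Proof.
have T0 : 0 < `|t| + 1 by rewrite ltr_wpDl.
have tT : t <= `|t| + 1 by apply: (le_trans (ler_norm t)); rewrite lerDl.
set T := `|t| + 1 in T0 tT.
have UBc s : U s (B b) = B (U s b).
  by apply: (@yosida_solution_comm _ 1) => // y; rewrite mul1r.
pose S (b : X) N (t : R) := \sum_(i < N) ck i t * dot (iter i B b) x.
have cS b' N : exists M, causal M (S b' N).
  elim: N => [|N [M IH]].
    have -> : S b' 0%N = cst 0 by apply/funext => s; rewrite /S big_ord0.
    by exists 0; split => // s; rewrite normr0.
  eexists; apply: causal_ext (causalD IH (causalZ (dot (iter N B b') x) (causal_series_coef al0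
    al1 ka0 N))).
  by move=> s; rewrite /S big_ord_recr /= [in RHS](mulrC (ck N s)).
have ciS b' N s : convolvable k (S b' N) s by have [M h] := cS b' N;
  exact: convolvable_k_causal h.
(* The lengths differ by one because the n-th term for [B b] produces the term of index n.+1 for
   [b]. *)
have SE N : S b N.+1 t + ka * convol k (S b N.+1) t = powk 1 t * dot b x + ka * convol k (S (B
  b) N) t.
  elim: N => [|N IH].
    have -> : S b 1%N = fun s => dot b x * ck 0 s.
      by apply/funext => s; rewrite /S big_ord1 mulrC.
    have -> : S (B b) 0%N = cst 0 by apply/funext => s; rewrite /S big_ord0.
    rewrite convolZr; last exact: convolvable_k_causal (causal_series_coef al0 al1 ka0 0).
    rewrite [X in _ = _ + ka * X](_ : _ = 0); last first.
      by rewrite /convol; under eq_Rintegral do rewrite mulr0; rewrite Rintegral_cst// mul0r.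
    rewrite mulr0 addr0 -(series_coef_eq0 al0 al1 ka0 t) mulrCA -mulrDr mulrC.
    by [].
  have c1 := convolvable_k_causal al0 t (causal_series_coef al0 al1 ka0 N.+1).
  have c2 := convolvable_k_causal al0 t (causal_series_coef al0 al1 ka0 N).
  have e1 : S b N.+2 = fun s => S b N.+1 s + dot (iter N.+1 B b) x * ck N.+1 s.
    by apply/funext => s; rewrite {1}/S big_ord_recr /= [in RHS]mulrC.
  have e2 : S (B b) N.+1 = fun s => S (B b) N s + dot (iter N.+1 B b) x * ck N s.
    by apply/funext => s; rewrite {1}/S big_ord_recr /= -iterSr [in RHS]mulrC.
  rewrite e1 e2 !convolDr//; try exact: convolvableZr.
  rewrite !convolZr// !mulrDr addrACA IH -addrA; congr (_ + (_ + _)).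
  by rewrite mulrCA -mulrDr (series_coef_eqS al0 al1 ka0 N t) mulrCA.
have dS b' N s : s <= T -> `|dot (U s b') x - S b' N s| <= `|b'| / (1 - rho T) * `|x| * rho T
  ^+ N.
  move=> sT; have -> : S b' N s = dot (series (yosida_term s b') N) x.
    rewrite /series /= big_mkord dot_suml; apply: eq_bigr => i _.
    by rewrite /yosida_term dotZl.
  rewrite -dotBl; apply: (le_trans (dot_CS dotn _ _)).
  apply: (le_trans (ler_wpM2r (normr_ge0 x) (yosida_solution_series_dist b' N T0 sT))).
  by rewrite le_eqVlt; apply/orP; left; apply/eqP; ring.
have ciU b' s : convolvable k (fun s =>
  dot (U s b') x) s by exact: convolvable_k_causal (causal_dot_yosida_solution b' x).
have [ck1 ck1E] := convol_powk t al0 (@ltr01 R).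
have dcv b' N : `|convol k (fun s => dot (U s b') x) t - convol k (S b' N) t| <=
    `|b'| / (1 - rho T) * `|x| * rho T ^+ N * convol k (powk 1) t.
  rewrite -convolBr// -convolZr//; apply: normr_convol;
    [exact: convolvableBr|exact: convolvableZr|] => s.
  have [st|st] := leP t s; first by rewrite powk0 ?subr_le0// !mul0r normr0.
  rewrite normrM (ger0_norm (powk_ge0 _ _)); apply: ler_wpM2l; first exact: powk_ge0.
  have [s0|s0] := leP s 0.
    have [M [_ e _]] := cS b' N.
    by rewrite yosida_solution_le0// dot0l e// subrr normr0 powk0 ?mulr0.
  by rewrite powk1// mulr1; apply: dS; apply/ltW/(lt_le_trans st).
have -> : (fun s => dot (l *: (B (U s b) - U s b)) x) =
    (fun s => l * dot (U s (B b)) x - l * dot (U s b) x).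
  by apply/funext => s; rewrite dotZl dotBl mulrBr UBc.
rewrite convolBr ?convolZr//; try exact: convolvableZr.
apply/eqP; rewrite -subr_eq0; apply/eqP.
pose D (b : X) := `|b| / (1 - rho T) * `|x|.
have D0 b' : 0 <= D b'.
  by rewrite /D !mulr_ge0// invr_ge0 subr_ge0; have /andP[_ /ltW] := rho01 T0.
apply: (@eq0_geometric_bound _ _ (D b + ka * (D b * convol k (powk 1) t) + ka * (D (B b) *
  convol k (powk 1) t)) (rho T) (rho01 T0)) => N.
have -> : dot (U t b) x - (powk 1 t * dot b x + c * (l * convol k (fun s => dot (U s (B b)) x) t
     - l * convol k (fun s => dot (U s b) x) t)) =
  (dot (U t b) x - S b N.+1 t) + ka * (convol k (fun s =>
    dot (U s b) x) t - convol k (S b N.+1) t)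
   - ka * (convol k (fun s => dot (U s (B b)) x) t - convol k (S (B b) N) t).
  have := SE N; move: (convol k (S b N.+1) t) (convol k (S (B b) N) t) (S b N.+1 t) => u v w e.
  have -> : w = powk 1 t * dot b x + ka * v - ka * u by rewrite -e addrK.
  by ring.
have /andP[q0 q1] := rho01 T0.
have cv0 : 0 <= convol k (powk 1) t by apply: convol_ge0 => s; rewrite mulr_ge0 ?powk_ge0.
have qS : rho T ^+ N.+1 <= rho T ^+ N by rewrite exprS ler_piMl ?exprn_ge0// ltW.
apply: (le_trans (ler_normB _ _)); rewrite mulrDl; apply: lerD.
  apply: (le_trans (ler_normD _ _)); rewrite mulrDl; apply: lerD.
    apply: (le_trans (dS b N.+1 t tT)); apply: ler_wpM2l => //; exact: D0.
  rewrite normrM (gtr0_norm ka0) -mulrA; apply: ler_wpM2l; first exact: ltW.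
  apply: (le_trans (dcv b N.+1)); rewrite mulrAC; apply: ler_wpM2l => //.
  by apply: mulr_ge0 => //; exact: D0.
rewrite normrM (gtr0_norm ka0) -mulrA; apply: ler_wpM2l; first exact: ltW.
by apply: (le_trans (dcv (B b) N)); rewrite mulrAC.
Qed.

(* Convolving with [rk] turns the equation into [w = rk * (B w + f / l)], on
   which the kernel bounds act directly. *)
Lemma stability (w f : R -> X) (M e T : R) : 0 < T -> 0 <= M -> 0 <= e ->
  (forall x, causal (M * `|x|) (fun t => dot (w t) x)) ->
  (forall x, causal (e * `|x|) (fun t => dot (f t) x)) ->
  (forall x, causal (M * `|x|) (fun t => dot (B (w t)) x)) ->
  (forall x t, t <= T ->
     dot (w t) x = c * convol k (fun s => dot (l *: (B (w s) - w s) + f s) x) t) ->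
  forall t, t <= T -> `|w t| <= e * (c * (powk_beta al 1 * powk (al + 1) T)).
Proof.
move=> T0 M0 e0 cw cf cB weq.
have wM t : `|w t| <= M.
  apply: (dot_norm_le dotn M0) => x; have [_ _ /(_ t)] := cw x.
  by apply: le_trans; exact: ler_norm.
have fe t : `|f t| <= e.
  apply: (dot_norm_le dotn e0) => x; have [_ _ /(_ t)] := cf x.
  by apply: le_trans; exact: ler_norm.
pose G x s := dot (l *: (B (w s) - w s) + f s) x.
have cG x : exists N, causal N (G x).
  eexists; apply: causal_ext (causalD (causalD (causalZ l (cB x)) (causalZ (- l) (cw x))) (cf x)).
  by move=> s /=; rewrite /G dotDl dotZl dotBl mulrBr mulNr.
(* The solution for constant scalar forcing [e] when [B] is the identity: it serves as
   supersolution. *)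
pose Y s := e * c * convol k (powk 1) s.
have c1 := @causal_powk1 R.
have Y0 s : 0 <= Y s.
  by rewrite /Y !mulr_ge0 ?(ltW c0)//; apply: convol_ge0 => u; rewrite mulr_ge0 ?powk_ge0.
have Yle (s t : R) : s <= t -> Y s <= Y t.
  move=> st; rewrite /Y !(convol_powk _ al0 (@ltr01 R)).2; apply: ler_wpM2l.
    by rewrite mulr_ge0 ?(ltW c0).
  apply: ler_wpM2l; first exact/ltW/powk_beta_gt0.
  have [s0|s0] := leP s 0; first by rewrite powk0// powk_ge0.
  have t0 := lt_le_trans s0 st.
  rewrite /powk s0 t0 addrK; apply: (ge0_ler_powR (ltW al0)) => //; rewrite nnegrE; exact: ltW.
have rep x t : t <= T -> dot (w t) x = convol rk (fun s =>
  dot (B (w s)) x + l^-1 * dot (f s) x) t.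
  move=> tT; have [N cN] := cG x.
  have [i2 e2] := convol_resolvent_kernel_convol_k al0 al1 ka0 t cN.
  have ew : convol rk (fun s => dot (w s) x) t = c * convol k (G x) t - l^-1 * convol rk (G x) t.
    rewrite (eq_convol (g' := fun s => c * convol k (G x) s)).
      rewrite convolZr// e2 mulrBr mulrA invfM; congr (_ - _ * _).
      by rewrite mulrCA divff ?mulr1// gt_eqF.
    move=> s; have [st|ts] := leP s t; first by rewrite weq//; exact: le_trans tT.
    by rewrite resolvent_kernel_le0 ?mul0r// subr_le0 ltW.
  rewrite weq// -/(G x).
  have -> : (fun s => dot (B (w s)) x + l^-1 * dot (f s) x) = (fun s =>
    dot (w s) x + l^-1 * G x s).
    apply/funext => s; rewrite /G dotDl dotZl dotBl mulrDr mulKf ?gt_eqF// addrA.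
    by rewrite [dot (w s) x + _]addrC subrK.
  have iG := convolvable_resolvent_kernel_causal al0 al1 ka0 t cN.
  have iw := convolvable_resolvent_kernel_causal al0 al1 ka0 t (cw x).
  by rewrite convolDr ?convolZr// ?ew ?subrK//; exact: convolvableZr.
(* [Y] is reproduced exactly: in rk * (Y + e / l) the term with e / l cancels the loss in rk * (k *
   1) = k * 1 - ka^-1 (rk * 1). Only [m] picks up the factor [rho T]. *)
have step (m : R) : 0 <= m -> (forall s, s <= T -> `|w s| <= m + Y s) ->
    forall t, t <= T -> `|w t| <= m * rho T + Y t.
  move=> m0 hm t tT.
  have r0 := resolvent_mass_ge0 al0 al1 ka0 T.
  apply: (dot_norm_le dotn (addr_ge0 (mulr_ge0 m0 r0) (Y0 t))) => x.
  rewrite rep//.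
  have i1 := convolvable_resolvent_kernel_powk1 al0 al1 ka0 t.
  have [i2 e2] := convol_resolvent_kernel_convol_k al0 al1 ka0 t c1.
  have i3 := convolvableDr (convolvableZr (m + e / l) i1) (convolvableZr (e * c) i2).
  have i4 := convolvableZr `|x| i3.
  have iBf : convolvable rk (fun s => dot (B (w s)) x + l^-1 * dot (f s) x) t.
    by apply: convolvableDr; [exact: (convolvable_resolvent_kernel_causal al0 al1 ka0 _ (cB
      x))|apply: convolvableZr; exact: (convolvable_resolvent_kernel_causal al0 al1 ka0 _ (cf
      x))].
  apply: (le_trans (le_convol iBf i4 _)) => [s|].
    have [ts|st] := leP t s; first by rewrite resolvent_kernel_le0 ?mul0r// subr_le0.
    apply: ler_wpM2l; first exact: resolvent_kernel_ge0.
    have [s0|s0] := leP s 0.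
      have [_ -> // _] := cB x; have [_ -> // _] := cf x; rewrite mulr0 addr0.
      apply: mulr_ge0 => //; rewrite powk0// mulr0 add0r; exact: Y0.
    rewrite powk1// mulr1.
    have h1 : dot (B (w s)) x <= (m + Y s) * `|x|.
      apply: (le_trans (ler_norm _)); apply: (le_trans (dot_CS dotn _ _)).
      apply: ler_wpM2r => //; apply: (le_trans (B_le _)); apply: hm.
      exact/ltW/(lt_le_trans st).
    have h2 : l^-1 * dot (f s) x <= e / l * `|x|.
      rewrite mulrAC mulrC; apply: ler_wpM2r; first by rewrite invr_ge0 ltW.
      apply: (le_trans (ler_norm _)); apply: (le_trans (dot_CS dotn _ _)).
      by apply: ler_wpM2r.
    apply: (le_trans (lerD h1 h2)); rewrite /Y le_eqVlt; apply/orP; left; apply/eqP.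
    by move: (convol k (powk 1) s) => u; ring.
  rewrite convolZr// convolDr ?convolZr ?e2//; try exact: convolvableZr.
  rewrite mulrC; apply: ler_wpM2r => //.
  have E (u v z : R) : u <= z ->
      (m + e / l) * u + e * c * (v - (l * c)^-1 * u) <= m * z + e * c * v.
    move=> uz; have -> : (m + e / l) * u + e * c * (v - (l * c)^-1 * u) = m * u + e * c * v.
      by field; rewrite !gt_eqF.
    by rewrite lerD2r; exact: ler_wpM2l.
  exact: (E (convol rk (powk 1) t) (convol k (powk 1) t) (rho T) (resolvent_mass_le al0 al1 ka0
    tT)).
have it n : forall t, t <= T -> `|w t| <= M * rho T ^+ n + Y t.
  elim: n => [|n IH] t tT.
    by rewrite expr0 mulr1; apply: (le_trans (wM t)); rewrite lerDl.
  rewrite exprSr mulrA; apply: step => //.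
  by rewrite mulr_ge0// exprn_ge0// resolvent_mass_ge0.
move=> t tT.
have wY : `|w t| <= Y t.
  (* The positive part is taken since [eq0_geometric_bound] speaks of an absolute value. *)
  rewrite -subr_le0; have := @eq0_geometric_bound _ (Num.max (`|w t| - Y t) 0) M (rho T) (rho01
    T0).
  move=> h; have <- : Num.max (`|w t| - Y t) 0 = 0.
    apply: h => n; rewrite ger0_norm ?le_max ?lexx ?orbT//.
    rewrite ge_max lerBlDr it//= mulr_ge0// exprn_ge0//; exact: resolvent_mass_ge0.
  by rewrite le_max lexx.
apply: (le_trans wY); apply: (le_trans (Yle _ _ tT)).
by rewrite /Y (convol_powk _ al0 (@ltr01 R)).2 -mulrA.
Qed.

End resolvent_operators.

(** * Hoelder continuity of fractional integrals of bounded functions *)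

Section hoelder.
Context {R : realType} (al : R).
Hypotheses (al0 : 0 < al) (al1 : al < 1).
Local Notation mu := (@lebesgue_measure R).
Local Notation k := (@powk R al).

Lemma powk_le_mono (s t : R) : s <= t -> powk (al + 1) s <= powk (al + 1) t.
Proof.
move=> st; have [s0|s0] := leP s 0; first by rewrite powk0// powk_ge0.
have t0 := lt_le_trans s0 st.
by rewrite /powk s0 t0 addrK; apply: (ge0_ler_powR (ltW al0)) => //; rewrite nnegrE; exact: ltW.
Qed.

Lemma powk_antitone (s t : R) : 0 < s -> s <= t -> k t <= k s.
Proof.
move=> s0 st; rewrite /powk s0 (lt_le_trans s0 st).
by apply: powR_antitone => //; rewrite subr_le0 ltW.
Qed.

(** For u < s the difference k(s - u) - k(t - u) is nonnegative; for u >= s only k(t - u) remains,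
    equal to - k(t - u) + 2 k(t - u). So k(s - u) - k(t - u) + 2 g1(u) is a majorant in both cases,
    and over u > 0 its first two terms have a nonpositive integral. *)
Lemma convol_k_hoelder M (h : R -> R) (s t : R) : causal M h -> s < t ->
  `|convol k h t - convol k h s| <= 2 * M * powk_beta al 1 * (2 * (t - s)) `^ al.
Proof.
move=> ch st; have M0 := causal_ge0 ch; have [mh h0 hM] := ch.
have m0 := powk_beta_gt0 al0 (@ltr01 R).
have it := convolvable_k_causal al0 t ch; have is_ := convolvable_k_causal al0 s ch.
have [i1 e1] := convol_powk t al0 (@ltr01 R).
have [i2 e2] := convol_powk s al0 (@ltr01 R).
have [i3 e3] := convol_powk (2 * (t - s)) al0 (@ltr01 R).
(* Strictly below [s], so that the cut-off in [g1] is 1 also at u = s; this doubles the length t - s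
   in the bound. *)
pose d := s - (t - s).
pose g1 (u : R) := k (t - u) * powk 1 (u - d).
have mg0 : measurable_fun setT (fun u : R => (k (2 * (t - s) - u) * powk 1 u)%:E).
  by apply: measurable_convol_EFin; exact: measurable_powk.
have Ig : (\int[mu]_u (g1 u)%:E = (powk_beta al 1 * powk (al + 1) (2 * (t - s)))%:E)%E.
  transitivity (\int[mu]_(u in setT) (k (2 * (t - s) - (u - d)) * powk 1 (u - d))%:E)%E.
    by apply: eq_integral => u _; rewrite /g1; congr (k _ * _)%:E; rewrite /d; ring.
  by rewrite (integral_translate d mg0) -EFin_convol// e3.
have g1i : mu.-integrable setT (EFin \o g1).
  apply/integrableP; split.
    apply: measurableT_comp => //; apply: measurable_funM.
      by apply: (measurableT_comp (measurable_powk _)); exact: measurable_funB.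
    by apply: (measurableT_comp (measurable_powk _)); exact: measurable_funB.
  under eq_integral do rewrite /= ger0_norm ?mulr_ge0 ?powk_ge0//.
  by rewrite Ig ltry.
have j1 := integrableB measurableT i2 i1.
have j2 := integrableD measurableT j1 (integrableZl measurableT 2 g1i).
have j3 := integrableZl measurableT M j2.
have j4 := integrableB measurableT it is_.
have -> : convol k h t - convol k h s = \int[mu]_u (k (t - u) * h u - k (s - u) * h u).
  by rewrite RintegralB.
apply: (le_trans (le_normr_Rintegral _ _)) => //.
apply: (@le_trans _ _ (\int[mu]_u (M * (k (s - u) * powk 1 u - k (t - u) * powk 1 u + 2 * g1
  u)))).
  apply: le_Rintegral => //; first exact: integrable_norm.
  move=> u _; have [u0|u0] := leP u 0.
    rewrite h0// !mulr0 subrr normr0 (powk0 1 u0) !mulr0 subrr add0r.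
    by apply: mulr_ge0 => //; rewrite !mulr_ge0 ?powk_ge0.
  rewrite -mulrBl normrM (powk1 u0) !mulr1.
  have [us|su] := ltP u s.
    have k1 : k (t - u) <= k (s - u) by apply: powk_antitone; rewrite ?subr_gt0// lerD2r ltW.
    rewrite ler0_norm ?subr_le0// opprB mulrC; apply: ler_pM => //.
      by rewrite subr_ge0.
    by rewrite lerDl !mulr_ge0 ?powk_ge0.
  have ud : 0 < u - d by rewrite /d opprB addrCA; apply: ltr_pwDl; rewrite ?subr_gt0 ?subr_ge0.
  rewrite (@powk0 _ al (s - u)) ?subr_le0// subr0 sub0r /g1 (powk1 ud).
  rewrite mulr1 (ger0_norm (powk_ge0 _ _)) mulrC; apply: ler_pM => //; first exact: powk_ge0.
  by rewrite mulr_natl mulr2n addKr.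
have E : \int[mu]_u (M * (k (s - u) * powk 1 u - k (t - u) * powk 1 u + 2 * g1 u)) =
   M * (convol k (powk 1) s - convol k (powk 1) t + 2 * (powk_beta al 1 * powk (al + 1) (2 * (t
     - s)))).
  have -> : powk_beta al 1 * powk (al + 1) (2 * (t - s)) = \int[mu]_u g1 u by rewrite
    /Rintegral Ig.
  rewrite RintegralZl//; congr (_ * _).
  rewrite RintegralD//; last by have := integrableZl measurableT 2 g1i; apply: eq_integrable.
  congr (_ + _); first by rewrite RintegralB.
  by rewrite RintegralZl.
rewrite E e1 e2.
have -> : powk (al + 1) (2 * (t - s)) = (2 * (t - s)) `^ al.
  by rewrite /powk addrK ifT// mulr_gt0// subr_gt0.
have k1 : powk_beta al 1 * powk (al + 1) s <= powk_beta al 1 * powk (al + 1) t.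
  by apply: ler_wpM2l; [exact: ltW|apply: powk_le_mono; exact: ltW].
move: k1; set a1 := _ * powk _ s; set a2 := _ * powk _ t; set a3 := _ `^ al => k1.
have : M * (a1 - a2 + 2 * (powk_beta al 1 * a3)) <= M * (2 * (powk_beta al 1 * a3)).
  by apply: ler_wpM2l => //; rewrite gerDr subr_le0.
by move/le_trans; apply; rewrite le_eqVlt; apply/orP; left; apply/eqP; ring.
Qed.

End hoelder.

(** * Passage to the limit in the Yosida approximations *)

Section solution_family.
Context {R : realType} {X : completeNormedModType R} (dot : {dot X for idfun}).
Hypothesis dotn : forall x : X, dot x x = `|x| ^+ 2.
Context (al c : R).
Hypotheses (al0 : 0 < al) (al1 : al < 1) (c0 : 0 < c).
Context (A : linear_operator X).
Hypothesis hrho : [set l : R | 0 < l] `<=` resolvent_set A.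
Hypothesis hres : forall l : R, 0 < l -> l * operator_norm (resolvent A l) <= 1.
Hypothesis hdense : densely_defined A.
Hypothesis hclosed : closed_operator A.
Local Notation k := (@powk R al).
Local Notation Y := (@yosida R X A).
Local Notation UU l := (@yosida_solution R X al c l (Y l)).

Let Ylin l (l0 : 0 < l) (a : R) x y : Y l (a *: x + y) = a *: Y l x + Y l y.
Proof. exact: yosida_linear. Qed.
Let Yle l (l0 : 0 < l) x : `|Y l x| <= `|x|.
Proof. exact: yosida_le. Qed.

Let UU_yosida l m t b : 0 < l -> 0 < m -> UU l t (Y m b) = Y m (UU l t b).
Proof.
move=> l0 m0; apply: (@yosida_solution_comm _ _ _ _ l al0 al1 c0 l0 (Y l) (Yle l0) (Y m) 1).
- exact: Ylin.
- by move=> x; rewrite mul1r; exact: Yle.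
- by move=> x; exact: yosida_comm.
Qed.

Let UUB l t x y : 0 < l -> UU l t (x - y) = UU l t x - UU l t y.
Proof. by move=> l0; apply: yosida_solutionB => //; [exact: Ylin|exact: Yle]. Qed.

Let UUZ l t (a : R) x : 0 < l -> UU l t (a *: x) = a *: UU l t x.
Proof.
move=> l0; have e := yosida_solution_linear al0 al1 c0 l0 (Ylin l0) (Yle l0).
by rewrite -[a *: x]addr0 e (linear_map0 (e t)) addr0.
Qed.

Let UU_norm l t x : 0 < l -> `|UU l t x| <= `|x|.
Proof. by move=> l0; apply: yosida_solution_norm => //; exact: Yle. Qed.

Lemma yosida_op l x : 0 < l -> op_dom A x -> l *: (Y l x - x) = Y l (A x).
Proof. by move=> l0 dx; rewrite -op_yosida// op_yosida_comm. Qed.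

Let UU_op l m t x : 0 < l -> 0 < m -> op_dom A x ->
  m *: (Y m (UU l t x) - UU l t x) = UU l t (Y m (A x)).
Proof. by move=> l0 m0 dx; rewrite -yosida_op// UUZ// UUB// UU_yosida. Qed.

Definition stability_const (T : R) : R := c * (powk_beta al 1 * powk (al + 1) T).

Lemma stability_const_ge0 T : 0 <= stability_const T.
Proof. by rewrite /stability_const !mulr_ge0 ?(ltW c0) ?powk_ge0// ltW// powk_beta_gt0. Qed.

(** The difference solves the equation of parameter [l] with forcing l (Y_l - 1) U_m a - m (Y_m - 1)
    U_m a. On the domain this is [UU m t (Y l (A a) - Y m (A a))], which is small for large [l] and
    [m]. *)
Lemma yosida_solution_cauchy_dom l m T a t : 0 < l -> 0 < m -> 0 < T -> op_dom A a -> t <= T ->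
  `|UU l t a - UU m t a| <= `|Y l (A a) - Y m (A a)| * stability_const T.
Proof.
move=> l0 m0 T0 da tT.
have cU l' (l'0 : 0 < l') := causal_dot_yosida_solution dotn al0 al1 c0 l'0 (Yle l'0).
have cD b b' x : `|b'| <= `|a| -> `|b| <= `|a| ->
    causal (2 * `|a| * `|x|) (fun t => dot (UU l t b - UU m t b') x).
  move=> hb' hb; apply: (causal_le_bound (M := `|b| * `|x| + `|-1| * (`|b'| * `|x|))).
    rewrite normrN normr1 mul1r -mulrDl; apply: ler_wpM2r => //.
    by rewrite mulr_natl mulr2n; apply: lerD.
  apply: causal_ext (causalD (cU _ l0 b x) (causalZ (-1) (cU _ m0 b' x))).
  by move=> s /=; rewrite dotBl mulN1r.
apply: (@stability _ _ dot dotn al c l al0 al1 c0 l0 (Y l) (Yle l0)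
  (fun t => UU l t a - UU m t a) (fun t => UU m t (Y l (A a) - Y m (A a))) (2 * `|a|)) tT => //.
- by move=> x; exact: cD.
- by move=> x; exact: cU.
- move=> x; apply: causal_ext (cD (Y l a) (Y l a) x _ _); try exact: Yle.
  by move=> s /=; rewrite yosidaB// !UU_yosida.
- move=> x s sT; rewrite dotBl.
  have := yosida_solution_eq dotn al0 al1 c0 l0 (Ylin l0) (Yle l0) a x s.
  have := yosida_solution_eq dotn al0 al1 c0 m0 (Ylin m0) (Yle m0) a x s.
  move=> -> ->; rewrite opprD addrACA subrr add0r -mulrBr; congr (_ * _).
  have cc l' (l'0 : 0 < l') : convolvable k (fun s =>
    dot (l' *: (Y l' (UU l' s a) - UU l' s a)) x) s.
    apply: (convolvable_k_causal (M := `|Y l' (A a)| * `|x|) al0).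
    apply: causal_ext (cU l' l'0 (Y l' (A a)) x) => u.
    by rewrite UU_op.
  rewrite -convolBr; [|exact: cc|exact: cc].
  apply: eq_convol => u; congr (_ * _).
  rewrite -dotBl; congr (dot _ x).
  rewrite yosidaB// UUB// -!UU_op// addrA -scalerDr; congr (_ *: _ - _).
  by rewrite opprB addrAC (addrA (_ - _)) subrK (addrA (_ - _)) subrK.
Qed.

Definition Un (n : nat) (t : R) (b : X) : X := UU n.+1%:R t b.
Definition Yn (n : nat) : X -> X := Y n.+1%:R.

Let np n : 0 < n.+1%:R :> R. Proof. by rewrite ltr0n. Qed.

Lemma cvg_Yn b (e : R) : 0 < e -> exists N, forall n, (N <= n)%N -> `|b - Yn n b| <= e.
Proof.
move=> e0; have [L L0 h] := yosida_cvg hrho hres hdense b e0.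
exists (Num.truncn L) => n Nn; apply: h.
apply/ltW/(lt_le_trans (truncnS_gt L)).
by rewrite ler_nat ltnS.
Qed.

Lemma yosida_solution_cauchy b T (e : R) : 0 < T -> 0 < e ->
  exists N, forall n m, (N <= n)%N -> (N <= m)%N -> forall t, t <= T ->
    `|Un n t b - Un m t b| <= e.
Proof.
move=> T0 e0; have e4 : 0 < e / 4 by rewrite divr_gt0.
have [a da ab] := op_dom_dense hdense b e4.
have K1 : 0 < stability_const T + 1 by rewrite ltr_wpDl// stability_const_ge0.
have eK : 0 < e / 4 / (stability_const T + 1) by rewrite divr_gt0.
have [N hN] := cvg_Yn (A a) eK.
exists N => n m Nn Nm t tT.
(* The outer terms are small by contractivity, whatever n, m and t; the middle one has its datum in
   the domain. *)
have -> : Un n t b - Un m t b = Un n t (b - a) + (Un n t a - Un m t a) - Un m t (b - a).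
  by rewrite /Un !UUB// opprB !addrA !subrK.
have h1 := yosida_solution_cauchy_dom (np n) (np m) T0 da tT.
have h2 : `|Yn n (A a) - Yn m (A a)| <= e / 4 / (stability_const T + 1) + e / 4 /
  (stability_const T + 1).
  have -> : Yn n (A a) - Yn m (A a) = (A a - Yn m (A a)) - (A a - Yn n (A a)).
    by rewrite opprB [RHS]addrC addrA subrK.
  by apply: (le_trans (ler_normB _ _)); apply: lerD; apply: hN.
have h3 : `|Un n t a - Un m t a| <= e / 2.
  apply: (le_trans h1); apply: (le_trans (ler_wpM2r (stability_const_ge0 T) h2)).
  have : e / 4 / (stability_const T + 1) * stability_const T <= e / 4.
    rewrite mulrAC ler_pdivrMr//; apply: ler_wpM2l; first exact: ltW.
    by rewrite lerDl.
  by rewrite mulrDl; move: (_ * stability_const T) => z; lra.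
have h4 n' : `|Un n' t (b - a)| <= e / 4 by apply: (le_trans (UU_norm _ _ (np n'))); exact: ltW.
apply: (le_trans (ler_normB _ _)).
apply: (@le_trans _ _ (e / 4 + e / 2 + e / 4)); last by lra.
by apply: lerD => //; apply: (le_trans (ler_normD _ _)); apply: lerD.
Qed.

(* Zero for [t <= 0], so that convolutions over the line are integrals over
   [(0, t)]. *)
Definition truncated_solution (t : R) (b : X) : X := limn (fun n => Un n t b).
Local Notation S := truncated_solution.

Lemma cvg_truncated_solution t b : (fun n => Un n t b) @ \oo --> S t b.
Proof.
suff : cvgn (fun n => Un n t b) by [].
have T0 : 0 < `|t| + 1 by rewrite ltr_wpDl.
have tT : t <= `|t| + 1 by apply: (le_trans (ler_norm t)); rewrite lerDl.
apply/cauchy_cvgP/cauchy_ballP => e e0.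
have e2 : 0 < e / 2 by rewrite divr_gt0.
have [N hN] := yosida_solution_cauchy b T0 e2.
pose E : set X := [set x | exists2 n, (N <= n)%N & x = Un n t b].
exists (E, E); first by split; exists N => // n Nn; exists n.
move=> [x y] /= [[n Nn ->] [m Nm ->]]; rewrite -ball_normE /=.
by apply: (le_lt_trans (hN _ _ Nn Nm t tT)); rewrite ltr_pdivrMr// ltr_pMr// ltr1n.
Qed.

Lemma truncated_solution_unif b T (e : R) : 0 < T -> 0 < e ->
  exists N, forall n, (N <= n)%N -> forall t, t <= T -> `|Un n t b - S t b| <= e.
Proof.
move=> T0 e0; have [N hN] := yosida_solution_cauchy b T0 e0.
exists N => n Nn t tT.
have h : `|Un n t b - Un m t b| @[m --> \oo] --> `|Un n t b - S t b|.
  by apply: cvg_norm; apply: cvgB; [exact: cvg_cst|exact: cvg_truncated_solution].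
rewrite -(cvg_lim _ h)//; apply: limr_le; first by apply/cvg_ex; eexists; exact: h.
by exists N => // m Nm; exact: hN.
Qed.

Lemma truncated_solution_norm t b : `|S t b| <= `|b|.
Proof.
have h : `|Un n t b| @[n --> \oo] --> `|S t b| by apply: cvg_norm; exact: cvg_truncated_solution.
rewrite -(cvg_lim _ h)//; apply: limr_le; first by apply/cvg_ex; eexists; exact: h.
by apply: nearW => n; exact: UU_norm.
Qed.

Lemma truncated_solutionB t x y : S t (x - y) = S t x - S t y.
Proof.
apply: cvg_lim => //; rewrite (_ : (fun n => _) = (fun n => Un n t x - Un n t y)).
  by apply: cvgB; exact: cvg_truncated_solution.
by apply/funext => n; exact: UUB.
Qed.

Lemma truncated_solution_le0 t b : t <= 0 -> S t b = 0.
Proof.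
move=> t0; apply: cvg_lim => //; rewrite (_ : (fun n => _) = cst 0); first exact: cvg_cst.
by apply/funext => n; apply: yosida_solution_le0.
Qed.

Lemma causal_dot_truncated_solution b x : causal (`|b| * `|x|) (fun t => dot (S t b) x).
Proof.
split.
- apply: (measurable_fun_cvg (h := fun n t => dot (Un n t b) x)).
    by move=> n; have [] := causal_dot_yosida_solution dotn al0 al1 c0 (np n) (Yle (np n)) b x.
  by move=> t _; exact: (cvg_dotl dotn (@cvg_truncated_solution t b)).
- by move=> s s0; rewrite truncated_solution_le0// dot0l.
- by move=> s; apply: (le_trans (dot_CS dotn _ _)); apply: ler_wpM2r => //;
  exact: truncated_solution_norm.
Qed.

Lemma cvg_UnYn t b : (fun n => Un n t (Yn n b)) @ \oo --> S t b.
Proof.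
apply/cvgrPdist_le => e e0; have e2 : 0 < e / 2 by rewrite divr_gt0.
have [N hN] := cvg_Yn b e2.
have /cvgrPdist_le /(_ _ e2) [N' _ hN'] := @cvg_truncated_solution t b.
exists (maxn N N') => // n /=; rewrite geq_max => /andP[Nn Nn'].
have -> : S t b - Un n t (Yn n b) = (S t b - Un n t b) + Un n t (b - Yn n b).
  by rewrite /Un UUB// addrA subrK.
apply: (le_trans (ler_normD _ _)); rewrite [leRHS]splitr; apply: lerD; first exact: hN'.
by apply: (le_trans (UU_norm _ _ (np n))); exact: hN.
Qed.

(** Closedness is applied to [Yn n (Un n t a)], visibly in the domain; it tends to [S t a], and its
    image [Un n t (Yn n (A a))] tends to [S t (A a)]. *)
Lemma truncated_solution_op t a : op_dom A a -> op_dom A (S t a) /\ A (S t a) = S t (A a).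
Proof.
move=> da.
have c1 : (fun n => Yn n (Un n t a)) @ \oo --> S t a.
  rewrite (_ : (fun n => _) = (fun n => Un n t (Yn n a))); first exact: cvg_UnYn.
  by apply/funext => n; rewrite /Un /Yn UU_yosida.
have c2 : (fun n => A (Yn n (Un n t a))) @ \oo --> S t (A a).
  rewrite (_ : (fun n => _) = (fun n => Un n t (Yn n (A a)))); first exact: cvg_UnYn.
  by apply/funext => n; rewrite /Yn op_yosida// UU_op.
have : [set p : X * X | op_dom A p.1 /\ p.2 = A p.1] (S t a, S t (A a)).
  apply: (@closed_cvg _ _ \oo _ (fun n => (Yn n (Un n t a), A (Yn n (Un n t a)))) _ hclosed).
    by apply: nearW => n /=; split => //; exact: op_dom_yosida.
  exact: cvg_pair.
by move=> /= [h1 h2].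
Qed.

(** For data in the domain the right-hand side of the approximate equation is [Un n s (Yn n (A a))],
    which converges uniformly up to time [T] and so passes under the singular kernel. *)
Lemma truncated_solution_eq a x t : op_dom A a ->
  dot (S t a) x = powk 1 t * dot a x + c * convol k (fun s => dot (S s (A a)) x) t.
Proof.
move=> da.
have T0 : 0 < `|t| + 1 by rewrite ltr_wpDl.
have tT : t <= `|t| + 1 by apply: (le_trans (ler_norm t)); rewrite lerDl.
set T := `|t| + 1 in T0 tT.
have c1 : dot (Un n t a) x @[n --> \oo] --> dot (S t a) x by exact: (cvg_dotl dotn
  (@cvg_truncated_solution t a)).
suff c2 : dot (Un n t a) x @[n --> \oo] --> powk 1 t * dot a x + c * convol k (fun s =>
  dot (S s (A a)) x) t.
  by rewrite -(cvg_lim _ c1)// (cvg_lim _ c2).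
have E n : dot (Un n t a) x = powk 1 t * dot a x + c * convol k (fun s =>
  dot (Un n s (Yn n (A a))) x) t.
  rewrite (yosida_solution_eq dotn al0 al1 c0 (np n) (Ylin (np n)) (Yle (np n)) a x t);
    congr (_ + _ * _).
  by apply: eq_convol => s; rewrite UU_op.
rewrite (_ : (fun n => _) = (fun n => powk 1 t * dot a x + c * convol k (fun s =>
  dot (Un n s (Yn n (A a))) x) t)); last first.
  by apply/funext => n; rewrite E.
apply: cvgD; first exact: cvg_cst.
apply: cvgM; first exact: cvg_cst.
apply/cvgrPdist_le => e e0.
have q0 : 0 < `|x| * convol k (powk 1) t + 1.
  rewrite ltr_wpDl// mulr_ge0//; apply: convol_ge0 => s; by rewrite mulr_ge0 ?powk_ge0.
(* Two errors of size [d], paired with [x] and convolved with [k], add up to at most [e]. *)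
pose d := e / (`|x| * convol k (powk 1) t + 1) / 2.
have d0 : 0 < d by rewrite !divr_gt0.
have [N hN] := truncated_solution_unif (A a) T0 d0.
have [N' hN'] := cvg_Yn (A a) d0.
exists (maxn N N') => // n /=; rewrite geq_max => /andP[Nn Nn'].
have i1 : convolvable k (fun s =>
  dot (S s (A a)) x) t by exact: (convolvable_k_causal al0 t (causal_dot_truncated_solution (A
  a) x)).
have i2 : convolvable k (fun s => dot (Un n s (Yn n (A a))) x) t.
  exact: (convolvable_k_causal al0 t (causal_dot_yosida_solution dotn al0 al1 c0 (np n) (Yle
    (np n)) (Yn n (A a)) x)).
have i3 := convolvableZr (2 * d * `|x|) (convol_powk t al0 (@ltr01 R)).1.
rewrite -convolBr//; apply: (le_trans (normr_convol (convolvableBr i1 i2) i3 _)) => [s|].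
  have [ts|st] := leP t s; first by rewrite powk0 ?subr_le0// !mul0r normr0.
  rewrite normrM (ger0_norm (powk_ge0 _ _)); apply: ler_wpM2l; first exact: powk_ge0.
  have [s0|s0] := leP s 0.
    by rewrite truncated_solution_le0// /Un yosida_solution_le0// subrr normr0 powk0 ?mulr0.
  rewrite powk1// mulr1 -dotBl; apply: (le_trans (dot_CS dotn _ _)); apply: ler_wpM2r => //.
  have -> : S s (A a) - Un n s (Yn n (A a)) = (S s (A a) - Un n s (A a)) + Un n s (A a - Yn n
    (A a)).
    by rewrite /Un UUB// addrA subrK.
  apply: (le_trans (ler_normD _ _)); rewrite mulr_natl mulr2n; apply: lerD.
    by rewrite distrC; apply: hN => //; apply/ltW/(lt_le_trans st).
  by apply: (le_trans (UU_norm _ _ (np n))); exact: hN'.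
rewrite convolZr; last exact: (convol_powk t al0 (@ltr01 R)).1.
move: q0; rewrite /d; move: (convol k (powk 1) t) => z q0.
have -> : 2 * (e / (`|x| * z + 1) / 2) * `|x| * z = e * ((`|x| * z) / (`|x| * z + 1)).
  by field; rewrite gt_eqF.
rewrite -[leRHS]mulr1; apply: ler_wpM2l; first exact: ltW.
by rewrite ler_pdivrMr// mul1r lerDl.
Qed.

(** Equal to [b] for t <= 0, which repairs the jump of [truncated_solution] at 0 and gives a
    function continuous on the whole line. *)
Definition solution (t : R) (b : X) : X := S t b + (1 - powk 1 t) *: b.
Local Notation V := solution.

Lemma solution_gt0 t b : 0 < t -> V t b = S t b.
Proof. by move=> t0; rewrite /V powk1// subrr scale0r addr0. Qed.

Lemma solution_le0 t b : t <= 0 -> V t b = b.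
Proof. by move=> t0; rewrite /V powk0// truncated_solution_le0// subr0 scale1r add0r. Qed.

Lemma solution_norm t b : `|V t b| <= `|b|.
Proof.
by have [t0|t0] := leP t 0; [rewrite solution_le0|rewrite solution_gt0//;
  exact: truncated_solution_norm].
Qed.

Lemma solutionB t x y : V t (x - y) = V t x - V t y.
Proof.
by have [t0|t0] := leP t 0; [rewrite !solution_le0|rewrite !solution_gt0// truncated_solutionB].
Qed.

Lemma solution_op t a : op_dom A a -> op_dom A (V t a) /\ A (V t a) = V t (A a).
Proof.
by move=> da; have [t0|t0] := leP t 0; [rewrite !solution_le0|rewrite !solution_gt0//;
  exact: truncated_solution_op].
Qed.

Lemma solution_eq a x t : op_dom A a ->
  dot (V t a) x = dot a x + c * convol k (fun s => dot (S s (A a)) x) t.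
Proof.
by move=> da; rewrite /V dotDl dotZl truncated_solution_eq//; ring.
Qed.

Lemma solution_continuous_dom a : op_dom A a -> continuous (fun t => V t a).
Proof.
move=> da.
pose C := c * (2 * `|A a| * powk_beta al 1).
have C0 : 0 <= C by rewrite /C !mulr_ge0 ?(ltW c0)//; exact/ltW/powk_beta_gt0.
have H s t : s < t -> `|V t a - V s a| <= C * (2 * (t - s)) `^ al.
  move=> st; apply: (dot_norm_le dotn); first by rewrite mulr_ge0 ?powR_ge0.
  move=> x; rewrite dotBl !solution_eq// opprD addrACA subrr add0r -mulrBr.
  apply: (le_trans (ler_norm _)); rewrite normrM (gtr0_norm c0).
  apply: (le_trans (ler_wpM2l (ltW c0) (convol_k_hoelder al0 al1 (causal_dot_truncated_solution
    (A a) x) st))).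
  by rewrite /C le_eqVlt; apply/orP; left; apply/eqP; ring.
move=> t; apply/(@cvgrPdist_le _ _ _ (nbhs t)) => e e0.
(* Solves (C + 1) (2 d)^al = e; the added 1 guards against C = 0. *)
pose d := (e / (C + 1)) `^ al^-1 / 2.
have C1 : 0 < C + 1 by rewrite ltr_wpDl.
have d0 : 0 < d by rewrite divr_gt0// powR_gt0// divr_gt0.
have bd (z : R) : 0 < z -> z < d -> C * (2 * z) `^ al <= e.
  move=> z0 zd.
  have h : (2 * z) `^ al <= e / (C + 1).
    have -> : e / (C + 1) = ((e / (C + 1)) `^ al^-1) `^ al.
      by rewrite -powRrM mulVf ?gt_eqF// powRr1// divr_ge0// ltW.
    have z2 : 2 * z <= (e / (C + 1)) `^ al^-1 by move: zd; rewrite /d ltr_pdivlMr// mulrC => /ltW.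
    apply: (ge0_ler_powR (ltW al0)) z2; rewrite nnegrE ?powR_ge0//.
    by rewrite mulr_ge0// ltW.
  apply: (le_trans (ler_wpM2l C0 h)).
  rewrite mulrCA -[leRHS]mulr1; apply: ler_wpM2l; first exact: ltW.
  by rewrite ler_pdivrMr// mul1r lerDl.
exists d => //= s /= sd.
have [st|ts|->] := ltgtP s t; last by rewrite subrr normr0 ltW.
  apply: (le_trans (H _ _ st)); apply: bd; first by rewrite subr_gt0.
  by move: sd; rewrite gtr0_norm// subr_gt0.
rewrite distrC; apply: (le_trans (H _ _ ts)); apply: bd; first by rewrite subr_gt0.
by move: sd; rewrite distrC gtr0_norm// subr_gt0.
Qed.

Lemma solution_continuous b : continuous (fun t => V t b).
Proof.
move=> t; apply/(@cvgrPdist_le _ _ _ (nbhs t)) => e e0.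
have e3 : 0 < e / 3 by rewrite divr_gt0.
have [a da ab] := op_dom_dense hdense b e3.
have /(@cvgrPdist_le _ _ _ (nbhs t)) /(_ _ e3) := @solution_continuous_dom a da t.
apply: filterS => s h.
have -> : V t b - V s b = V t (b - a) + (V t a - V s a) - V s (b - a).
  rewrite (solutionB t b a) (solutionB s b a); move: (V t b) (V t a) (V s a) (V s b) => p q r z.
  by rewrite opprB !addrA !subrK.
apply: (le_trans (ler_normB _ _)).
apply: (@le_trans _ _ (e / 3 + e / 3 + e / 3)); last by lra.
apply: lerD; last by apply: (le_trans (solution_norm _ _)); exact: ltW.
apply: (le_trans (ler_normD _ _)); apply: lerD => //.
by apply: (le_trans (solution_norm _ _)); exact: ltW.
Qed.

End solution_family.

(** * Comparison of integrals off a null set *)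

Section lower_integral.
Local Open Scope ereal_scope.
Context d (T : measurableType d) (R : realType) (mu : {measure set T -> \bar R}).
Import HBNNSimple.

(* The integral of a nonnegative function is a supremum over simple functions,
   so no measurability of [f] and [g] is needed. *)
Lemma ge0_le_integral_off_null (D N : set T) (f g : T -> \bar R) :
  measurable N -> mu N = 0 ->
  (forall x, D x -> 0 <= f x) -> (forall x, D x -> 0 <= g x) ->
  (forall x, D x -> ~ N x -> f x <= g x) ->
  \int[mu]_(x in D) f x <= \int[mu]_(x in D) g x.
Proof.
move=> mN N0 f0 g0 fg; rewrite !ge0_integralE//.
apply: ge_ereal_sup => _ [h /= hf <-].
have mNC : measurable (~` N) by exact: measurableC.
(* A simple minorant of [f], set to 0 on [N], becomes a minorant of [g] with the same integral. *)
apply: le_ereal_sup_tmp; exists (sintegral mu (proj_nnsfun h mNC)).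
  exists (proj_nnsfun h mNC) => //= x; rewrite mindicE.
  have [xN|xN] := boolP (x \in ~` N); last first.
    rewrite mulr0 patchE; case: ifPn => // /set_mem; exact: g0.
  rewrite mulr1; apply: (le_trans (hf x)); rewrite !patchE; case: ifPn => // xD.
  by apply: fg; [exact: set_mem|exact: set_mem xN].
rewrite -!integralT_nnsfun; apply: ae_ge0_le_integral => //.
- by move=> x _; rewrite lee_fin.
- exact/measurable_EFinP/measurable_funP.
- by move=> x _; rewrite lee_fin.
- exact/measurable_EFinP/measurable_funP.
exists N; split => // x /= hx; apply: contrapT => xN; apply: hx => _.
by rewrite mindicE mem_set// mulr1.
Qed.

End lower_integral.

(** * Finitely valued functions and their pointwise limits *)

Section finite_valued.
Context {R : realType}.
Local Notation mu := (@lebesgue_measure R).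

(** The codomain is an arbitrary type, so that pairing followed by composition yields every
    pointwise operation. *)
Definition finite_measurable (Y : Type) (s : R -> Y) : Prop :=
  finite_set (range s) /\ forall y, measurable (s @^-1` [set y] : set R).

Lemma finite_measurable_preimage (Y : Type) (s : R -> Y) (B : set Y) : finite_measurable s ->
  measurable (s @^-1` B : set R).
Proof.
move=> [fs ms]; have -> : s @^-1` B = \bigcup_(y in range s `&` B) s @^-1` [set y].
  apply/seteqP; split => [x /= Bx|x /= [y [_ By] /= ->]] //.
  by exists (s x) => //; split => //; exists x.
apply: fin_bigcup_measurable; first exact: (sub_finite_set (@subIsetl _ _ _) fs).
by move=> y _; exact: ms.
Qed.

Lemma finite_measurable_comp (Y Z : Type) (p : Y -> Z) (s : R -> Y) : finite_measurable s ->
  finite_measurable (p \o s).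
Proof.
move=> fs; split; last by move=> z; rewrite comp_preimage; exact: finite_measurable_preimage.
have -> : range (p \o s) = p @` range s by rewrite image_comp.
by apply: finite_image; case: fs.
Qed.

Lemma finite_measurable_pair (Y Z : Type) (s : R -> Y) (r : R -> Z) : finite_measurable s ->
  finite_measurable r ->
  finite_measurable (fun t => (s t, r t)).
Proof.
move=> [fs ms] [fr mr]; split.
  apply: (@sub_finite_set _ _ (range s `*` range r)); last exact: finite_setX.
  by move=> _ [t _ <-]; split; exists t.
move=> [y z]; have -> : (fun t => (s t, r t)) @^-1` [set (y, z)] =
    s @^-1` [set y] `&` r @^-1` [set z].
  by apply/seteqP; split => t /=; [move=> [-> ->]|move=> [-> ->]].
exact: measurableI.
Qed.

Lemma finite_measurable_measurable (s : R -> R) : finite_measurable s -> measurable_fun setT s.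
Proof. by move=> fs _ B _; rewrite setTI; exact: finite_measurable_preimage. Qed.

Lemma finite_measurable_bool (D : set R) : measurable D -> finite_measurable (fun t =>
  `[< D t >]).
Proof.
move=> mD; split.
  apply: (@sub_finite_set _ _ [set: bool]); last exact: finite_finset.
  by [].
case.
  rewrite (_ : _ @^-1` _ = D)//; apply/seteqP; split => t /=; first by move/asboolP.
  by move=> Dt; apply/asboolP.
rewrite (_ : _ @^-1` _ = ~` D); first exact: measurableC.
apply/seteqP; split => t /=; first by move/asboolP.
by move=> Dt; apply/asboolP.
Qed.

Context {X : completeNormedModType R}.

Definition to_fimfun (s : R -> X) (fs : finite_measurable s) : {fimfun R >-> X} :=
  HB.pack s (FiniteImage.Build R X s (proj1 fs)).

Lemma simple_fimfun (s : R -> X) (fs : finite_measurable s) (D : set X) :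
  (forall t, D (s t)) -> simple_in D (to_fimfun fs).
Proof. by move=> Ds; split => //; have [] := fs. Qed.

Lemma simple_finite_measurable (D : set X) (s : {fimfun R >-> X}) : simple_in D s ->
  finite_measurable s.
Proof. by move=> [ms _]; split => //; exact: fimfunP. Qed.

(** Strong measurability with convergence at every point of the line: null sets are removed
    beforehand, by choosing a representative. *)
Definition bochner_measurable (f : R -> X) : Prop :=
  exists s : nat -> R -> X, (forall n, finite_measurable (s n)) /\ forall t, s n t @[n --> \oo]
    --> f t.

Lemma bochner_measurable_measurable (f : R -> X) (p : X -> R) : bochner_measurable f ->
  continuous p ->
  measurable_fun setT (p \o f).
Proof.
move=> [s [fs sf]] cp; apply: (measurable_fun_cvg (h := fun n => p \o s n)).
  by move=> n; apply: finite_measurable_measurable; exact: finite_measurable_comp.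
by move=> t _; exact: (cvg_comp (fun n => s n t) p (sf t) (cp (f t))).
Qed.

Lemma bochner_measurable_norm (f : R -> X) : bochner_measurable f ->
  measurable_fun setT (fun t => `|f t|).
Proof. by move=> bf; apply: (bochner_measurable_measurable bf) => x; exact: norm_continuous. Qed.

Lemma bochner_measurableB (f g : R -> X) : bochner_measurable f -> bochner_measurable g ->
  bochner_measurable (fun t => f t - g t).
Proof.
move=> [s [fs sf]] [r [fr rg]]; exists (fun n t => s n t - r n t); split.
  move=> n; exact: (finite_measurable_comp (fun p =>
    p.1 - p.2) (finite_measurable_pair (fs n) (fr n))).
by move=> t; apply: cvgB.
Qed.

Import HBSimple.

Lemma bochner_measurableZ (h : R -> R) (f : R -> X) : measurable_fun setT h ->
  bochner_measurable f ->
  bochner_measurable (fun t => h t *: f t).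
Proof.
move=> mh [s [fs sf]].
have [g hg] := approximation_sfun measurableT ((measurable_EFinP _ _).2 mh :
  measurable_fun setT (EFin \o h)).
exists (fun n t => g n t *: s n t); split.
  move=> n; apply: (finite_measurable_comp (fun p =>
    p.1 *: p.2) (finite_measurable_pair _ (fs n))).
  split; first exact: fimfunP.
  by move=> y; rewrite -[X in measurable X]setTI; exact: (measurable_funP (g n)).
move=> t; apply: cvgZ => //.
by have /= := hg t I; move/fine_cvgP => [].
Qed.

End finite_valued.

(** * Bounded linear functionals *)

Section functionals.
Context {R : realType} {X : completeNormedModType R}.

Definition bounded_functional (l : X -> R) : Prop :=
  (forall (a : R) x y, l (a *: x + y) = a * l x + l y) /\
  exists K, forall x, `|l x| <= K * `|x|.

Lemma bounded_functional0 l : bounded_functional l -> l 0 = 0.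
Proof. by move=> [h _]; have := h (-1) 0 0; rewrite scaleN1r oppr0 addr0 mulN1r addNr. Qed.

Lemma bounded_functionalB l x y : bounded_functional l -> l (x - y) = l x - l y.
Proof. by move=> [h _]; rewrite addrC -scaleN1r h mulN1r addrC. Qed.

Lemma bounded_functionalZ l a x : bounded_functional l -> l (a *: x) = a * l x.
Proof. by move=> bl; have [h _] := bl; rewrite -[a *: x]addr0 h bounded_functional0// addr0. Qed.

Lemma bounded_functionalD l x y : bounded_functional l -> l (x + y) = l x + l y.
Proof. by move=> [h _]; rewrite -[x]scale1r h mul1r scale1r. Qed.

Lemma bounded_functional_bound l : bounded_functional l ->
  exists2 K, 0 < K & forall x, `|l x| <= K * `|x|.
Proof.
move=> [_ [K hK]]; exists (`|K| + 1); first by rewrite ltr_wpDl.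
move=> x; apply: (le_trans (hK x)); apply: ler_wpM2r => //.
by apply: (le_trans (ler_norm K)); rewrite lerDl.
Qed.

Lemma bounded_functional_continuous l : bounded_functional l -> continuous l.
Proof.
move=> bl x; have [K K0 hK] := bounded_functional_bound bl.
apply/(@cvgrPdist_le _ _ _ (nbhs x)) => e e0.
have eK : 0 < e / K by rewrite divr_gt0.
have /(@cvgrPdist_le _ _ _ (nbhs x)) /(_ _ eK) := @cvg_id _ (nbhs x).
apply: filterS => y h; rewrite -bounded_functionalB//; apply: (le_trans (hK _)).
by rewrite mulrC -ler_pdivlMr.
Qed.

End functionals.

(** * The Bochner integral through functionals *)

Section bochner.
Context {R : realType} {X : completeNormedModType R}.
Local Notation mu := (@lebesgue_measure R).
Implicit Types (l : X -> R) (f : R -> X).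

Let itv_lty (a b : R) : (mu `]a, b[%classic < +oo)%E.
Proof.
rewrite lebesgue_measure_itv /=; case: ifP => _; last exact: ltry.
by rewrite -EFinB ltry.
Qed.

Lemma simple_integral_functional (a b : R) (s : {fimfun R >-> X}) l :
  simple_in setT s -> bounded_functional l ->
  mu.-integrable `]a, b[ (fun t => (l (s t))%:E) /\
  l (simple_integral a b s) = \int[mu]_(t in `]a, b[) l (s t).
Proof.
move=> [ms _] bl; set D := `]a, b[%classic.
have mD : measurable (D : set (measurableTypeR R)) by exact: measurable_itv.
have fs : finite_set (range s) by exact: fimfunP.
pose r : seq X := finmap.enum_fset (fset_set (range s)).
pose F x t := (l x * \1_(s @^-1` [set x]) t)%:E.
have mF x : mu.-integrable D (F x).
  have i1 : mu.-integrable D (EFin \o \1_(s @^-1` [set x])).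
    apply: (@measurable_bounded_integrable _ _ R mu) => //; first exact: itv_lty.
      by apply: measurable_funTS; apply: measurable_indic; exact: ms.
    exists 1; split => // M M1 t _ /=; rewrite indicE; case: (_ \in _);
      rewrite ?normr1 ?normr0 ltW//.
    exact: lt_trans M1.
  have := integrableZl mD (l x) i1; by apply: eq_integrable => // t _; rewrite /F EFinM.
have IF x : (\int[mu]_(t in D) F x t = (l x * fine (mu (D `&` s @^-1` [set x])))%:E)%E.
  rewrite /F; under eq_integral do rewrite EFinM.
  rewrite integralZl//; last first.
    apply: (@measurable_bounded_integrable _ _ R mu) => //; first exact: itv_lty.
      by apply: measurable_funTS; apply: measurable_indic; exact: ms.
    exists 1; split => // M M1 t _ /=; rewrite indicE; case: (_ \in _);
      rewrite ?normr1 ?normr0 ltW//.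
    exact: lt_trans M1.
  rewrite integral_indic//; last exact: ms.
  rewrite setIC EFinM fineK// ge0_fin_numE//.
  apply: le_lt_trans (itv_lty a b); apply: le_measure; rewrite ?inE//.
  by apply: measurableI => //; exact: ms.
have E t : (l (s t))%:E = (\sum_(x <- r) F x t)%E.
  have m : s t \in r by rewrite in_fset_set// inE; exists t.
  have u : uniq r by exact: finmap.fset_uniq.
  rewrite (bigD1_seq (s t) m u) /= big1 => [|x xt].
    by rewrite adde0 /F indicE mem_set// mulr1.
  by rewrite /F indicE memNset ?mulr0//= => st; move: xt; rewrite st eqxx.
have i1 : mu.-integrable D (fun t => (l (s t))%:E).
  have := @integrable_sum _ _ R mu D mD X r xpredT F (fun x _ => mF x).
  by apply: eq_integrable => // t _; rewrite E.
split => //.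
rewrite /Rintegral; under eq_integral do rewrite E.
rewrite integral_sum//; under eq_bigr do rewrite IF.
rewrite sumEFin /= /simple_integral fsbig_finite//= -/r.
elim: r {E} => [|x q IH]; first by rewrite !big_nil bounded_functional0.
by rewrite !big_cons bounded_functionalD// IH bounded_functionalZ// mulrC.
Qed.

Lemma has_bochner_functional (a b : R) f w l :
  bochner_measurable f -> has_bochner_integral a b f w -> bounded_functional l ->
  mu.-integrable `]a, b[ (fun t => (l (f t))%:E) /\
  l w = \int[mu]_(t in `]a, b[) l (f t).
Proof.
move=> bf [_ [s [ss fs sw]]] bl; set D := `]a, b[%classic.
have mD : measurable (D : set (measurableTypeR R)) by exact: measurable_itv.
have [K K0 hK] := bounded_functional_bound bl.
have bs n : bochner_measurable (s n) by exists (fun=> s n); split => [_|t];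
  [exact: simple_finite_measurable (ss n)|exact: cvg_cst].
have bfs n := bochner_measurableB bf (bs n).
have mlf : measurable_fun setT (l \o f).
  by apply: bochner_measurable_measurable => //; exact: bounded_functional_continuous.
pose I n := (\int[mu]_(t in D) `|f t - s n t|%:E)%E.
have mnorm n : measurable_fun D (fun t => `|f t - s n t|%:E).
  by apply: measurable_funTS; apply: measurableT_comp => //; exact: bochner_measurable_norm.
(* Convergence to 0 in the extended reals makes these integrals finite only eventually. *)
have Ifin : \forall n \near \oo, I n \is a fin_num.
  by move: fs => /fine_cvgP[].
have lfs n : I n \is a fin_num -> mu.-integrable D (fun t => (l (f t - s n t))%:E) /\
    `|\int[mu]_(t in D) l (f t - s n t)| <= K * fine (I n).
  move=> fin.
  have i1 : mu.-integrable D (fun t => (`|f t - s n t|)%:E).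
    apply/integrableP; split; first exact: mnorm.
    under eq_integral do rewrite /= normr_id.
    by rewrite ltey_eq fin.
  have i2 := integrableZl mD K i1.
  have i3 : mu.-integrable D (fun t => (l (f t - s n t))%:E).
    apply: le_integrable i2 => //.
      apply: measurable_funTS; apply: measurableT_comp => //.
      by apply: (bochner_measurable_measurable (bfs n)); exact: bounded_functional_continuous.
    by move=> t _; rewrite /= lee_fin normrM (gtr0_norm K0) normr_id.
  split => //; apply: (le_trans (le_normr_Rintegral _ _)) => //.
  have -> : K * fine (I n) = \int[mu]_(t in D) (K * `|f t - s n t|).
    by rewrite RintegralZl.
  apply: le_Rintegral => //; first exact: integrable_norm.
have simp n := simple_integral_functional a b (ss n) bl.
have [N _ hN] := Ifin.
have ilf : mu.-integrable D (fun t => (l (f t))%:E).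
  have := integrableD mD (lfs N (hN N (leqnn N))).1 (simp N).1.
  by apply: eq_integrable => // t _; rewrite /= -EFinD bounded_functionalB// subrK.
split => //.
have c1 : l (simple_integral a b (s n)) @[n --> \oo] --> l w.
  by apply: cvg_comp; [exact: sw|exact: (bounded_functional_continuous bl (x := w))].
have c2 : l (simple_integral a b (s n)) @[n --> \oo] --> \int[mu]_(t in D) l (f t).
  apply/cvgrPdist_le => e e0.
  have eK : 0 < e / K by rewrite divr_gt0.
  move: fs => /fine_cvgP[h1 /cvgrPdist_le /(_ _ eK)].
  move: h1; apply: filterS2 => n fin; rewrite /= sub0r normrN => h.
  have [j1 j2] := lfs n fin.
  have -> : \int[mu]_(t in D) l (f t) - l (simple_integral a b (s n)) = \int[mu]_(t in D) l (f
    t - s n t).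
    rewrite (simp n).2 -RintegralB//; last exact: (simp n).1.
    by apply: eq_Rintegral => t _; rewrite bounded_functionalB.
  apply: (le_trans j2); rewrite mulrC -ler_pdivlMr//.
  by apply: le_trans h; exact: ler_norm.
by rewrite -(cvg_lim _ c1)// (cvg_lim _ c2).
Qed.

Lemma strongly_measurable_bochner_measurable (I : set R) f : bochner_measurable f ->
  strongly_measurable setT Num.norm I f.
Proof.
move=> [s [fs sf]]; split; first exact: aeW.
exists (fun n => to_fimfun (fs n)); split; first by move=> n; exact: simple_fimfun.
apply: aeW => t.
have h : f t - s n t @[n --> \oo] --> f t - f t by apply: cvgB => //; exact: cvg_cst.
have := cvg_norm h; rewrite subrr normr0 => h2 It; exact: h2.
Qed.

Context (dot : {dot X for idfun}).
Hypothesis dotn : forall x : X, dot x x = `|x| ^+ 2.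

Lemma bounded_functional_dot z : bounded_functional (fun x => dot x z).
Proof.
split; first by move=> a x y; rewrite dotPl.
by exists `|z| => x; rewrite mulrC; exact: dot_CS.
Qed.

Lemma has_bochner_unique (a b : R) f w w' :
  bochner_measurable f -> has_bochner_integral a b f w -> has_bochner_integral a b f w' -> w = w'.
Proof.
move=> bf h h'; apply: (dot_inj dotn) => z.
by rewrite (has_bochner_functional bf h (bounded_functional_dot z)).2
  (has_bochner_functional bf h' (bounded_functional_dot z)).2.
Qed.

(** The simple approximants are set to 0 where their norm exceeds twice that of [f]. The error is
    then at most 3 |f|, dominated convergence gives convergence in L^1, and the integrals form a
    Cauchy sequence by pairing with vectors. *)
Lemma has_bochner_exists (a b : R) f : bochner_measurable f ->
  mu.-integrable `]a, b[ (fun t => `|f t|%:E) -> exists w, has_bochner_integral a b f w.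
Proof.
move=> bf fi; have [s [fs sf]] := bf; set D := `]a, b[%classic.
have mD : measurable (D : set (measurableTypeR R)) by exact: measurable_itv.
have mf := bochner_measurable_norm bf.
pose B n := [set t | `|s n t| <= 2 * `|f t|].
have mB n : measurable (B n).
  have m1 : measurable_fun setT (fun t => `|s n t|).
    by apply: finite_measurable_measurable; exact: (finite_measurable_comp (fun x : X => `|x|)).
  have m2 : measurable_fun setT (fun t => 2 * `|f t|) by exact: measurable_funM.
  have mb := measurable_fun_ler m1 m2.
  have : measurable (setT `&` (fun t => `|s n t| <= 2 * `|f t|) @^-1` [set true]) by exact: mb.
  by rewrite setTI.
pose r n t := if `[< B n t >] then s n t else 0.
have fr n : finite_measurable (r n).
  exact: (finite_measurable_comp (fun p : bool * X =>
    if p.1 then p.2 else 0) (finite_measurable_pair (finite_measurable_bool (mB n)) (fs n))).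
(* Where [f t] is 0 the cut makes the approximant 0; elsewhere it is eventually inactive. *)
have rf t : r n t @[n --> \oo] --> f t.
  have [f0|f0] := eqVneq (f t) 0.
    rewrite f0 (_ : (fun n => r n t) = cst 0); first exact: cvg_cst.
    apply/funext => n; rewrite /r; case: asboolP => // h.
    by move: h; rewrite /B /= f0 normr0 mulr0 normr_le0 => /eqP.
  have f1 : 0 < `|f t| by rewrite normr_gt0.
  have : \forall n \near \oo, s n t = r n t.
    have /cvgrPdist_le /(_ _ f1) := sf t; apply: filterS => n h.
    rewrite /r; case: asboolP => // nB; exfalso; apply: nB; rewrite /B /=.
    rewrite -[s n t](subrK (f t)); apply: (le_trans (ler_normD _ _)).
    by rewrite mulr_natl mulr2n lerD2r distrC.
  by move=> /near_eq_cvg h; apply: cvg_trans (sf t); exact: h.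
have rle n t : `|f t - r n t| <= 3 * `|f t|.
  apply: (le_trans (ler_normB _ _)); rewrite -[3]/(1 + 2 : R) mulrDl mul1r lerD2l.
  by rewrite /r; case: asboolP => // _; rewrite normr0 mulr_ge0.
have br n : bochner_measurable (r n) by exists (fun=> r n); split => // t; exact: cvg_cst.
have c1 : ((\int[mu]_(t in D) `|f t - r n t|%:E) @[n --> \oo] --> (0 : \bar R))%E.
  have mfr n : measurable_fun D (fun t => `|f t - r n t|%:E).
    by apply: measurable_funTS; apply: measurableT_comp => //; apply: bochner_measurable_norm;
      exact: bochner_measurableB.
  have i3 := integrableZl mD 3 fi.
  have A1 : {ae mu, forall t, D t -> (fun n => `|f t - r n t|%:E) @ \oo --> (0 : R)%:E}.
    apply: aeW => t _; apply: cvg_EFin; first exact: nearW.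
    have h : f t - r n t @[n --> \oo] --> f t - f t by apply: cvgB; [exact: cvg_cst|exact: rf].
    by have := cvg_norm h; rewrite subrr normr0 => h2; exact: h2.
  have A2 : {ae mu, forall t n, D t -> (`|(`|f t - r n t|%:E)| <= 3%:E * `|f t|%:E)%E}.
    by apply: aeW => t n _; rewrite /= normr_id lee_fin.
  have [_ _] := @dominated_convergence _ _ R mu D mD (fun n t => `|f t - r n t|%:E) (cst 0%E) _
    mfr (measurable_cst _) A1 i3 A2.
  by rewrite integral0.
pose q n := to_fimfun (fr n).
have sq n : simple_in setT (q n) by exact: simple_fimfun.
have i4 n : mu.-integrable D (fun t => `|f t - r n t|%:E).
  apply: le_integrable (integrableZl mD 3 fi) => //.
    by apply: measurable_funTS; apply: measurableT_comp => //; apply: bochner_measurable_norm;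
      exact: bochner_measurableB.
  by move=> t _; rewrite /= lee_fin normr_id ger0_norm ?mulr_ge0.
pose J n := \int[mu]_(t in D) `|f t - r n t|.
have JE n : (\int[mu]_(t in D) `|f t - r n t|%:E)%E = (J n)%:E.
  by rewrite /J /Rintegral fineK// integrable_fin_num.
have SIdist n m : `|simple_integral a b (q n) - simple_integral a b (q m)| <= J n + J m.
  apply: (dot_norm_le dotn).
    by apply: addr_ge0; apply: Rintegral_ge0.
  move=> z; rewrite dotBl.
  have [j1 ->] := simple_integral_functional a b (sq n) (bounded_functional_dot z).
  have [j2 ->] := simple_integral_functional a b (sq m) (bounded_functional_dot z).
  rewrite -RintegralB//.
  have E : (J n + J m) * `|z| = \int[mu]_(t in D) ((`|f t - r n t| + `|f t - r m t|) * `|z|).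
    rewrite RintegralZr//; last by have := integrableD mD (i4 n) (i4 m); apply: eq_integrable.
    by rewrite (RintegralD mD (i4 n) (i4 m)).
  rewrite E; apply: le_Rintegral => //.
  - by have := integrableB mD j1 j2; apply: eq_integrable.
  - have := integrableZr mD `|z| (integrableD mD (i4 n) (i4 m)).
    by apply: eq_integrable.
  move=> t _; rewrite -dotBl; apply: (le_trans (ler_norm _)); apply: (le_trans (dot_CS dotn _ _)).
  apply: ler_wpM2r => //=.
  rewrite -[r n t - r m t](_ : (f t - r m t) - (f t - r n t) = _).
    by apply: (le_trans (ler_normB _ _)); rewrite addrC.
  by rewrite opprB addrC addrA subrK.
have Jc : J n @[n --> \oo] --> (0 : R).
  move: c1; rewrite (_ : (fun n => _) = (fun n => (J n)%:E)); last by apply/funext => n;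
    rewrite JE.
  by move=> /fine_cvgP[].
have cS : cvgn (fun n => simple_integral a b (q n)).
  apply/cauchy_cvgP/cauchy_ballP => e e0.
  have e2 : 0 < e / 2 by rewrite divr_gt0.
  have /cvgrPdist_lt /(_ _ e2) [N _ hN] := Jc.
  pose E : set X := [set x | exists2 n, (N <= n)%N & x = simple_integral a b (q n)].
  exists (E, E); first by split; exists N => // n Nn; exists n.
  move=> [x y] /= [[n Nn ->] [m Nm ->]]; rewrite -ball_normE /=.
  apply: (le_lt_trans (SIdist n m)); rewrite [ltRHS]splitr.
  have h n' : (N <= n')%N -> J n' < e / 2.
    by move=> /(hN n'); rewrite /= sub0r normrN; apply: le_lt_trans; exact: ler_norm.
  by apply: ltrD; exact: h.
exists (limn (fun n => simple_integral a b (q n))); split.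
  exact: strongly_measurable_bochner_measurable.
by exists q; split => //.
Qed.

(** [g] may be wild on the null set, so the integrals are compared in both directions by
    [ge0_le_integral_off_null]. *)
Lemma has_bochner_ae (a b : R) f g w : {ae mu, forall t, `]a, b[%classic t -> f t = g t} ->
  has_bochner_integral a b f w -> has_bochner_integral a b g w.
Proof.
move=> [N [mN N0 sub]] [[sm1 [q [sq qf]]] [s [ss fs sw]]].
have fg t : `]a, b[%classic t -> ~ N t -> f t = g t.
  by move=> Dt Nt; apply: contrapT => ne; apply: Nt; apply: sub => /= /(_ Dt).
have aeF : Filter (nbhs (almost_everywhere mu)) by exact: ae_filter_ringOfSetsType.
have aeN : {ae mu, forall t, ~ N t}.
  by exists N; split => // t /= /contrapT.
split.
  split; first exact: aeW.
  exists q; split => //; move: qf aeN; apply: (@filterS2 _ _ aeF) => t h nt Dt.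
  by rewrite -(fg _ Dt nt); exact: h.
exists s; split => //.
rewrite (_ : (fun n => _) = (fun n => (\int[mu]_(t in `]a, b[) `|f t - s n t|%:E)%E))//.
apply/funext => n; apply/eqP; rewrite eq_le; apply/andP; split.
  by apply: (ge0_le_integral_off_null mN N0) => t Dt // nt; rewrite (fg _ Dt nt).
by apply: (ge0_le_integral_off_null mN N0) => t Dt // nt; rewrite (fg _ Dt nt).
Qed.

End bochner.

(** * Vanishing almost everywhere from vanishing integrals *)

Section almost_everywhere_zero.
Context {R : realType}.
Local Notation mu := (@lebesgue_measure R).

Lemma aeF : Filter (nbhs (almost_everywhere mu)).
Proof. exact: ae_filter_ringOfSetsType. Qed.

Lemma ae_and (P Q : R -> Prop) : {ae mu, forall t, P t} -> {ae mu, forall t, Q t} ->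
  {ae mu, forall t, P t /\ Q t}.
Proof. by move=> p q; move: p q; apply: (@filterS2 _ _ aeF) => t p q; split. Qed.

(** Lebesgue differentiation: almost everywhere [h] is the derivative of its primitive, which is
    zero near every t < T. *)
Lemma integrals_eq0_ae (h : R -> R) (T : R) : mu.-integrable setT (EFin \o h) ->
  (forall t, T <= t -> h t = 0) -> (forall t, t <= T -> convol (powk 1) h t = 0) ->
  {ae mu, forall t, h t = 0}.
Proof.
move=> ih hT hz.
have mh : measurable_fun setT h by apply/measurable_EFinP; exact: measurable_int ih.
have F0 t : t <= T -> \int[mu]_(s in `]-oo, t]) h s = 0.
  move=> tT; rewrite -(hz t tT) -Rintegral_itv_bndo_bndc; last first.
    by apply: (integrableS _ _ _ ih).
  rewrite /convol Rintegral_mkcond; apply: eq_Rintegral => s _; rewrite patchE.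
  case: ifPn => [|]; rewrite ?notin_setE ?inE /= in_itv /= => st.
    by rewrite powk1 ?mul1r// subr_gt0.
  by rewrite powk0 ?mul0r// subr_le0 leNgt; apply/negP.
have loc : locally_integrable [set: R] h by apply: open_integrable_locally => //; exact: openT.
have sub y : mu.-integrable `]-oo, y] (EFin \o h) by apply: integrableS ih.
have := FTC1Ny sub loc; apply: (@filterS _ _ aeF) => t [_ dF].
have [Tt|tT] := leP T t; first exact: hT.
rewrite -dF derive1E (near_eq_derive (g := cst 0)) ?derive_cst//.
near=> s; apply: F0; apply: ltW; near: s; exact: lt_nbhsl.
Unshelve. all: end_near. Qed.

Lemma ae_seq (Y : eqType) (r : seq Y) (P : Y -> R -> Prop) :
  (forall y, {ae mu, forall t, P y t}) -> {ae mu, forall t, forall y, y \in r -> P y t}.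
Proof.
move=> h; elim: r => [|y r IH]; first by apply: aeW.
have h1 := h y; move: h1 IH; apply: (@filterS2 _ _ aeF) => t p q z.
by rewrite inE => /predU1P[->//|]; exact: q.
Qed.

End almost_everywhere_zero.

(** * Representatives, and fractional integrals as scalar convolutions *)

Section frac_integral_theory.
Context {R : realType} {X : completeNormedModType R} (dot : {dot X for idfun}).
Hypothesis dotn : forall x : X, dot x x = `|x| ^+ 2.
Local Notation mu := (@lebesgue_measure R).
Implicit Types (f g : R -> X) (t T : R).

(** The null set on which [dot (g t) z] differs from 0 depends on [z], and X need not be separable.
    The values of the approximants [s n] are countably many, and along them [dot (s n t) (g t)]
    tends to the squared norm of [g t]. *)
Lemma bochner_measurable_eq0_ae g T : bochner_measurable g -> mu.-integrable setT (fun t =>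
  `|g t|%:E) ->
  (forall t, T <= t -> g t = 0) ->
  (forall z t, t <= T -> convol (powk 1) (fun s => dot (g s) z) t = 0) ->
  {ae mu, forall t, g t = 0}.
Proof.
move=> bg ig gT gz; have [s [fs sg]] := bg.
have z0 z : {ae mu, forall t, dot (g t) z = 0}.
  apply: (@integrals_eq0_ae _ _ T); last by move=> t; exact: gz.
    have i1 := integrableZl measurableT `|z| ig.
    apply: le_integrable i1 => //.
      apply: measurableT_comp => //; apply: (bochner_measurable_measurable (p := fun x =>
        dot x z) bg).
      exact: (bounded_functional_continuous (bounded_functional_dot dotn z)).
    move=> t _; rewrite /= lee_fin normrM !normr_id mulrC; exact: dot_CS.
  by move=> t Tt; rewrite gT// dot0l.
have zn n : {ae mu, forall t, dot (g t) (s n t) = 0}.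
  have [/finite_seqP[r rE] _] := fs n.
  have := ae_seq (r : seq X) (P := fun z t => dot (g t) z = 0) z0.
  apply: (@filterS _ _ (@aeF R)) => t; apply.
  have : range (s n) (s n t) by exists t.
  by rewrite rE.
have := measure_negligible.ae_foralln zn; apply: (@filterS _ _ (@aeF R)) => t h.
apply/eqP; rewrite -normr_eq0 -sqrf_eq0 -dotn.
have c1 : dot (s n t) (g t) @[n --> \oo] --> dot (g t) (g t) by exact: (cvg_dotl dotn (sg t)).
apply/eqP; rewrite -(cvg_lim _ c1)//.
rewrite (_ : (fun n => dot (s n t) (g t)) = cst 0); first by rewrite lim_cst.
by apply/funext => n; rewrite (dotC dot (s n t)) h.
Qed.

(** The function is set to 0 on the exceptional set and outside (0, T). The bound of the norm by [N]
    turns convergence in the graph norm into convergence in X. *)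
Lemma strongly_measurable_representative (D : set X) (N : X -> R) T f :
  (forall x, `|x| <= N x) -> strongly_measurable D N `]0, T[ f ->
  exists g, [/\ bochner_measurable g, forall t, ~ (0 < t < T) -> g t = 0 &
    {ae mu, forall t, `]0, T[%classic t -> g t = f t}].
Proof.
move=> leN [_ [s [ss [Z [mZ Z0 sub]]]]].
pose E := `]0, T[%classic `\` Z : set R.
have mE : measurable E by apply: measurableD => //; exact: measurable_itv.
exists (fun t => if `[< E t >] then f t else 0); split.
- exists (fun n t => if `[< E t >] then s n t else 0); split.
    move=> n; exact: (finite_measurable_comp (fun p : bool * X => if p.1 then p.2 else 0)
      (finite_measurable_pair (finite_measurable_bool mE) (simple_finite_measurable (ss n)))).
  move=> t; case: asboolP => [[It nZ]|_]; last exact: cvg_cst.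
  have c : N (f t - s n t) @[n --> \oo] --> (0 : R).
    by apply: contrapT => h; apply: nZ; apply: sub => /= /(_ It).
  apply/cvgrPdist_le => e e0; have /cvgrPdist_le /(_ _ e0) := c.
  apply: filterS => n; rewrite /= sub0r normrN; apply: le_trans.
  by apply: (le_trans (leN _)); exact: ler_norm.
- by move=> t h; case: asboolP => // -[It _]; exfalso; apply: h; move: It; rewrite /= in_itv.
- exists Z; split => // t /= h; apply: contrapT => nZ; apply: h => It.
  by rewrite asboolT.
Qed.

Lemma L2_representative (D : set X) (N : X -> R) T f :
  (forall x, `|x| <= N x) -> L2 D N T f ->
  exists g, [/\ bochner_measurable g, forall t, ~ (0 < t < T) -> g t = 0,
    {ae mu, forall t, `]0, T[%classic t -> g t = f t} &
    mu.-integrable setT (fun t => `|g t|%:E)].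
Proof.
move=> leN [sm fin]; have [g [bg g0 gf]] := strongly_measurable_representative leN sm.
exists g; split => //.
have mg := bochner_measurable_norm bg.
have [Z [mZ Z0 sub]] := gf.
have D_ : measurable (`]0, T[%classic : set (measurableTypeR R)) by exact: measurable_itv.
have h1 : (\int[mu]_(t in `]0%R, T[) (`|g t| ^+ 2)%:E < +oo)%E.
  apply: le_lt_trans fin; apply: (ge0_le_integral_off_null mZ Z0) => t It.
  - by rewrite lee_fin exprn_ge0.
  - by rewrite lee_fin exprn_even_ge0.
  - move=> nZ; have -> : g t = f t by apply: contrapT => ne; apply: nZ; apply: sub => /= /(_ It).
    by rewrite lee_fin lerXn2r ?nnegrE// (le_trans _ (leN _)).
have m2 : measurable_fun `]0, T[ (fun t => (`|g t| ^+ 2)%:E).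
  by apply: measurable_funTS; apply: measurableT_comp => //; apply: measurable_funX.
apply/integrableP; split; first by apply: measurableT_comp.
have -> : (\int[mu]_t abse (`|g t|%:E) = \int[mu]_(t in `]0%R, T[) `|g t|%:E)%E.
  rewrite [RHS]integral_mkcond; apply: eq_integral => t _; rewrite /= normr_id patchE.
  case: ifPn => // /negP h; rewrite g0 ?normr0// => It; apply: h.
  by rewrite inE /= in_itv.
(* y <= 1 + y^2 gives integrability, the interval having finite measure. *)
apply: (@le_lt_trans _ _ (\int[mu]_(t in `]0%R, T[) (1 + (`|g t| ^+ 2)%:E))%E).
  apply: ge0_le_integral => //.
  - by apply: measurable_funTS; apply: measurableT_comp.
  - by apply: emeasurable_funD.
  move=> t _; rewrite -EFinD lee_fin; have := normr_ge0 (g t); move: `|g t| => y y0; nra.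
rewrite ge0_integralD//.
apply: lte_add_pinfty; last exact: h1.
rewrite integral_cst// mul1e.
suff : (mu `]0%R, T[%classic < +oo)%E by [].
rewrite lebesgue_measure_itv /=; case: ifP => _; last exact: ltry.
by rewrite -EFinB ltry.
Qed.

Context (al : R).
Hypotheses (al0 : 0 < al) (al1 : al < 1).
Local Notation k := (@powk R al).

Lemma convolvable_k_integrable (b : R) (h : R -> R) T : 0 < b ->
  mu.-integrable setT (EFin \o h) ->
  (forall t, t <= 0 -> h t = 0) -> convolvable (powk (b + 1)) h T.
Proof.
move=> b0 ih h0.
have mh : measurable_fun setT h by apply/measurable_EFinP; exact: measurable_int ih.
have i1 := integrableZl measurableT (powk (b + 1) T) ih.
apply: le_integrable i1 => //; first by apply: measurable_convol_EFin => //;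
  exact: measurable_powk.
move=> s _; rewrite /= lee_fin !normrM !(ger0_norm (powk_ge0 _ _)).
have [s0|s0] := leP s 0; first by rewrite h0// normr0 !mulr0.
by apply: ler_wpM2r => //; apply: powk_le_mono => //; lra.
Qed.

(** One more integration makes the kernel harmless: [powk 1] convolved with [k] is a multiple of
    [powk (al + 1)], bounded on bounded intervals. Fubini at time [T] then gives the inner
    convergence for almost every t < T. *)
Lemma ae_convolvable_k (h : R -> R) T : mu.-integrable setT (EFin \o h) ->
  (forall t, t <= 0 -> h t = 0) -> {ae mu, forall t, t < T -> convolvable k h t}.
Proof.
move=> ih h0.
have mh : measurable_fun setT h by apply/measurable_EFinP; exact: measurable_int ih.
have E : convol (powk 1) k = fun t => powk_beta 1 al * powk (al + 1) t.
  by apply/funext => t; rewrite (convol_powk t (@ltr01 R) al0).2 addrC.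
have H : convolvable (convol (powk 1) k) h T by rewrite E; apply: convolvableZl;
  exact: convolvable_k_integrable.
have [_ _] := convolA (measurable_powk _) (measurable_powk _) mh (powk_ge0 1) (powk_ge0 al)
  (fun x => (convol_powk x (@ltr01 R) al0).1) H.
apply: (@filterS _ _ (@aeF R)) => t h1 tT; apply: h1.
by rewrite gt_eqF// powk_gt0// subr_gt0.
Qed.

(** The null set is fixed before the functional, so that at each remaining time all functionals may
    be used at once and separate vectors. *)
Lemma frac_integral_ae (v g : R -> X) T : bochner_measurable g -> mu.-integrable setT (fun t =>
  `|g t|%:E) ->
  (forall t, ~ (0 < t < T) -> g t = 0) ->
  {ae mu, forall t, `]0, T[%classic t -> g t = v t} ->
  {ae mu, forall t, 0 < t < T -> forall l, bounded_functional l ->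
    convolvable k (l \o g) t /\ l (frac_integral al v t) = (Gamma al)^-1 * convol k (l \o g) t}.
Proof.
move=> bg ig g0 gv.
have g0' t : t <= 0 -> g t = 0 by move=> t0; apply: g0 => /andP[]; rewrite ltNge t0.
have n0 t : t <= 0 -> `|g t| = 0 by move=> /g0' ->; rewrite normr0.
have [Z [mZ Z0 sub]] := gv.
have := ae_convolvable_k T ig n0; apply: (@filterS _ _ (@aeF R)) => t ck /andP[t0 tT].
have {ck}ci := ck tT.
have mD : measurable (`]0, t[%classic : set (measurableTypeR R)) by exact: measurable_itv.
pose ft s := k (t - s) *: g s.
have bf : bochner_measurable ft.
  apply: bochner_measurableZ => //; apply: (measurableT_comp (measurable_powk _));
    exact: measurable_funB.
have fi : mu.-integrable `]0, t[ (fun s => `|ft s|%:E).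
  have := integrableS measurableT mD (@subsetT _ _) ci.
  by apply: eq_integrable => // s _; rewrite /ft normrZ ger0_norm ?powk_ge0.
have [w hw] := has_bochner_exists dotn bf fi.
have ae1 : {ae mu, forall s, `]0, t[%classic s -> ft s = (t - s) `^ (al - 1) *: v s}.
  exists Z; split => // s /= h; apply: contrapT => nZ; apply: h;
    rewrite /= in_itv /= => /andP[s0 st].
  have -> : v s = g s.
    apply/esym; apply: contrapT => ne; apply: nZ; apply: sub => /= h; apply: ne; apply: h.
    by rewrite in_itv /= s0 (lt_trans st).
  by rewrite /ft /powk subr_gt0 st.
have ae2 : {ae mu, forall s, `]0, t[%classic s -> (t - s) `^ (al - 1) *: v s = ft s}.
  by have := ae1; apply: (@filterS _ _ (@aeF R)) => s h Is; rewrite h.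
have hw' := has_bochner_ae ae1 hw.
(* [bochner_integral] is a choice among integrals of the integrand in [v]; uniqueness is applied to
   its measurable representative [ft]. *)
have bw : bochner_integral 0 t (fun s => (t - s) `^ (al - 1) *: v s) = w.
  rewrite /bochner_integral; case: xgetP => [w' _ /= h|/(_ w)/(_ hw')//].
  exact: (has_bochner_unique dotn bf (has_bochner_ae ae2 h) hw).
move=> l bl; have [i1 lw] := has_bochner_functional bf hw bl.
have E : (fun s => (k (t - s) * (l \o g) s)%:E) = (fun s => (l (ft s))%:E) \_ `]0, t[%classic.
  apply/funext => s; rewrite patchE; case: ifPn => [_|].
    by rewrite /ft bounded_functionalZ.
  rewrite notin_setE /= in_itv /= => /negP; rewrite negb_and -!leNgt => /orP[s0|ts].
    by rewrite g0'// bounded_functional0// mulr0.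
  by rewrite powk0 ?mul0r// subr_le0.
split.
  have h : mu.-integrable setT ((fun s : R => (l (ft s))%:E) \_ `]0, t[%classic).
    by apply/(integrable_mkcond _ mD); exact: i1.
  by rewrite -E in h.
rewrite /frac_integral bw bounded_functionalZ// lw; congr (_ * _).
rewrite /convol Rintegral_mkcond; congr fine; apply: eq_integral => s _.
by have := congr1 (fun F => F s) E; rewrite /= => ->; rewrite !patchE; case: ifP.
Qed.

End frac_integral_theory.

(** * Positivity of Gamma *)

Section gamma.
Context {R : realType}.
Local Notation mu := (@lebesgue_measure R).

(** Integrability is the point, as a divergent integral would be read as 0: [powk al] dominates
    below 1 and the exponential density above it. *)
Lemma Gamma_gt0 (al : R) : 0 < al -> al < 1 -> 0 < Gamma al.
Proof.
move=> al0 al1.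
pose f (t : R) := powk al t * expR (- t).
have mf : measurable_fun setT f.
  apply: measurable_funM; first exact: measurable_powk.
  by apply: (measurableT_comp (@measurable_expR R)); exact: measurable_funN.
have f0 t : 0 <= f t by rewrite mulr_ge0 ?powk_ge0 ?expR_ge0.
have -> : Gamma al = \int[mu]_t f t.
  rewrite /Gamma Rintegral_mkcond; apply: eq_Rintegral => t _; rewrite patchE /f /powk.
  case: ifPn => [|]; rewrite ?notin_setE ?inE /= in_itv /= andbT.
    by move=> ->.
  by move/negP/negbTE => ->; rewrite mul0r.
apply: Rintegral_gt0 => //; last by move=> t /andP[t0 _]; rewrite /f mulr_gt0 ?powk_gt0 ?expR_gt0.
have i1 : convolvable (powk 1) (powk al) 1 by exact: convolvable_powk1.
have i2 : mu.-integrable setT (EFin \o exponential_pdf (1 : R)).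
  apply/integrableP; split.
    by apply/measurable_EFinP; exact: measurable_exponential_pdf.
  under eq_integral do rewrite /= ger0_norm ?exponential_pdf_ge0//.
  by rewrite integral_exponential_pdf// ltry.
apply: le_integrable (integrableD measurableT i1 i2) => //; first exact/measurable_EFinP.
move=> t _; rewrite /= lee_fin (ger0_norm (f0 t)); apply: le_trans (ler_norm _).
have p0 : 0 <= exponential_pdf 1 t by apply: exponential_pdf_ge0.
have [t1|t1] := ltP t 1.
  rewrite powk1 ?subr_gt0// mul1r; apply: (@le_trans _ _ (powk al t)); last by rewrite lerDl.
  rewrite /f; have [t0|t0] := leP t 0; first by rewrite powk0// mul0r.
  rewrite -[leRHS]mulr1; apply: ler_wpM2l; first exact: powk_ge0.
  by rewrite -[leRHS]expR0 ler_expR oppr_le0 ltW.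
apply: (@le_trans _ _ (exponential_pdf 1 t)); last first.
  by rewrite lerDr mulr_ge0 ?powk_ge0.
have t0 : 0 < t := lt_le_trans ltr01 t1.
rewrite /exponential_pdf patchE mem_set /= ?in_itv /= ?(ltW t0)//.
rewrite mul1r mulN1r /f -[leRHS]mul1r; apply: ler_wpM2r; first exact: expR_ge0.
rewrite /powk t0; have := powR_antitone (c := al - 1) _ ltr01 t1.
by rewrite powR1; apply; rewrite subr_le0 ltW.
Qed.

End gamma.

(** * Primitives of Bochner integrable functions *)

Section primitive.
Context {R : realType} {X : completeNormedModType R} (dot : {dot X for idfun}).
Hypothesis dotn : forall x : X, dot x x = `|x| ^+ 2.
Local Notation mu := (@lebesgue_measure R).
Context (g : R -> X) (T : R).
Hypotheses (bg : bochner_measurable g) (ig : mu.-integrable setT (fun t => `|g t|%:E)).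
Hypothesis g0 : forall t : R, ~ (0 < t < T) -> g t = 0.

Lemma integrable_functional l : bounded_functional l -> mu.-integrable setT (EFin \o (l \o g)).
Proof.
move=> bl; have [K K0 hK] := bounded_functional_bound bl.
apply: le_integrable (integrableZl measurableT K ig) => //.
  apply: measurableT_comp => //; apply: bochner_measurable_measurable => //.
  exact: bounded_functional_continuous.
by move=> t _; rewrite /= lee_fin normrM normr_id (gtr0_norm K0).
Qed.

Lemma functional_le0 l (t : R) : bounded_functional l -> t <= 0 -> (l \o g) t = 0.
Proof.
move=> bl t0; rewrite /= g0 ?bounded_functional0// => /andP[].
by rewrite ltNge t0.
Qed.

Lemma convolvable_powk1_integrable (h : R -> R) t : mu.-integrable setT (EFin \o h) ->
  convolvable (powk 1) h t.
Proof.
move=> ih.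
have mh : measurable_fun setT h by apply/measurable_EFinP; exact: measurable_int ih.
apply: le_integrable ih => //; first by apply: measurable_convol_EFin => //;
  exact: measurable_powk.
move=> s _; rewrite /= lee_fin normrM -[leRHS]mul1r; apply: ler_wpM2r => //.
by have [_ _ /(_ (t - s))] := @causal_powk1 R.
Qed.

Definition bochner_primitive (t : R) : X := xget 0 [set w | has_bochner_integral 0 t g w].

Lemma bochner_primitive_functional l t : bounded_functional l ->
  l (bochner_primitive t) = convol (powk 1) (l \o g) t.
Proof.
move=> bl.
have mD : measurable (`]0, t[%classic : set (measurableTypeR R)) by exact: measurable_itv.
have ex := has_bochner_exists dotn bg (integrableS measurableT mD (@subsetT _ _) ig).
have hp : has_bochner_integral 0 t g (bochner_primitive t).
  by have [w hw] := ex; exact: (@xgetPex _ 0 [set w | has_bochner_integral 0 t g w] (ex_intro _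
    w hw)).
rewrite (has_bochner_functional bg hp bl).2 /convol Rintegral_mkcond.
apply: eq_Rintegral => s _; rewrite patchE.
case: ifPn => [|]; rewrite ?notin_setE ?inE /= in_itv /=.
  by move=> /andP[s0 st]; rewrite powk1 ?mul1r// subr_gt0.
move=> /negP; rewrite negb_and -!leNgt => /orP[s0|ts].
  by rewrite -[l (g s)]/((l \o g) s) functional_le0 ?mulr0.
by rewrite powk0 ?mul0r// subr_le0.
Qed.

Definition L1_norm : R := \int[mu]_t `|g t|.

Lemma L1_norm_ge0 : 0 <= L1_norm. Proof. exact: Rintegral_ge0. Qed.

Lemma bochner_primitive_norm t : `|bochner_primitive t| <= L1_norm.
Proof.
apply: (dot_norm_le dotn L1_norm_ge0) => z.
rewrite (bochner_primitive_functional t (bounded_functional_dot dotn z)).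
rewrite /L1_norm -RintegralZr//; apply: le_Rintegral => //.
- exact: (convolvable_powk1_integrable t (integrable_functional (bounded_functional_dot dotn z))).
- have := integrableZr measurableT `|z| ig.
  by apply: eq_integrable.
move=> s _; apply: (le_trans (ler_norm _)); rewrite normrM -[leRHS]mul1r.
apply: ler_pM => //; last exact: (dot_CS dotn).
by have [_ _ /(_ (t - s))] := @causal_powk1 R.
Qed.

Lemma causal_bochner_primitive l K : bounded_functional l ->
  (forall t, `|l (bochner_primitive t)| <= K) ->
  causal K (fun t => l (bochner_primitive t)).
Proof.
move=> bl hK.
have E : (fun t => l (bochner_primitive t)) = convol (powk 1) (l \o g).
  by apply/funext => t; exact: bochner_primitive_functional.
have mh : measurable_fun setT (l \o g).
  by apply: bochner_measurable_measurable => //; exact: bounded_functional_continuous.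
split => //.
  by rewrite E; apply: measurable_convol => //; exact: measurable_powk.
move=> t t0; rewrite (bochner_primitive_functional t bl) /convol /Rintegral (eq_integral (cst
  0%E)) ?integral0// => s _.
have [s0|s0] := leP s 0; first by rewrite functional_le0 ?mulr0.
by rewrite powk0 ?mul0r//; lra.
Qed.

End primitive.

(** * Convolution up to null sets and Abel inversion *)

Section almost_everywhere_convolution.
Context {R : realType}.
Local Notation mu := (@lebesgue_measure R).

Lemma eq_convol_ae (f h h' : R -> R) (t : R) : measurable_fun setT f ->
  measurable_fun setT h -> measurable_fun setT h' ->
  {ae mu, forall s, f (t - s) * h s = f (t - s) * h' s} -> convol f h t = convol f h' t.
Proof.
move=> mf mh mh' E; rewrite /convol /Rintegral; congr fine; apply: ae_eq_integral => //.
- exact: measurable_convol_EFin.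
- exact: measurable_convol_EFin.
- have := E; apply: (@filterS _ _ (@aeF R)) => s e _; by rewrite e.
Qed.

Context (al : R).
Hypotheses (al0 : 0 < al) (al1 : al < 1).
Local Notation k := (@powk R al).

Lemma convol_le0 (h : R -> R) (t : R) : (forall s, s <= 0 -> h s = 0) -> t <= 0 ->
  convol k h t = 0.
Proof.
move=> h0 t0; rewrite /convol /Rintegral (eq_integral (cst 0%E)) ?integral0// => s _.
have [s0|s0] := leP s 0; first by rewrite h0 ?mulr0.
by rewrite powk0 ?mul0r//; lra.
Qed.

(* Abel's inversion: powk (1 - al) * powk al is a multiple of powk 1. *)
Lemma convol_k_ae0 (h : R -> R) (T : R) : mu.-integrable setT (EFin \o h) ->
  (forall s, s <= 0 -> h s = 0) ->
  {ae mu, forall s, 0 < s < T -> convol k h s = 0} -> forall t, t <= T -> convol (powk 1) h t = 0.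
Proof.
move=> ih h0 ae0 t tT.
have mh : measurable_fun setT h by apply/measurable_EFinP; exact: measurable_int ih.
have b0 : 0 < 1 - al by rewrite subr_gt0.
have E : convol (powk (1 - al)) k = fun t => powk_beta (1 - al) al * powk 1 t.
  by apply/funext => s; rewrite (convol_powk s b0 al0).2 subrK.
have i1 : convolvable (powk 1) h t by exact: convolvable_powk1_integrable.
have H : convolvable (convol (powk (1 - al)) k) h t by rewrite E; exact: convolvableZl.
have [_ e _] := convolA (measurable_powk _) (measurable_powk _) mh (powk_ge0 _) (powk_ge0 al)
  (fun x => (convol_powk x b0 al0).1) H.
have kb : powk_beta (1 - al) al != 0 by rewrite gt_eqF// powk_beta_gt0.
apply: (mulfI kb); rewrite mulr0 -convolZl// -E -e.
rewrite (eq_convol_ae (h' := cst 0)).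
- rewrite /convol; under eq_Rintegral do rewrite mulr0.
  by rewrite Rintegral_cst// mul0r.
- exact: measurable_powk.
- by apply: measurable_convol => //; exact: measurable_powk.
- exact: measurable_cst.
- have := ae0; apply: (@filterS _ _ (@aeF R)) => s es.
  have [s0|s0] := leP s 0; first by rewrite convol_le0.
  have [ts|st] := leP t s; first by rewrite powk0 ?mul0r// subr_le0.
  by rewrite es ?s0 ?(lt_le_trans st).
Qed.

End almost_everywhere_convolution.

(** * Injectivity of the fractional integral and uniqueness of strong solutions *)

Section uniqueness.
Context {R : realType} {X : completeNormedModType R} (dot : {dot X for idfun}).
Hypothesis dotn : forall x : X, dot x x = `|x| ^+ 2.
Local Notation mu := (@lebesgue_measure R).
Context (al T : R).
Hypotheses (al0 : 0 < al) (al1 : al < 1) (T0 : 0 < T).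
Local Notation k := (@powk R al).

Let ci : 0 < (Gamma al)^-1. Proof. by rewrite invr_gt0 Gamma_gt0. Qed.

Lemma integrable_normB (f g : R -> X) : bochner_measurable f -> bochner_measurable g ->
  mu.-integrable setT (fun t => `|f t|%:E) -> mu.-integrable setT (fun t => `|g t|%:E) ->
  mu.-integrable setT (fun t => `|f t - g t|%:E).
Proof.
move=> bf bg i1 i2; apply: le_integrable (integrableD measurableT i1 i2) => //.
  by apply: measurableT_comp => //; apply: bochner_measurable_norm; exact: bochner_measurableB.
by move=> t _; rewrite /= lee_fin normr_id (ger0_norm (addr_ge0 _ _))//; exact: ler_normB.
Qed.

(** By Abel inversion, applied to each pairing, the difference has zero primitives. This also
    identifies [frac_derivative], an arbitrary choice among preimages, with any known one. *)
Lemma frac_integral_inj (w w1 w2 : R -> X) :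
  frac_integral_preimage al T w w1 -> frac_integral_preimage al T w w2 ->
  {ae mu, forall t, `]0, T[%classic t -> w1 t = w2 t}.
Proof.
move=> [l1 e1] [l2 e2].
have [g1 [b1 z1 a1 i1]] := L2_representative (fun x : X => lexx `|x|) l1.
have [g2 [b2 z2 a2 i2]] := L2_representative (fun x : X => lexx `|x|) l2.
have f1 := frac_integral_ae dotn al0 b1 i1 z1 a1.
have f2 := frac_integral_ae dotn al0 b2 i2 z2 a2.
pose g t := g1 t - g2 t.
have bg : bochner_measurable g by exact: bochner_measurableB.
have ig := integrable_normB b1 b2 i1 i2.
have gz t : ~ (0 < t < T) -> g t = 0 by move=> h; rewrite /g z1// z2// subrr.
have ae0 : {ae mu, forall t, g t = 0}.
  apply: (bochner_measurable_eq0_ae (T := T) dotn bg ig).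
    by move=> t Tt; apply: gz => /andP[_]; rewrite ltNge Tt.
  move=> z t tT; have bl := bounded_functional_dot dotn z.
  apply: (convol_k_ae0 al0 al1 (h := (fun x => dot x z) \o g) (T := T)) => //.
  - exact: integrable_functional.
  - by move=> s s0; exact: (functional_le0 gz bl s0).
  have := ae_and (ae_and f1 f2) (ae_and e1 e2).
  apply: (@filterS _ _ (@aeF R)) => s [[h1 h2] [h3 h4]] sT.
  have Is : `]0, T[%classic s by rewrite /= in_itv.
  have [c1 d1] := h1 sT _ bl; have [c2 d2] := h2 sT _ bl.
  have -> : (fun x => dot x z) \o g = fun s => ((fun x => dot x z) \o g1) s - ((fun x =>
    dot x z) \o g2) s.
    by apply/funext => u; rewrite /= /g dotBl.
  rewrite convolBr//; apply/eqP; rewrite subr_eq0; apply/eqP.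
  have cn : (Gamma al)^-1 != 0 by rewrite gt_eqF.
  by apply: (mulfI cn); rewrite -d1 -d2 h3// h4.
have := ae_and ae0 (ae_and a1 a2).
apply: (@filterS _ _ (@aeF R)) => t [h [h1 h2]] It.
by rewrite -h1// -h2//; apply/eqP; rewrite -subr_eq0; apply/eqP.
Qed.

Context (A : linear_operator X).
Hypothesis hrho : [set l : R | 0 < l] `<=` resolvent_set A.
Hypothesis hres : forall l : R, 0 < l -> l * operator_norm (resolvent A l) <= 1.

Let R1 := resolvent A 1.
Let l1 : 0 < (1 : R). Proof. exact: ltr01. Qed.
Let R1_le x : `|R1 x| <= `|x|.
Proof. by have := resolvent_le hrho hres x l1; rewrite mul1r. Qed.

Let bf_comp (L : X -> X) (K : R) z : (forall (a : R) x y, L (a *: x + y) = a *: L x + L y) ->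
  (forall x, `|L x| <= K * `|x|) -> bounded_functional (fun x => dot (L x) z).
Proof.
move=> Ll LK; split; first by move=> a x y; rewrite Ll dotPl.
exists (`|K| * `|z|) => x; apply: (le_trans (dot_CS dotn _ _)).
rewrite mulrAC; apply: ler_wpM2r => //; apply: (le_trans (LK x)).
by apply: ler_wpM2r => //; exact: ler_norm.
Qed.

(* The primitives of [d] and [g], smoothed by the resolvent, solve the equation
   everywhere, so the stability estimate applies with a forcing term O(1/l). *)
Lemma homogeneous_ae0 (d g : R -> X) : bochner_measurable d -> bochner_measurable g ->
  mu.-integrable setT (fun t => `|d t|%:E) -> mu.-integrable setT (fun t => `|g t|%:E) ->
  (forall t, ~ (0 < t < T) -> d t = 0) -> (forall t, ~ (0 < t < T) -> g t = 0) ->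
  {ae mu, forall t, d t = R1 (d t - g t)} ->
  {ae mu, forall t, 0 < t < T -> forall l, bounded_functional l ->
    l (d t) = (Gamma al)^-1 * convol k (l \o g) t} ->
  {ae mu, forall t, d t = 0}.
Proof.
move=> bd bg id_ ig zd zg dR deq.
pose D := bochner_primitive d; pose G := bochner_primitive g.
have Df l t (bl : bounded_functional l) : l (D t) = convol (powk 1) (l \o d) t.
  exact: (bochner_primitive_functional dotn bd id_ zd).
have Gf l t (bl : bounded_functional l) : l (G t) = convol (powk 1) (l \o g) t.
  exact: (bochner_primitive_functional dotn bg ig zg).
pose M := L1_norm d + L1_norm g.
have md := L1_norm_ge0 d; have mg := L1_norm_ge0 g.
have DM t : `|D t| <= M by apply: (le_trans (bochner_primitive_norm dotn bd id_ zd t));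
  rewrite lerDl.
have GM t : `|G t| <= M by apply: (le_trans (bochner_primitive_norm dotn bg ig zg t));
  rewrite lerDr.
have M0 : 0 <= M by rewrite addr_ge0.
have R1lin (a : R) x y : R1 (a *: x + y) = a *: R1 x + R1 y by exact: resolvent_linear.
have R1B x y : R1 (x - y) = R1 x - R1 y by exact: resolventB.
have bR z : bounded_functional (fun x => dot (R1 x) z).
  by apply: (bf_comp (K := 1)) => // x; rewrite mul1r.
have mfun (h : R -> X) l : bochner_measurable h -> bounded_functional l ->
  measurable_fun setT (l \o h).
  by move=> bh bl; apply: bochner_measurable_measurable => //;
    exact: bounded_functional_continuous.
(* The relation A d = g is carried in the form [d = R1 (d - g)]: [R1] is bounded and commutes with
   integration, while [A] is only closed. *)
have DE t : D t = R1 (D t - G t).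
  apply: (dot_inj dotn) => z; have bz := bounded_functional_dot dotn z.
  have E1 := Df _ t bz; have E2 := Df _ t (bR z); have E3 := Gf _ t (bR z).
  rewrite R1B dotBl; apply: (etrans E1); apply: esym;
    apply: (etrans (congr2 (fun p q => p - q) E2 E3)).
  apply: esym.
  have c1 := convolvable_powk1_integrable t (integrable_functional bd id_ (bR z)).
  have c2 := convolvable_powk1_integrable t (integrable_functional bg ig (bR z)).
  rewrite -convolBr//; apply: eq_convol_ae.
  - exact: measurable_powk.
  - exact: mfun.
  - by apply: measurable_funB; exact: mfun.
  have := dR; apply: (@filterS _ _ (@aeF R)) => s es; congr (_ * _).
  by rewrite /= {1}es R1B dotBl.
pose e t := R1 (D t); pose E t := R1 (G t).
have de t : op_dom A (e t) by exact: op_dom_resolvent.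
have dE t : op_dom A (E t) by exact: op_dom_resolvent.
have Ae t : A (e t) = E t.
  rewrite op_resolvent// scale1r -/R1 {2}DE R1B.
  by rewrite opprB addrC subrK.
(* Integration commutes with convolution by [k], and turns the equation for almost every time into
   one for every t <= T. *)
have eeq x t : t <= T -> dot (e t) x = (Gamma al)^-1 * convol k (fun s => dot (E s) x) t.
  move=> tT; rewrite [LHS](Df _ t (bR x)).
  set lx := fun y => dot (R1 y) x; have bx : bounded_functional lx := bR x.
  have mk := @measurable_powk R al; have m1 := @measurable_powk R 1.
  have mg' := mfun g lx bg bx.
  have ih := integrable_functional bg ig bx.
  have h0 s : s <= 0 -> (lx \o g) s = 0 by exact: (functional_le0 zg bx).
  have E1 : convol (powk 1) k = fun t => powk_beta 1 al * powk (al + 1) t.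
    by apply/funext => s; rewrite (convol_powk s (@ltr01 R) al0).2 addrC.
  have E2 : convol k (powk 1) = convol (powk 1) k by apply/funext => s; rewrite convolC.
  have H : convolvable (convol (powk 1) k) (lx \o g) t.
    by rewrite E1; apply: convolvableZl; exact: convolvable_k_integrable.
  have H' : convolvable (convol k (powk 1)) (lx \o g) t by rewrite E2.
  have [c1 c1E _] := convolA m1 mk mg' (powk_ge0 1) (powk_ge0 al) (fun x =>
    (convol_powk x (@ltr01 R) al0).1) H.
  have [c2 c2E _] := convolA mk m1 mg' (powk_ge0 al) (powk_ge0 1) (fun x =>
    (convol_powk x al0 (@ltr01 R)).1) H'.
  have -> : (fun s => dot (E s) x) = convol (powk 1) (lx \o g).
    by apply/funext => s; exact: (Gf lx s bx).
  rewrite c2E E2 -c1E -convolZr//; apply: eq_convol_ae => //.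
  - exact: mfun.
  - by apply: measurable_funM => //; exact: measurable_convol.
  have := deq; apply: (@filterS _ _ (@aeF R)) => s es.
  have [s0|s0] := leP s 0.
    by rewrite (functional_le0 zd bx s0) (convol_le0 _ h0 s0) !mulr0.
  have [ts|st] := leP t s; first by rewrite powk0 ?mul0r// subr_le0.
  by congr (_ * _); apply: es => //; rewrite s0 (lt_le_trans st).
have e_le l t : 0 < l -> t <= T ->
  `|e t| <= (2 * M / l) * ((Gamma al)^-1 * (powk_beta al 1 * powk (al + 1) T)).
  move=> l0 tT.
  have Yle x : `|yosida A l x| <= `|x| by exact: yosida_le.
  have Ylin (a : R) x y : yosida A l (a *: x + y) = a *: yosida A l x + yosida A l y.
    exact: yosida_linear.
  (* The error of replacing [A] by its Yosida approximation along [e]. As [E] lies in the domain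
     with [A (E t) = E t - G t], of norm at most 2 M, this error is at most 2 M / l. *)
  pose f t := E t - yosida A l (E t).
  have fle s : `|f s| <= 2 * M / l.
    rewrite ler_pdivlMr// mulrC; apply: (le_trans (yosida_dist_le hrho hres l0 (dE s))).
    rewrite op_resolvent// scale1r; apply: (le_trans (ler_normB _ _)).
    rewrite mulr_natl mulr2n; exact: lerD (le_trans (R1_le _) (GM s)) (GM s).
  apply: (@stability _ _ dot dotn al (Gamma al)^-1 l al0 al1 ci l0 (yosida A l) Yle e f M) tT
    => //.
  - by rewrite divr_ge0 ?mulr_ge0// ltW.
  - move=> x; apply: (causal_bochner_primitive dotn bd id_ zd (bR x)) => s.
    apply: (le_trans (dot_CS dotn _ _)); apply: ler_wpM2r => //.
    exact: le_trans (R1_le _) (DM s).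
  - move=> x.
    have bl : bounded_functional (fun y => dot (R1 y - yosida A l (R1 y)) x).
      apply: (bf_comp (L := fun y => R1 y - yosida A l (R1 y)) (K := 2)).
        by move=> a y z; rewrite R1lin Ylin opprD addrACA scalerBr.
      move=> y; apply: (le_trans (ler_normB _ _)); rewrite mulr_natl mulr2n.
      by apply: lerD => //; apply: le_trans (Yle _) _.
    apply: (causal_bochner_primitive dotn bg ig zg bl) => s.
    by apply: (le_trans (dot_CS dotn _ _)); apply: ler_wpM2r => //; exact: fle.
  - move=> x.
    have bl : bounded_functional (fun y => dot (yosida A l (R1 y)) x).
      apply: (bf_comp (L := fun y => yosida A l (R1 y)) (K := 1)).
        by move=> a y z; rewrite R1lin Ylin.
      by move=> y; rewrite mul1r; apply: le_trans (Yle _) _.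
    apply: (causal_bochner_primitive dotn bd id_ zd bl) => s.
    apply: (le_trans (dot_CS dotn _ _)); apply: ler_wpM2r => //.
    by apply: (le_trans (Yle _)); exact: le_trans (R1_le _) (DM s).
  - move=> x s sT; rewrite eeq//; congr (_ * convol k _ s); apply/funext => u; congr (dot _ x).
    by rewrite /f yosida_op// Ae addrC subrK.
have e0 t : t <= T -> e t = 0.
  move=> tT; apply/eqP; rewrite -normr_le0; apply/ler_addgt0Pr => eps eps0.
  rewrite add0r.
  set K := (Gamma al)^-1 * (powk_beta al 1 * powk (al + 1) T) in e_le.
  have K0 : 0 <= K by rewrite /K !mulr_ge0 ?(ltW ci) ?powk_ge0// ltW// powk_beta_gt0.
  have MK : 0 <= 2 * M * K by exact: mulr_ge0 (mulr_ge0 (ler0n _ 2) M0) K0.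
  (* Makes the bound 2 M K / l at most [eps], the added 1 keeping [l] positive. *)
  pose l := (2 * M * K + 1) / eps.
  have l0 : 0 < l by rewrite divr_gt0// ltr_wpDl.
  apply: (le_trans (e_le l t l0 tT)).
  rewrite mulrAC ler_pdivrMr// /l (mulrCA eps) divff ?gt_eqF// mulr1.
  by rewrite lerDl.
(* The resolvent is injective: A (R1 D) = R1 D - D. *)
have D0 t : t <= T -> D t = 0.
  move=> tT; have h := op_resolvent hrho (D t) l1.
  rewrite -/R1 -[R1 (D t)]/(e t) (e0 t tT) scaler0 sub0r op0 in h.
  by apply/eqP; rewrite -oppr_eq0 -h.
apply: (bochner_measurable_eq0_ae (T := T) dotn bd id_).
  by move=> t Tt; apply: zd => /andP[_]; rewrite ltNge Tt.
move=> z t tT; have bz := bounded_functional_dot dotn z.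
by have := Df _ t bz; rewrite D0// dot0l => <-.
Qed.

Lemma strong_solution_unique (a : X) (u v : R -> X) :
  strong_solution al T A a u -> strong_solution al T A a v ->
  {ae mu, forall t, `]0, T[%classic t -> v t = u t}.
Proof.
move=> [Lu Hu du] [Lv Hv dv].
have gnle x : `|x| <= graph_norm A x by rewrite /graph_norm lerDl.
(* Membership in [H_] makes the chosen derivative a genuine preimage rather than the default
   [cst 0]. *)
have pu : frac_integral_preimage al T (fun t => u t - a) (frac_derivative al T (fun t =>
  u t - a)).
  by have [w hw] := Hu; exact: (@xgetPex _ (cst 0) _ (ex_intro _ w hw)).
have pv : frac_integral_preimage al T (fun t => v t - a) (frac_derivative al T (fun t =>
  v t - a)).
  by have [w hw] := Hv; exact: (@xgetPex _ (cst 0) _ (ex_intro _ w hw)).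
set wu := frac_derivative al T (fun t => u t - a) in du pu.
set wv := frac_derivative al T (fun t => v t - a) in dv pv.
have [Lwu eu] := pu; have [Lwv ev] := pv.
have [gu [bu zu aeu iu]] := L2_representative gnle Lu.
have [gv [bv zv aev iv]] := L2_representative gnle Lv.
have [hu [bhu zhu aehu ihu]] := L2_representative (fun x : X => lexx `|x|) Lwu.
have [hv [bhv zhv aehv ihv]] := L2_representative (fun x : X => lexx `|x|) Lwv.
have fu := frac_integral_ae dotn al0 bhu ihu zhu aehu.
have fv := frac_integral_ae dotn al0 bhv ihv zhv aehv.
have [[Du _] [Dv _]] := (Lu, Lv).
pose d t := gv t - gu t; pose g t := hv t - hu t.
have F := @aeF R.
have zd t : ~ (0 < t < T) -> d t = 0 by move=> h; rewrite /d zu// zv// subrr.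
have zg t : ~ (0 < t < T) -> g t = 0 by move=> h; rewrite /g zhu// zhv// subrr.
have d0 : {ae mu, forall t, d t = 0}.
  apply: (@homogeneous_ae0 d g) => //; try exact: bochner_measurableB;
    try exact: integrable_normB.
  - have [Du' _] := Du; have [Dv' _] := Dv.
    have := ae_and (ae_and (ae_and Du' Dv') (ae_and aeu aev))
      (ae_and (ae_and du dv) (ae_and aehu aehv)).
    apply: (@filterS _ _ F) => t [[[h1 h2] [h3 h4]] [[h5 h6] [h7 h8]]].
    have [tT|/negP tT] := boolP (0 < t < T); last first.
      by rewrite zd// zg// subrr [R1 0]resolvent0.
    have It : `]0, T[%classic t by rewrite /= in_itv.
    have dd : d t = v t - u t by rewrite /d h3// h4.
    have dg : g t = A (v t) - A (u t) by rewrite /g h7// h8// h5// h6.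
    have dD : op_dom A (d t) by rewrite dd; apply: op_domB; [exact: h2|exact: h1].
    have gd : g t = A (d t) by rewrite dd opB//; [exact: h2|exact: h1].
    by rewrite gd -[X in R1 (X - _)]scale1r; apply/esym; exact: resolventK.
  - have := ae_and (ae_and fu fv) (ae_and (ae_and eu ev) (ae_and aeu aev)).
    apply: (@filterS _ _ F) => t [[h1 h2] [[h3 h4] [h5 h6]]] tT l bl.
    have It : `]0, T[%classic t by rewrite /= in_itv.
    have [c1 e1] := h1 tT l bl; have [c2 e2] := h2 tT l bl.
    have -> : l \o g = fun s => (l \o hv) s - (l \o hu) s.
      by apply/funext => s; rewrite /= /g bounded_functionalB.
    rewrite convolBr// mulrBr -e1 -e2 h3// h4// -bounded_functionalB//.
    by rewrite /d h5// h6// opprB addrA subrK.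
have := ae_and d0 (ae_and aeu aev); apply: (@filterS _ _ F) => t [h [h1 h2]] It.
by rewrite -h1// -h2//; apply/eqP; rewrite -subr_eq0; apply/eqP.
Qed.

End uniqueness.

(** * Finitely valued approximations of time *)

Section grid.
Context {R : realType} (T : R).
Local Notation mu := (@lebesgue_measure R).

(** Rounds down to the mesh 1/(n+1) inside (0, T); the value 0 outside keeps the range finite. *)
Definition grid_index (n : nat) (t : R) : nat :=
  if t \in `]0, T[ then Num.truncn (n.+1%:R * t) else 0%N.

Definition grid (n : nat) (t : R) : R := (grid_index n t)%:R / n.+1%:R.

Lemma finite_measurable_grid n : finite_measurable (grid n).
Proof.
apply: (finite_measurable_comp (fun k : nat => k%:R / n.+1%:R : R)); split.
  apply: (@sub_finite_set _ _ `I_(Num.truncn (n.+1%:R * T)).+1); last exact: finite_II.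
  move=> _ [t _ <-]; rewrite /= /grid_index; case: ifPn => //.
  rewrite in_itv /= => /andP[t0 tT]; rewrite ltnS; apply: le_truncn.
  by rewrite ler_pM2l ?ltr0n// ltW.
move=> k; have n0 : 0 < n.+1%:R :> R by rewrite ltr0n.
have mD : measurable (`]0, T[%classic : set R) by exact: measurable_itv.
have mE : measurable (`[k%:R / n.+1%:R, k.+1%:R / n.+1%:R[%classic :
  set R) by exact: measurable_itv.
rewrite (_ : _ @^-1` _ = (`]0, T[ `&` `[k%:R / n.+1%:R, k.+1%:R / n.+1%:R[) `|`
    (if k == 0%N then ~` `]0, T[ else set0)); last first.
  apply/seteqP; split => t /=.
    rewrite /grid_index; case: ifPn => [tT <-|tT <-]; last by right => /=; exact/negP.
    left; split => //; have t0 : 0 <= n.+1%:R * t.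
      by move: tT; rewrite in_itv /= => /andP[/ltW t0 _]; rewrite mulr_ge0.
    by rewrite in_itv /= ler_pdivrMr// ltr_pdivlMr// (mulrC t) truncn_itv.
  rewrite /grid_index => -[[tT]|].
    rewrite tT in_itv /= ler_pdivrMr// ltr_pdivlMr// (mulrC t) => h; exact: truncn_def.
  by case: eqP => // -> /= /negP/negbTE ->.
apply: measurableU; first exact: measurableI.
by case: eqP => _; [exact: measurableC|exact: measurable0].
Qed.

Lemma cvg_grid t : t \in `]0, T[ -> grid n t @[n --> \oo] --> t.
Proof.
move=> tT; apply/cvgrPdist_le => e e0.
have := (@near_infty_natSinv_lt R (PosNum e0)); apply: filterS => n /= ne.
have n0 : 0 < n.+1%:R :> R by rewrite ltr0n.
rewrite /grid /grid_index tT; apply: le_trans (ltW ne).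
have t0 : 0 <= n.+1%:R * t.
  by move: tT; rewrite in_itv /= => /andP[/ltW t0 _]; rewrite mulr_ge0.
have /andP[h1 h2] := truncn_itv t0.
rewrite ler_norml; apply/andP; split.
  rewrite lerBrDr; apply: (@le_trans _ _ (- n.+1%:R^-1 + t));
    last by rewrite gerDr oppr_le0 invr_ge0.
  by rewrite lerD2l ler_pdivrMr// (mulrC t).
rewrite lerBlDr -[X in X + _]mul1r -mulrDl ler_pdivlMr// (mulrC t).
by rewrite addrC natr1 ltW.
Qed.

End grid.

(** * Bounded continuous functions are square integrable *)

Section continuous_L2.
Context {R : realType} {X : completeNormedModType R}.
Local Notation mu := (@lebesgue_measure R).

(** Sampling on the grid gives simple functions whose values are values of [f], hence in [D].
    Continuity is sequential and measured by [N], since the pair [D], [N] carries no topology of its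
    own. *)
Lemma L2_of_bounded_continuous (D : set X) (N : X -> R) (T C : R) (f : R -> X) :
  (forall t, D (f t)) -> (forall t, 0 <= N (f t) <= C) ->
  (forall t (z : nat -> R), z n @[n --> \oo] --> t ->
     N (f t - f (z n)) @[n --> \oo] --> (0 : R)) ->
  L2 D N T f.
Proof.
move=> Df fC cf; split.
  split; first by apply: aeW => t.
  pose s n := f \o grid T n.
  have fs n : finite_measurable (s n) by apply: finite_measurable_comp;
    exact: finite_measurable_grid.
  exists (fun n => to_fimfun (fs n)); split; first by move=> n; apply: simple_fimfun => t;
    exact: Df.
  by apply: aeW => t It; apply: cf; exact: cvg_grid.
apply: (@le_lt_trans _ _ (\int[mu]_(t in `]0%R, T[) (C ^+ 2)%:E)%E).
  apply: (@ge0_le_integral_off_null _ _ _ mu _ set0) => //.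
  - by move=> t _; rewrite lee_fin sqr_ge0.
  - by move=> t _; rewrite lee_fin sqr_ge0.
  move=> t _ _; have /andP[f0 fC'] := fC t.
  by rewrite lee_fin lerXn2r// nnegrE// (le_trans f0).
have mD : measurable (`]0, T[%classic : set (measurableTypeR R)) by exact: measurable_itv.
rewrite integral_cst//; apply: lte_mul_pinfty => //; first by rewrite lee_fin sqr_ge0.
suff : (mu `]0%R, T[%classic < +oo)%E by [].
rewrite lebesgue_measure_itv /=; case: ifP => _; last exact: ltry.
by rewrite -EFinB ltry.
Qed.

End continuous_L2.

(** * The limit is a strong solution *)

Section existence.
Context {R : realType} {X : completeNormedModType R} (dot : {dot X for idfun}).
Hypothesis dotn : forall x : X, dot x x = `|x| ^+ 2.
Local Notation mu := (@lebesgue_measure R).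
Context (al T : R).
Hypotheses (al0 : 0 < al) (al1 : al < 1) (T0 : 0 < T).
Context (A : linear_operator X).
Hypothesis hclosed : closed_operator A.
Hypothesis hdense : densely_defined A.
Hypothesis hrho : [set l : R | 0 < l] `<=` resolvent_set A.
Hypothesis hres : forall l : R, 0 < l -> l * operator_norm (resolvent A l) <= 1.
Local Notation k := (@powk R al).
Local Notation u := (solution al (Gamma al)^-1 A).

Let ci : 0 < (Gamma al)^-1. Proof. by rewrite invr_gt0 Gamma_gt0. Qed.

Let u_cvg b t (z : nat -> R) : z n @[n --> \oo] --> t ->
  `|u t b - u (z n) b| @[n --> \oo] --> (0 : R).
Proof.
move=> zt; have cu := @solution_continuous _ _ _ dotn _ _ al0 al1 ci _ hrho hres hdense b t.
have h : u t b - u (z n) b @[n --> \oo] --> u t b - u t b.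
  by apply: cvgB; [exact: cvg_cst|exact: (cvg_comp z (fun t => u t b) zt cu)].
by have := cvg_norm h; rewrite subrr normr0 => h2; exact: h2.
Qed.

Lemma L2_solution b : L2 setT Num.norm T (fun t => u t b).
Proof.
apply: (@L2_of_bounded_continuous _ _ _ _ _ (`|b|)) => // [t|t z]; last exact: u_cvg.
by rewrite normr_ge0 (solution_norm dotn al0 al1 ci hrho hres hdense).
Qed.

Lemma L2_graph_solution a : op_dom A a -> L2 (op_dom A) (graph_norm A) T (fun t => u t a).
Proof.
move=> da; have uD t := (solution_op dotn al0 al1 ci hrho hres hdense hclosed t da).1.
have uA t := (solution_op dotn al0 al1 ci hrho hres hdense hclosed t da).2.
apply: (@L2_of_bounded_continuous _ _ _ _ _ (`|a| + `|A a|)) => // [t|t z zt].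
  rewrite addr_ge0//= /graph_norm uA.
  by apply: lerD; exact: (solution_norm dotn al0 al1 ci hrho hres hdense).
rewrite (_ : (fun n => _) = (fun n => `|u t a - u (z n) a| + `|u t (A a) - u (z n) (A a)|)).
  by rewrite -[0 in X in _ --> X](addr0 0); apply: cvgD; exact: u_cvg.
by apply/funext => n; rewrite /graph_norm opB// !uA.
Qed.

(** As A u_a is u_(A a), it is bounded and continuous, hence in L^2, and its fractional integral is
    found by comparing each pairing with [solution_eq]. *)
Lemma preimage_solution a : op_dom A a ->
  frac_integral_preimage al T (fun t => u t a - a) (fun t => A (u t a)).
Proof.
move=> da; have uA t := (solution_op dotn al0 al1 ci hrho hres hdense hclosed t da).2.
have -> : (fun t => A (u t a)) = (fun t => u t (A a)) by apply/funext => t; exact: uA.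
have L := L2_solution (A a); split => //.
have [g [bg zg ae_g ig]] := L2_representative (fun x => lexx `|x|) L.
have := frac_integral_ae dotn al0 bg ig zg ae_g.
apply: (@filterS _ _ (@aeF R)) => t h It; have tT : 0 < t < T by move: It; rewrite /= in_itv.
apply: (dot_inj dotn) => z; have bz := bounded_functional_dot dotn z.
rewrite (h tT _ bz).2 dotBl (solution_eq dotn al0 al1 ci hrho hres hdense)// addrAC subrr add0r.
congr (_ * _); apply: eq_convol_ae.
- exact: measurable_powk.
- exact: (bochner_measurable_measurable bg (bounded_functional_continuous bz)).
- by have [] := causal_dot_truncated_solution dotn al0 al1 ci hrho hres hdense (A a) z.
have := ae_g; apply: (@filterS _ _ (@aeF R)) => s gs.
have [s0|s0] := leP s 0.
  rewrite /= zg ?dot0l ?truncated_solution_le0//; last by move=> /andP[]; rewrite ltNge s0.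
  by rewrite dot0l.
have [ts|st] := leP t s; first by rewrite powk0 ?mul0r// subr_le0.
(* On (0, t) the representative, [solution] and [truncated_solution] agree almost everywhere. *)
congr (_ * dot _ z); rewrite gs ?solution_gt0//.
by rewrite /= in_itv/= s0 (lt_trans st)//; case/andP: tT.
Qed.

Lemma strong_solution_exists a : op_dom A a -> strong_solution al T A a (fun t => u t a).
Proof.
move=> da; have pu := preimage_solution da; split; first exact: L2_graph_solution.
  by exists (fun t => A (u t a)).
(* [frac_derivative] is some preimage of u - a; injectivity identifies it almost everywhere with A
   u. *)
by apply: (frac_integral_inj dotn al0 al1 _ pu); exact: (xgetPex _ (ex_intro _ _ pu)).
Qed.

End existence.

Theorem corollary2p6 (R : realType) (X : completeNormedModType R)
    (dot : {dot X for idfun})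
    (hdot : forall x : X, dot x x = `|x| ^+ 2)
    (alpha T : R) (halpha : 0 < alpha < 1) (hT : 0 < T)
    (A : linear_operator X)
    (hclosed : closed_operator A) (hdense : densely_defined A)
    (hrho : [set l : R | 0 < l] `<=` resolvent_set A)
    (hres : forall l : R, 0 < l -> l * operator_norm (resolvent A l) <= 1)
    (a : X) (ha : op_dom A a) :
  exists u : R -> X,
    [/\ strong_solution alpha T A a u,
        (forall v : R -> X, strong_solution alpha T A a v ->
           v = u %[ae lebesgue_measure in `]0, T[%classic]),
        {within `[0, T], continuous u},
        {within `[0, T], continuous (A \o u)} &
        forall t : R, t \in `[0, T] ->
          [/\ op_dom A (u t), `|u t| <= `|a| & `|A (u t)| <= `|A a|]].
Proof.
have /andP[al0 al1] := halpha.
have ci : 0 < (Gamma alpha)^-1 by rewrite invr_gt0 Gamma_gt0.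
have uop t := solution_op hdot al0 al1 ci hrho hres hdense hclosed t ha.
have sol := strong_solution_exists hdot T al0 al1 hclosed hdense hrho hres ha.
have uc b : continuous (fun t => solution alpha (Gamma alpha)^-1 A t b).
  by move=> t; exact: (@solution_continuous _ _ _ hdot _ _ al0 al1 ci _ hrho hres hdense b t).
exists (fun t => solution alpha (Gamma alpha)^-1 A t a); split => //.
- by move=> v; exact: (strong_solution_unique hdot).
- exact/continuous_subspaceT/uc.
- rewrite (_ : A \o _ = fun t => solution alpha (Gamma alpha)^-1 A t (A a)); last first.
    by apply/funext => t; exact: (uop t).2.
  exact/continuous_subspaceT/uc.
- move=> t _; have [dV AV] := uop t; split => //; first exact: (solution_norm hdot).
  by rewrite AV; exact: (solution_norm hdot).
Qed.
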